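(* For any skewfields $F_1$ and $F_2$ the categories $\textup{mod-}F_1$ and $\textup{mod-}F_2$ are elementarily equivalent if and only if the structures $\langle \mathrm{Cn},F_1\rangle$ and $\langle \mathrm{Cn},F_2\rangle$ are equivalent in the second-order logic $L_2$.
   Context: The ambient set theory is NBG (von Neumann--Bernays--G\''odel, with choice). $\mathrm{Cn}$ is the class of all cardinal numbers (initial ordinals; a cardinal is identified with the set of smaller ordinals). $\textup{mod-}R$ is the category of all left $R$-modules and all homomorphisms. The first order language of category theory has variables for objects and for morphisms, equality, and expressions for ''$f\in \mathrm{Mor}(X,Y)$'', ''$h=f\circ g$'' and ''$f=1_X$''. Two categories are elementarily equivalent if the same sentences of this language hold in both. The second-order logic $L_2$ of the structure $\langle \mathrm{Cn},\mathsf{ring}\rangle$ (where $\mathsf{ring}$ stands for a ring, with its operations $+$ and $\cdot$): formulas are built by the logical connectives from: quantifiers $\forall r\in\mathsf{ring}$, $\exists r\in \mathsf{ring}$; quantifiers $\forall\varkappa\in\mathrm{Cn}$, $\exists\varkappa\in\mathrm{Cn}$; quantifiers $\forall\alpha\in\varkappa$, $\exists\alpha\in\varkappa$, where $\varkappa$ is a free or previously introduced cardinal variable; atomic formulas $r_1=r_2+r_3$, $r_1=r_2\cdot r_3$, $r_1=r_2$, $\varkappa_1=\varkappa_2$, $\alpha_1=\alpha_2$; quantifiers $\forall$, $\exists$ over predicate variables $P_{\varkappa_1,\dots,\varkappa_k}(c_1,\dots,c_k;v_1,\dots,v_n)$, where $\varkappa_1,\dots,\varkappa_k$ are free or previously introduced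 cardinal variables, ranging over arbitrary relations $P\subseteq \varkappa_1\times\dots\times\varkappa_k\times \mathsf{ring}^n$; and atomic formulas $P_{\varkappa_1,\dots,\varkappa_k}(\alpha_1,\dots,\alpha_k;r_1,\dots,r_n)$ with $\alpha_i\in\varkappa_i$, $r_j\in \mathsf{ring}$. Structures $\langle \mathrm{Cn},R\rangle$ and $\langle \mathrm{Cn},S\rangle$ are equivalent in $L_2$ if the same sentences of this language are true in both. *)

(* Defs.v *)
From HB Require Import structures.
From mathcomp Require Import all_boot all_algebra.
From mathcomp Require Import boolp classical_sets.

Set Implicit Arguments.
Unset Strict Implicit.
Unset Printing Implicit Defensive.

Import GRing.Theory.
Local Open Scope quotient_scope.

(** * The universe of sets *)

(** The ambient set theory is realised by Aczel's well-founded trees, quotiented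
    by extensional equality: [V] is the class of all sets, and the classes of
    NBG are the predicates on [V]. *)

Inductive tree : Type := Sup (A : Type) (f : A -> tree).

Fixpoint bisim (s t : tree) : Prop :=
  let: Sup A f := s in let: Sup B g := t in
  (forall a, exists b, bisim (f a) (g b)) /\
  (forall b, exists a, bisim (f a) (g b)).

Lemma bisim_refl s : bisim s s.
Proof. by elim: s => A f IH /=; split=> a; exists a. Qed.

Lemma bisim_sym s t : bisim s t -> bisim t s.
Proof.
elim: s t => A f IH [B g] /= [fg gf]; split=> [b|a].
  by have [a /IH] := gf b; exists a.
by have [b /IH] := fg a; exists b.
Qed.

Lemma bisim_trans t s u : bisim s t -> bisim t u -> bisim s u.
Proof.
elim: t s u => B g IH [A f] [C h] /= [fg gf] [gh hg]; split=> [a|c].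
  by have [b ab] := fg a; have [c bc] := gh b; exists c; apply: IH bc.
by have [b bc] := hg c; have [a ab] := gf b; exists a; apply: IH bc.
Qed.

HB.instance Definition _ := gen_eqMixin tree.
HB.instance Definition _ := gen_choiceMixin tree.

Definition bisimb : rel tree := fun s t => `[< bisim s t >].

Lemma bisimb_refl : reflexive bisimb.
Proof. by move=> s; apply/asboolP/bisim_refl. Qed.
Lemma bisimb_sym : symmetric bisimb.
Proof. by move=> s t; apply/asboolP/asboolP; apply: bisim_sym. Qed.
Lemma bisimb_trans : transitive bisimb.
Proof.
move=> t s u /asboolP st /asboolP tu; apply/asboolP.
exact: bisim_trans st tu.
Qed.

Canonical bisim_equiv := EquivRel bisimb bisimb_refl bisimb_sym bisimb_trans.

Definition V : Type := {eq_quot bisim_equiv}.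
HB.instance Definition _ := Choice.on V.

Definition to_V (s : tree) : V := \pi_({eq_quot bisim_equiv}) s.
Definition of_V (x : V) : tree := repr (x : {eq_quot bisim_equiv}).

Definition elt (x y : V) : Prop :=
  let: Sup A f := of_V y in exists a, x = to_V (f a).

Notation "x ∈ y" := (elt x y) (at level 70, no associativity).
Notation "x ∉ y" := (~ elt x y) (at level 70, no associativity).

Definition range_V (A : Type) (f : A -> V) : V := to_V (Sup (fun a => of_V (f a))).

Lemma of_VK : cancel of_V to_V.
Proof. by move=> x; rewrite /to_V /of_V reprK. Qed.

Lemma to_V_eq s t : to_V s = to_V t <-> bisim s t.
Proof.
split=> [/eqmodP/asboolP //|st]; apply/eqmodP/asboolP; exact: st.
Qed.

Lemma elt_to_V x A (f : A -> tree) :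
  x ∈ to_V (Sup f) <-> exists a, x = to_V (f a).
Proof.
have /to_V_eq := of_VK (to_V (Sup f)); rewrite /elt.
case: (of_V _) => B g /= [gf fg]; split=> -[].
  by move=> b ->; have [a /to_V_eq->] := gf b; exists a.
by move=> a ->; have [b /to_V_eq<-] := fg a; exists b.
Qed.

Lemma elt_range_V x A (f : A -> V) : x ∈ range_V f <-> exists a, x = f a.
Proof. by rewrite elt_to_V; split=> -[a ->]; exists a; rewrite of_VK. Qed.

Lemma is_range_V (y : V) :
  exists (A : Type) (f : A -> V), y = range_V f.
Proof.
rewrite -(of_VK y); case: (of_V y) => A f; exists A, (fun a => to_V (f a)).
by apply/to_V_eq; split=> a; exists a; apply/to_V_eq; rewrite of_VK.
Qed.

(** [V] is a model of NBG.  Class extensionality and comprehension are immediate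
    for predicates on [V]; the remaining axioms follow. *)

Lemma V_extensionality x y : (forall z, z ∈ x <-> z ∈ y) -> x = y.
Proof.
have [A [f ->]] := is_range_V x; have [B [g ->]] := is_range_V y => xy.
apply/to_V_eq; split=> [a|b].
  have /xy/elt_range_V[b fg] : f a ∈ range_V f by apply/elt_range_V; exists a.
  by exists b; apply/to_V_eq; rewrite fg.
have /xy/elt_range_V[a gf] : g b ∈ range_V g by apply/elt_range_V; exists b.
by exists a; apply/to_V_eq; rewrite gf.
Qed.

Lemma V_foundation (C : set V) :
  (exists x, C x) -> exists2 x, C x & forall y, y ∈ x -> ~ C y.
Proof.
move=> [x0 Cx0]; apply: contrapT => noC; move: Cx0; rewrite -(of_VK x0).
elim: (of_V x0) => A f IH Cx; apply: noC; exists (to_V (Sup f)) => // y.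
by move=> /elt_to_V[a ->]; apply: IH.
Qed.

Lemma V_pairing x y : exists p, forall z, z ∈ p <-> z = x \/ z = y.
Proof.
exists (range_V (fun b : bool => if b then x else y)) => z.
rewrite elt_range_V; split=> [[[] ->]|[]->]; [by left|by right| |].
  by exists true.
by exists false.
Qed.

Lemma V_union x : exists u, forall z, z ∈ u <-> exists2 y, y ∈ x & z ∈ y.
Proof.
rewrite -(of_VK x); case: (of_V x) => A f.
pose idx t := let: Sup B _ := t in B.
pose sub t : idx t -> tree := let: Sup B g := t in g.
exists (to_V (Sup (fun p : {a : A & idx (f a)} => sub _ (tagged p)))) => z.
rewrite elt_to_V; split=> [[[a b] ->]|[y /elt_to_V[a ->]]].
  exists (to_V (f a)); first by apply/elt_to_V; exists a.
  by move: b => /=; case: (f a) => B g b; apply/elt_to_V; exists b.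
move=> za; have [b ->] : exists b, z = to_V (@sub (f a) b).
  by move: za; case: (f a) => B g /elt_to_V.
by exists (existT _ a b).
Qed.

Lemma V_powerset x : exists p, forall z, z ∈ p <-> forall y, y ∈ z -> y ∈ x.
Proof.
have [A [f ->]] := is_range_V x.
exists (range_V (fun P : A -> Prop => range_V (fun a : {a | P a} => f (sval a)))).
move=> z; rewrite elt_range_V; split=> [[P ->] y|zx].
  by move=> /elt_range_V[a ->]; apply/elt_range_V; exists (sval a).
exists (fun a => f a ∈ z); apply: V_extensionality => y; rewrite elt_range_V.
split=> [yz|[[a faz] -> //]]; have /elt_range_V[a ya] := zx _ yz.
by rewrite ya in yz *; exists (exist _ a yz).
Qed.

Lemma V_infinity : exists w, (exists2 e, e ∈ w & forall z, z ∉ e) /\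
  forall x, x ∈ w -> exists2 y, y ∈ w & forall z, z ∈ y <-> z ∈ x \/ z = x.
Proof.
have succ x : exists y, forall z, z ∈ y <-> z ∈ x \/ z = x.
  have [A [f ->]] := is_range_V x.
  exists (range_V (fun o : option A => if o is Some a then f a else range_V f)).
  move=> z; rewrite !elt_range_V; split=> [[[a|] ->]|[[a ->]|->]].
  - by left; exists a.
  - by right.
  - by exists (Some a).
  - by exists None.
have [s sP] := choice succ.
pose e := range_V (fun v : void => of_void V v).
exists (range_V (fun n => iter n s e)); split.
  by exists e => [|z]; rewrite elt_range_V; [exists 0|case=> -[]].
move=> x /elt_range_V[n ->]; exists (s (iter n s e)); last exact: sP.
by apply/elt_range_V; exists n.+1.
Qed.

Lemma V_replacement (F : V -> V) x :
  exists r, forall z, z ∈ r <-> exists2 y, y ∈ x & z = F y.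
Proof.
have [A [f ->]] := is_range_V x; exists (range_V (F \o f)) => z.
rewrite elt_range_V; split=> [[a ->]|[y /elt_range_V[a ->] ->]].
  by exists (f a) => //; apply/elt_range_V; exists a.
by exists a.
Qed.

Lemma V_global_choice :
  exists c : V -> V, forall x, (exists y, y ∈ x) -> c x ∈ x.
Proof.
have /choice[c cP] x : exists y, (exists z, z ∈ x) -> y ∈ x.
  by have [[y yx]|nx] := pselect (exists y, y ∈ x); [exists y|exists x].
by exists c.
Qed.

Definition El (x : V) : Type := {y : V | y ∈ x}.
HB.instance Definition _ (x : V) := gen_eqMixin (El x).
HB.instance Definition _ (x : V) := gen_choiceMixin (El x).

(** * Cardinal numbers *)

Definition elt_well_orders (a : V) : Prop :=
  [/\ forall x, x ∈ a -> x ∉ x,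
      forall x y z, x ∈ a -> y ∈ a -> z ∈ a -> x ∈ y -> y ∈ z -> x ∈ z
    & forall b, (forall x, x ∈ b -> x ∈ a) -> (exists x, x ∈ b) ->
        exists2 m, m ∈ b & forall x, x ∈ b -> x = m \/ m ∈ x].

Definition ordinal_V (a : V) : Prop :=
  (forall x y, x ∈ y -> y ∈ a -> x ∈ a) /\ elt_well_orders a.

Definition equipotent (x y : V) : Prop := exists f : El x -> El y, bijective f.

Definition cardinal_V (k : V) : Prop :=
  ordinal_V k /\ forall a, a ∈ k -> ~ equipotent a k.

Definition Cn : Type := {k : V | cardinal_V k}.
Definition set_of_card (k : Cn) : V := sval k.
Coercion set_of_card : Cn >-> V.

(** * Skewfields and modules *)

Definition nzRing_on (x : V) (m : GRing.isNzRing (El x)) : nzRingType :=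
  HB.pack (El x) m.
Definition zmod_on (x : V) (m : GRing.isZmodule (El x)) : zmodType :=
  HB.pack (El x) m.

Record skewfield := Skewfield {
  skewfield_set : V;
  skewfield_nzRing : GRing.isNzRing (El skewfield_set);
  skewfield_inv : forall x : nzRing_on skewfield_nzRing, x <> 0%R ->
    exists y : nzRing_on skewfield_nzRing, (y * x = 1 /\ x * y = 1)%R
}.

Definition skewfield_ring (F : skewfield) : nzRingType :=
  nzRing_on (skewfield_nzRing F).
Coercion skewfield_ring : skewfield >-> GRing.NzRing.type.

(** Equality of these records is equality of the underlying sets and of the
    operations: the choice structure of [El] is fixed once and for all and is
    not part of the data. *)
Record lmodule (R : nzRingType) := Lmodule {
  lmodule_set : V;
  lmodule_zmod : GRing.isZmodule (El lmodule_set);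
  lmodule_lmod : GRing.Zmodule_isLmodule R (zmod_on lmodule_zmod)
}.

Definition lmodule_lmodType (R : nzRingType) (M : lmodule R) : lmodType R :=
  HB.pack (El (lmodule_set M)) (zmod_on (lmodule_zmod M)) (lmodule_lmod M).
Coercion lmodule_lmodType : lmodule >-> GRing.Lmodule.type.

(** * Categories and their first-order language *)

Record category := Category {
  obj : Type;
  hom : obj -> obj -> Type;
  idm : forall X, hom X X;
  cmp : forall X Y Z, hom Y Z -> hom X Y -> hom X Z;
  cmp1m : forall X Y (f : hom X Y), cmp (idm Y) f = f;
  cmpm1 : forall X Y (f : hom X Y), cmp f (idm X) = f;
  cmpA : forall X Y Z T (h : hom Z T) (g : hom Y Z) (f : hom X Y),
    cmp h (cmp g f) = cmp (cmp h g) f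
}.

(** A morphism determines its domain and codomain. *)
Record morphism (C : category) := Morphism {
  dom : obj C;
  cod : obj C;
  arrow : hom dom cod
}.

Section ModCategory.
Variable R : nzRingType.

Lemma linear_ext (M N : lmodType R) (f g : {linear M -> N}) : f =1 g -> f = g.
Proof.
case: f g => f [fl fs] [g [gl gs]] /= /funext fg; subst g.
case: fl fs gl gs => [fl] [fs] [gl] [gs].
by rewrite (Prop_irrelevance fl gl) (Prop_irrelevance fs gs).
Qed.

Definition Mod : category.
Proof.
by refine (@Category (lmodule R) (fun M N => {linear M -> N})
  (fun M => idfun) (fun M N P g f => g \o f) _ _ _);
  move=> *; apply: linear_ext.
Defined.

End ModCategory.

(** Object and morphism variables are named by natural numbers. *)
Inductive cat_formula : Type :=
| CMor (f X Y : nat)             (* f ∈ Mor(X, Y) *)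
| CComp (h f g : nat)            (* h = f ∘ g *)
| CId (f X : nat)                (* f = 1_X *)
| CEqO (X Y : nat)
| CEqM (f g : nat)
| CNot (p : cat_formula)
| CAnd (p q : cat_formula)
| COr (p q : cat_formula)
| CImp (p q : cat_formula)
| CAllO (X : nat) (p : cat_formula)
| CExO (X : nat) (p : cat_formula)
| CAllM (f : nat) (p : cat_formula)
| CExM (f : nat) (p : cat_formula).

(** [os] and [ms] list the object and morphism variables in scope. *)
Fixpoint cat_wf (os ms : seq nat) (p : cat_formula) : bool :=
  match p with
  | CMor f X Y => [&& f \in ms, X \in os & Y \in os]
  | CComp h f g => [&& h \in ms, f \in ms & g \in ms]
  | CId f X => (f \in ms) && (X \in os)
  | CEqO X Y => (X \in os) && (Y \in os)
  | CEqM f g => (f \in ms) && (g \in ms)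
  | CNot p => cat_wf os ms p
  | CAnd p q | COr p q | CImp p q => cat_wf os ms p && cat_wf os ms q
  | CAllO X p | CExO X p => cat_wf (X :: os) ms p
  | CAllM f p | CExM f p => cat_wf os (f :: ms) p
  end.

Definition cat_sentence (p : cat_formula) : bool := cat_wf [::] [::] p.

Section CatSemantics.
Variable C : category.

Fixpoint cat_sat (eo : nat -> obj C) (em : nat -> morphism C) (p : cat_formula)
    : Prop :=
  match p with
  | CMor f X Y => dom (em f) = eo X /\ cod (em f) = eo Y
  | CComp h f g => exists X Y Z (u : hom Y Z) (v : hom X Y),
      [/\ em f = Morphism u, em g = Morphism v & em h = Morphism (cmp u v)]
  | CId f X => em f = Morphism (idm (eo X))
  | CEqO X Y => eo X = eo Y
  | CEqM f g => em f = em g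
  | CNot p => ~ cat_sat eo em p
  | CAnd p q => cat_sat eo em p /\ cat_sat eo em q
  | COr p q => cat_sat eo em p \/ cat_sat eo em q
  | CImp p q => cat_sat eo em p -> cat_sat eo em q
  | CAllO X p => forall x, cat_sat [eta eo with X |-> x] em p
  | CExO X p => exists x, cat_sat [eta eo with X |-> x] em p
  | CAllM f p => forall u, cat_sat eo [eta em with f |-> u] p
  | CExM f p => exists u, cat_sat eo [eta em with f |-> u] p
  end.

Definition cat_holds (p : cat_formula) : Prop :=
  forall eo em, cat_sat eo em p.

End CatSemantics.

Definition elementarily_equivalent (C D : category) : Prop :=
  forall p, cat_sentence p -> (cat_holds C p <-> cat_holds D p).

(** * The second-order logic of the structure of cardinals and a ring *)

(** The four sorts of variables (ring elements, cardinals, elements of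
    cardinals, predicates) are named by natural numbers, independently of each
    other.  A predicate variable receives its cardinal variables
    [ks = κ_1, …, κ_k] and its number [n] of ring arguments at its binder. *)
Inductive L2_formula : Type :=
| LAdd (r1 r2 r3 : nat)                   (* r1 = r2 + r3 *)
| LMul (r1 r2 r3 : nat)                   (* r1 = r2 * r3 *)
| LEqR (r1 r2 : nat)
| LEqC (k1 k2 : nat)
| LEqE (a1 a2 : nat)
| LPred (P : nat) (cs vs : seq nat)       (* P(cs; vs) *)
| LNot (p : L2_formula)
| LAnd (p q : L2_formula)
| LOr (p q : L2_formula)
| LImp (p q : L2_formula)
| LAllR (r : nat) (p : L2_formula)
| LExR (r : nat) (p : L2_formula)
| LAllC (k : nat) (p : L2_formula)
| LExC (k : nat) (p : L2_formula)
| LAllE (a k : nat) (p : L2_formula)      (* ∀ a ∈ k, p *)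
| LExE (a k : nat) (p : L2_formula)       (* ∃ a ∈ k, p *)
| LAllP (P : nat) (ks : seq nat) (n : nat) (p : L2_formula)
| LExP (P : nat) (ks : seq nat) (n : nat) (p : L2_formula).

(** The arguments [rs], [ks], [es], [ps] list the variables in scope, an element
    variable together with its cardinal variable, a predicate variable together
    with its type.  A bound name must be fresh, so that the cardinal variables
    recorded in [es] and [ps] are never rebound. *)
Fixpoint L2_wf (rs ks : seq nat) (es : seq (nat * nat))
    (ps : seq (nat * (seq nat * nat))) (p : L2_formula) : bool :=
  match p with
  | LAdd r1 r2 r3 | LMul r1 r2 r3 => [&& r1 \in rs, r2 \in rs & r3 \in rs]
  | LEqR r1 r2 => (r1 \in rs) && (r2 \in rs)
  | LEqC k1 k2 => (k1 \in ks) && (k2 \in ks)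
  | LEqE a1 a2 => (a1 \in unzip1 es) && (a2 \in unzip1 es)
  | LPred P cs vs =>
      all (mem rs) vs &&
      has (fun d => [&& d.1 == P, size vs == d.2.2
                      & all2 (fun a k => (a, k) \in es) cs d.2.1]) ps
  | LNot p => L2_wf rs ks es ps p
  | LAnd p q | LOr p q | LImp p q => L2_wf rs ks es ps p && L2_wf rs ks es ps q
  | LAllR r p | LExR r p => (r \notin rs) && L2_wf (r :: rs) ks es ps p
  | LAllC k p | LExC k p => (k \notin ks) && L2_wf rs (k :: ks) es ps p
  | LAllE a k p | LExE a k p =>
      [&& a \notin unzip1 es, k \in ks & L2_wf rs ks ((a, k) :: es) ps p]
  | LAllP P js n p | LExP P js n p =>
      [&& P \notin unzip1 ps, all (mem ks) js
        & L2_wf rs ks es ((P, (js, n)) :: ps) p]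
  end.

Definition L2_sentence (p : L2_formula) : bool := L2_wf [::] [::] [::] [::] p.

Section L2Semantics.
Variable R : nzRingType.
Local Open Scope classical_set_scope.

Fixpoint card_prod (js : seq Cn) (cs : seq V) : Prop :=
  match js, cs with
  | [::], [::] => True
  | k :: js, a :: cs => a ∈ k /\ card_prod js cs
  | _, _ => False
  end.

(** The product [κ_1 × … × κ_k × R^n]. *)
Definition rel_dom (js : seq Cn) (n : nat) : set (seq V * seq R) :=
  [set c | card_prod js c.1 /\ size c.2 = n].

Fixpoint L2_sat (er : nat -> R) (ek : nat -> Cn) (ee : nat -> V)
    (ep : nat -> set (seq V * seq R)) (p : L2_formula) : Prop :=
  match p with
  | LAdd r1 r2 r3 => er r1 = (er r2 + er r3)%R
  | LMul r1 r2 r3 => er r1 = (er r2 * er r3)%R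
  | LEqR r1 r2 => er r1 = er r2
  | LEqC k1 k2 => ek k1 = ek k2
  | LEqE a1 a2 => ee a1 = ee a2
  | LPred P cs vs => ep P (map ee cs, map er vs)
  | LNot p => ~ L2_sat er ek ee ep p
  | LAnd p q => L2_sat er ek ee ep p /\ L2_sat er ek ee ep q
  | LOr p q => L2_sat er ek ee ep p \/ L2_sat er ek ee ep q
  | LImp p q => L2_sat er ek ee ep p -> L2_sat er ek ee ep q
  | LAllR r p => forall x, L2_sat [eta er with r |-> x] ek ee ep p
  | LExR r p => exists x, L2_sat [eta er with r |-> x] ek ee ep p
  | LAllC k p => forall x, L2_sat er [eta ek with k |-> x] ee ep p
  | LExC k p => exists x, L2_sat er [eta ek with k |-> x] ee ep p
  | LAllE a k p =>
      forall x, x ∈ ek k -> L2_sat er ek [eta ee with a |-> x] ep p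
  | LExE a k p =>
      exists2 x, x ∈ ek k & L2_sat er ek [eta ee with a |-> x] ep p
  | LAllP P js n p =>
      forall Q, Q `<=` rel_dom (map ek js) n ->
        L2_sat er ek ee [eta ep with P |-> Q] p
  | LExP P js n p =>
      exists2 Q, Q `<=` rel_dom (map ek js) n &
        L2_sat er ek ee [eta ep with P |-> Q] p
  end.

Definition L2_holds (p : L2_formula) : Prop :=
  forall er ek ee ep, L2_sat er ek ee ep p.

End L2Semantics.

Definition L2_equivalent (R S : nzRingType) : Prop :=
  forall p, L2_sentence p -> (L2_holds R p <-> L2_holds S p).

(* Main.v *)
From HB Require Import structures.
From mathcomp Require Import all_boot all_algebra.
From mathcomp Require Import boolp classical_sets wochoice zify.
From mathcomp.multinomials Require Import freeg.
Require Import Defs.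

(** Both languages describe the same second-order structure.

    From L2 to the category.  All lines are isomorphic, a line [U] is recognised
    by a first-order condition, and its endomorphisms form the opposite of [F].
    A free module with an index set [I] of the size of a cardinal carries a
    distinguished family of maps [e i] from [U] ([i] in [I]).  This family is
    definable from finitely many morphisms: on the free module over the
    labellings by [I] of a set of positions one fixes a finite list of operators
    whose commutant is rigid enough to force every idempotent of rank one that is
    compatible with it to be the projection to a basis vector.  Any family of
    morphisms out of [U] indexed by [I] is then [l \o e i] for one morphism [l],
    so arbitrary relations on [I] and [F] are coded by finitely many morphisms,
    and cardinals by initial well-orders on such sets.

    From the category to L2.  A module is coded by a cardinal together with two
    relations on it, the graphs of addition and scaling, and a homomorphism by
    its graph.  The code also carries a cardinal as a label, so that every
    module has infinitely many codes, just as it has infinitely many isomorphic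
    copies; hence the category of modules and the equivalent category of codes
    satisfy the same sentences, by a back-and-forth argument. *)

Set Implicit Arguments.
Unset Strict Implicit.
Unset Printing Implicit Defensive.

Import GRing.Theory.

(** * Free modules *)

(** Only finitely many morphisms can be quantified, yet they have to single out a basis of arbitrary
    size, and a free module has automorphisms that move its bases. Commuting with a self-map of the
    basis makes supports natural under that map, so rigidity becomes combinatorial: a natural
    assignment of finite sets of labellings to labellings must keep the distinguished element at
    some labelling over each point. A well-order on the index set still admits strictly increasing
    self-maps that move points, as a successor map does. The parity of shifts excludes them: a moved
    point has an injective orbit, on which the map acts as a shift and flips the parity.

    The opposite ring does no harm: products are read off with the two factors exchanged, so [F]
    itself is recovered.

    For the converse, equality of objects belongs to the language, so an equivalence of categories
    alone does not preserve truth. The game therefore pairs objects with codes one to one, and a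
    move may need a partner that has not been used. *)

Section FreeModule.
Variables (R : nzRingType) (K : choiceType).
Local Open Scope ring_scope.

Lemma freeg_ind (P : {freeg K / R} -> Prop) :
  P 0 -> (forall a k x, P x -> P (<< a *g k >> + x)) -> forall x, P x.
Proof.
move=> P0 PD x; rewrite -(freeg_sumE x).
by elim: (freeg.dom x) => [|k s IH]; rewrite ?big_nil // big_cons; apply: PD.
Qed.

Lemma freegZ (a b : R) (k : K) : a *: << b *g k >> = << (a * b) *g k >>.
Proof. by apply/eqP/freeg_eqP => l; rewrite coeffZ !coeffU mulrA. Qed.

Section Lift.
Variables (M : lmodType R) (f : K -> M).

Lemma fglift0 : fglift f 0 = 0.
Proof. by rewrite -(@freeg_nil R K) fglift_Freeg /prelift big_nil. Qed.

Fact fglift_is_linear : linear (fglift f).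
Proof.
have liftB := lift_is_additive f.
have liftD : {morph fglift f : x y / x + y}.
  by move=> x y; rewrite -{1}(opprK y) liftB -(sub0r y) liftB fglift0 sub0r opprK.
move=> a x y; rewrite liftD; congr (_ + _).
elim/freeg_ind: x => [|b k x IH]; first by rewrite scaler0 fglift0 scaler0.
by rewrite scalerDr !liftD freegZ !liftU IH scalerDr scalerA.
Qed.
HB.instance Definition _ :=
  GRing.isLinear.Build R {freeg K / R} M *:%R (fglift f) fglift_is_linear.

Definition free_lift : {linear {freeg K / R} -> M} := fglift f.

Lemma free_liftE k : free_lift << k >> = f k.
Proof. by rewrite /free_lift /= liftU scale1r. Qed.

Lemma free_lift_sum x :
  free_lift x = \sum_(k <- freeg.dom x) coeff k x *: f k.
Proof.
rewrite -{1}(freeg_sumE x) linear_sum /=.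
by apply: eq_bigr => k _; rewrite liftU.
Qed.

Lemma free_linear_eq (g h : {linear {freeg K / R} -> M}) :
  (forall k, g << k >> = h << k >>) -> g = h.
Proof.
move=> gh; apply: linear_ext; elim/freeg_ind => [|a k x IH].
  by rewrite !linear0.
by rewrite !linearD IH -[a]mulr1 -freegZ !linearZ gh.
Qed.

End Lift.

Lemma coeff_sumU (s : seq K) (a : K -> R) (k : K) : uniq s ->
  coeff k (\sum_(l <- s) << a l *g l >>) = if k \in s then a k else 0.
Proof.
move=> us; rewrite raddf_sum /=.
case: ifPn => ks.
  rewrite (bigD1_seq k) //= big1 ?addr0 => [|l lk]; first by rewrite coeffU eqxx mulr1.
  by rewrite coeffU (negbTE lk) mulr0.
rewrite big_seq big1 // => l ls; rewrite coeffU.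
by case: (l =P k) ls ks => [->|_ _ _]; [move=> -> | rewrite mulr0].
Qed.

End FreeModule.

(** * Supports of the images of basis vectors under a commuting operator *)

Section FreeEndo.
Variables (R : nzRingType) (K : choiceType).
Local Open Scope ring_scope.
Implicit Types (w : K) (g : K -> K) (L : pred K).

Definition reindex g : {linear {freeg K / R} -> {freeg K / R}} :=
  free_lift (fun w => << g w >>).

Definition restrict L : {linear {freeg K / R} -> {freeg K / R}} :=
  free_lift (fun w => if L w then << w >> else 0).

Variable (Psi : {linear {freeg K / R} -> {freeg K / R}}).
Definition supp w : seq K := freeg.dom (Psi << w >>).

(** [Psi] sends [<< g w >>] to the reindexed image of [<< w >>]. Coefficients may cancel where [g]
    identifies points of the support, so there is only an inclusion, but no new basis vector can
    appear. *)
Lemma supp_reindex g w : Psi \o reindex g =1 reindex g \o Psi ->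
  {subset supp (g w) <= map g (supp w)}.
Proof.
move=> /(_ << w >>) /=; rewrite free_liftE => Pg v.
rewrite /supp Pg free_lift_sum mem_dom => v0.
apply/negPn/negP => vn; case/eqP: v0; rewrite raddf_sum /= big_seq big1 // => u us.
rewrite freegZ mulr1 coeffU; case: eqP => [uv|]; last by rewrite mulr0.
by case/negP: vn; apply/mapP; exists u.
Qed.

(** [restrict L] projects onto the span of [L] along the span of its complement. An operator that
    commutes with it preserves both summands, so the support stays on the side of [w]. *)
Lemma supp_restrict L w v : Psi \o restrict L =1 restrict L \o Psi ->
  v \in supp w -> L v = L w.
Proof.
move=> /(_ << w >>) /=; rewrite free_liftE free_lift_sum => PL vw.
have cv : coeff v (\sum_(k <- freeg.dom (Psi << w >>))
      coeff k (Psi << w >>) *: (if L k then << k >> else 0 : {freeg K / R}))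
    = if L v then coeff v (Psi << w >>) else 0.
  rewrite (eq_bigr (fun k =>
      << (if L k then coeff k (Psi << w >>) else 0) *g k >>)); last first.
    by move=> k _; case: (L k); rewrite ?freegZ ?mulr1 ?scaler0 ?freegU0.
  by rewrite coeff_sumU ?uniq_dom // (_ : v \in _ = true).
move: (vw); rewrite mem_dom => v0.
case: (L w) PL => PL; move: cv; rewrite -PL.
  by case: (L v) => // v00; rewrite v00 eqxx in v0.
by rewrite linear0 coeff0; case: (L v) => // v00; rewrite -v00 eqxx in v0.
Qed.

End FreeEndo.


(* In each class of sequences with a common tail up to a shift, choose a
   representative; [eps c] is the parity of the shift between [c] and the
   representative of its class. *)
Lemma shift_parity (I : Type) : exists eps : (nat -> I) -> bool,
  forall c, injective c -> eps (fun n => c n.+1) = ~~ eps c.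
Proof.
have [[c0 _]|no] := pselect (exists c : nat -> I, True); last first.
  by exists (fun=> true) => c; case: no; exists c.
pose sim (c d : nat -> I) := exists m n, forall i, c (m + i) = d (n + i).
have sim_sym c d : sim c d -> sim d c by move=> [m [n cd]]; exists n, m => i.
have sim_trans d c e : sim c d -> sim d e -> sim c e.
  move=> [m [n cd]] [p [q de]]; exists (m + p), (q + n) => i.
  by rewrite -!addnA cd (addnCA n p) de.
have /choice[g gP] (S : set (nat -> I)) : exists b, (exists c, S c) -> S b.
  have [[c Sc]|nS] := pselect (exists c, S c); first by exists c.
  by exists c0.
pose r c := g (sim c).
have rc c : sim c (r c) by apply: (gP (sim c)); exists c, 0, 0.
have rr c d : sim c d -> r c = r d.
  move=> cd; congr g; apply/seteqP; split=> e /=; last exact: sim_trans.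
  by apply: sim_trans; apply: sim_sym.
pose odds c m n := (forall i, c (m + i) = r c (n + i)) /\ odd (m + n).
exists (fun c => `[< exists m n, odds c m n >]) => c inj_c.
(* The shifted sequence is in the class of [c] and has the same representative, so both parities are
   measured against [r c]; only [m] moves by one. *)
have -> : odds (fun n => c n.+1) = fun m n =>
    (forall i, c (m.+1 + i) = r c (n + i)) /\ odd (m + n).
  apply/funext => m; apply/funext => n; rewrite /odds.
  by rewrite (rr (fun n => c n.+1) c) //; exists 0, 1 => i; rewrite add0n.
(* Injectivity of [c] makes the parity well defined: taking one identity at [q] and the other at [n]
   gives [m + q = p + n]. *)
have par m n p q : (forall i, c (m + i) = r c (n + i)) ->
    (forall i, c (p + i) = r c (q + i)) -> odd (m + n) = odd (p + q).
  move=> /(_ q) mn /(_ n) pq.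
  have /inj_c : c (m + q) = c (p + n) by rewrite mn pq addnC.
  lia.
have [m [n mn]] := rc c.
apply/idP/idP.
  move=> /asboolP[p [q [pq opq]]]; apply/asboolP => -[p' [q' [pq' opq']]].
  by have := par _ _ _ _ pq pq'; lia.
move=> /asboolP ne; apply/asboolP; exists m, n.+1; split.
  by move=> i; have := mn i.+1; rewrite !addSnnS.
by apply/negPn/negP => on; apply: ne; exists m, n; split=> //; lia.
Qed.

(** * Rigid families of cells *)

(* A cell is a labelling of all positions with elements of [I], and a
   distinguished element.  The positions with an empty stack form a track
   indexed by [nat], on which [shift] and [freeze] act; the stacks make room for
   a sequence of labellings in a single one, from which [skip] and [unstack]
   recover each of them. *)
Definition pos : Type := (seq nat * nat)%type.

Definition unstack (p : pos) : pos := (0 :: p.1, p.2).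
Definition skip (p : pos) : pos :=
  (if p.1 is n :: s then n.+1 :: s else [::], p.2).
Definition shift (p : pos) : pos := if p.1 is [::] then ([::], p.2.+1) else p.
Definition freeze (p : pos) : pos := if p.1 is [::] then ([::], 0) else p.

Definition cell (I : Type) : Type := (I * (pos -> I))%type.
HB.instance Definition _ (I : Type) := gen_eqMixin (cell I).
HB.instance Definition _ (I : Type) := gen_choiceMixin (cell I).

Definition remap (I : Type) (t : pos -> pos) (w : cell I) : cell I :=
  (w.1, w.2 \o t).
Definition track (I : Type) (w : cell I) (n : nat) : I := w.2 ([::], n).

Lemma ex_max_size (T : Type) (P : T -> Prop) (N : T -> nat) (n : nat) :
  (exists x, P x) -> (forall x, P x -> N x <= n) ->
  exists2 x, P x & forall y, P y -> N y <= N x.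
Proof.
move=> [x Px] bnd.
suff H k : forall x, P x -> n - N x <= k ->
    exists2 x, P x & forall y, P y -> N y <= N x.
  exact: (H (n - N x) x).
elim: k => [|k IH] z Pz nz; first by exists z => // y /bnd; lia.
have [[y Py zy]|no] := pselect (exists2 y, P y & N z < N y).
  by apply: (IH y) => //; have := bnd _ Py; lia.
by exists z => // y Py; rewrite leqNgt; apply/negP => zy; apply: no; exists y.
Qed.

Lemma uniq_map_inj_in (T U : eqType) (f : T -> U) (s : seq T) :
  uniq (map f s) -> {in s &, injective f}.
Proof.
elim: s => //= x s IH /andP[nx us] y z; rewrite !inE.
move=> /orP[/eqP->|ys] /orP[/eqP->|zs] // e; last exact: IH.
  by case/negP: nx; rewrite e map_f.
by case/negP: nx; rewrite -e map_f.
Qed.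

Section Rigid.
Variables (I : eqType) (le : rel I) (eps : (nat -> I) -> bool).
Hypothesis le_wo : well_order le.
Hypothesis eps_shift : forall c, injective c -> eps (fun n => c n.+1) = ~~ eps c.

Let lt x y := (x != y) && le x y.

Lemma wo_chainT : wo_chain le predT.
Proof. by move=> A _ nA; apply: le_wo. Qed.
Lemma wo_refl x : le x x.
Proof. exact: (wo_chain_reflexive wo_chainT). Qed.
Lemma wo_total x y : le x y || le y x.
Proof. exact: (wo_chainW wo_chainT). Qed.
Lemma wo_anti x y : le x y -> le y x -> x = y.
Proof. by move=> xy yx; apply: (wo_chain_antisymmetric wo_chainT); rewrite ?xy. Qed.
Lemma wo_min (P : I -> Prop) : (exists x, P x) ->
  exists2 z, P z & forall x, P x -> le z x.
Proof.
move=> [x Px]; have [|z [[/asboolP Pz lez] _]] := le_wo (A := [pred x | `[< P x >]]).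
  by exists x; apply/asboolP.
by exists z => // y Py; apply: lez; apply/asboolP.
Qed.

Lemma wo_trans x y z : le x y -> le y z -> le x z.
Proof.
move=> xy yz; have [|w Pw wmin] := @wo_min (fun v => v = x \/ v = y \/ v = z).
  by exists x; left.
have wx : le w x by apply: wmin; left.
have wy : le w y by apply: wmin; right; left.
have wz : le w z by apply: wmin; right; right.
by case: Pw wx wy wz => [->|[->|->]] // h1 h2 h3;
  [rewrite (wo_anti xy h1) | rewrite -(wo_anti yz h2)].
Qed.

Lemma strict_mono_le (f : I -> I) :
  (forall x y, lt x y -> lt (f x) (f y)) -> forall x, le x (f x).
Proof.
move=> mf x; apply: contrapT => nx.
have [|z nz zmin] := @wo_min (fun x => ~ le x (f x)); first by exists x.
have ltz : lt (f z) z.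
  have [zf|zf] := eqVneq (f z) z; first by case: nz; rewrite zf; exact: wo_refl.
  by have /orP[|l] := wo_total z (f z); [|rewrite /lt zf l].
have nfz : ~ le (f z) (f (f z)).
  move=> l; have /andP[/eqP nq l'] := mf _ _ ltz.
  by apply: nq; apply: wo_anti.
have := zmin _ nfz; move/andP: ltz => [/eqP nq l] l'.
by apply: nq; apply: wo_anti.
Qed.

(** A moved point moves up by [strict_mono_le], and so do all its iterates. This yields the
    injective sequence that [eps_shift] asks for. *)
Lemma mono_orbit (f : I -> I) x :
  (forall x y, lt x y -> lt (f x) (f y)) -> x <> f x ->
  injective (fun n => iter n f x).
Proof.
move=> mf xfx.
have step n : lt (iter n f x) (iter n.+1 f x).
  elim: n => [|n IH] /=; last exact: mf.
  by rewrite /lt strict_mono_le // andbT; apply/eqP.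
have lt_iter m k : lt (iter m f x) (iter (m + k.+1) f x).
  elim: k => [|k IH]; first by rewrite addn1.
  have /andP[/eqP ne l] := IH; have /andP[/eqP ne' l'] := step (m + k.+1).
  rewrite addnS /lt (wo_trans l l') andbT; apply/eqP => e.
  by apply: ne; apply: wo_anti => //; rewrite e.
move=> m n /= e; case: (ltngtP m n) => // mn.
  by have := lt_iter m (n - m).-1; rewrite (_ : m + _ = n) ?e /lt ?eqxx //; lia.
by have := lt_iter n (m - n).-1; rewrite (_ : n + _ = m) ?e /lt ?eqxx //; lia.
Qed.

(** [S w] abstracts the support of the image of the basis vector [w] under an operator commuting
    with four reindexings and three restrictions; [supp_reindex] and [supp_restrict] provide the
    hypotheses below. *)
Variable S : cell I -> seq (cell I).
Hypothesis S_uniq : forall w, uniq (S w).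
Hypothesis S_unstack : forall w,
  {subset S (remap unstack w) <= map (remap unstack) (S w)}.
Hypothesis S_skip : forall w,
  {subset S (remap skip w) <= map (remap skip) (S w)}.
Hypothesis S_shift : forall w,
  {subset S (remap shift w) <= map (remap shift) (S w)}.
Hypothesis S_freeze : forall w,
  {subset S (remap freeze w) <= map (remap freeze) (S w)}.
Hypothesis S_lt : forall w v, v \in S w ->
  lt (track v 0) (track v 1) = lt (track w 0) (track w 1).
Hypothesis S_eps : forall w v, v \in S w -> eps (track v) = eps (track w).
Hypothesis S_diag : forall w v, v \in S w ->
  (track v 0 == v.1) = (track w 0 == w.1).

(* By [S_unstack] and [S_skip] the sizes of the supports of the cells over [c]
   are bounded; take one, [w0], of maximal size.  Every cell [ext d] lying over
   it has the same support up to its track, so the tracks in [S (ext d)] are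
   given by a map [f] of [I] applied to [d].  The map [f] is increasing, and by
   [eps_shift] it moves no point, since the orbit of such a point would be an
   injective [d] that [f] shifts. *)
Lemma rigid_cells (c : I) :
  exists2 w : cell I, w.1 = c & forall v, v \in S w -> v.1 = c.
Proof.
pose N w := size (S w).
have N_remap t w : {subset S (remap t w) <= map (remap t) (S w)} ->
    N (remap t w) <= N w.
  by move=> sub; rewrite /N -(size_map (remap t) (S w)); exact: uniq_leq_size.
have [n0 Nn] : exists n, forall w, w.1 = c -> N w <= n.
  apply: contrapT => unb.
  have /choice[a aP] n : exists a : pos -> I, n <= N (c, a).
    apply: contrapT => na; apply: unb; exists n => -[d a] /= ->.
    by rewrite leqNgt; apply/negP => lt_n; apply: na; exists a; apply: ltnW.
  (* All the labellings [a n] are packed into one, selected by the top of the stack. [skip] and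
     [unstack] recover each of them and never enlarge a support, so the finite number [N (c, b)]
     would bound every [n]. *)
  pose b : pos -> I := fun p => if p.1 is n :: s then a n (s, p.2) else c.
  have bE n : N (remap unstack (iter n (remap skip) (c, b))) <= N (c, b).
    apply: (leq_trans (N_remap _ _ (@S_unstack _))).
    by elim: n => //= n; apply: (leq_trans (N_remap _ _ (@S_skip _))).
  have unstackE k : remap unstack (iter k (remap skip) (c, b)) = (c, a k).
    have -> : iter k (remap skip) (c, b) = (c, b \o iter k skip).
      elim: k => //= k ->; rewrite /remap /=; congr pair; apply/funext => p /=.
      by rewrite -iterSr.
    rewrite /remap /=; congr pair; apply/funext => -[s m] /=.
    by rewrite /unstack /= (_ : iter k skip _ = (k :: s, m)) //; elim: k => //= k ->.
  have := leq_trans (aP (N (c, b)).+1) _; rewrite -unstackE => /(_ _ (bE _)).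
  by rewrite ltnn.
have [|w0 w0c w0max] := ex_max_size (P := fun w : cell I => w.1 = c) _ Nn.
  by exists (c, fun=> c).
pose ext (d : nat -> I) : cell I :=
  (c, fun p => if p.1 is n :: s then w0.2 (s, p.2) else d p.2).
have extE d : remap unstack (ext d) = w0.
  by rewrite [RHS]surjective_pairing w0c; congr pair; apply/funext => -[].
have ext_shift d : remap shift (ext d) = ext (fun n => d n.+1).
  by congr pair; apply/funext => -[[|? ?] ?].
have ext_freeze d : remap freeze (ext d) = ext (fun=> d 0).
  by congr pair; apply/funext => -[[|? ?] ?].
have unstack_shift w : remap unstack (remap shift w) = remap unstack w.
  by congr pair; apply/funext.
have unstack_freeze w : remap unstack (remap freeze w) = remap unstack w.
  by congr pair; apply/funext.
have N_ext d : N (ext d) <= N w0 by apply: w0max.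
(* Together with the maximality of [w0], this inclusion makes [remap unstack] a bijection from
   [S (ext d)] onto [S w0], for every [d]. *)
have sub_ext d : {subset S w0 <= map (remap unstack) (S (ext d))}.
  by rewrite -{1}(extE d).
have inj_ext d : {in S (ext d) &, injective (remap unstack)}.
  apply: uniq_map_inj_in.
  by apply: (leq_size_uniq (S_uniq w0) (@sub_ext d)); rewrite size_map; exact: N_ext.
have ext_sub d v : v \in S (ext d) -> remap unstack v \in S w0.
  have sz : size (map (remap unstack) (S (ext d))) <= size (S w0).
    by rewrite size_map; exact: N_ext.
  by move=> vS; rewrite (uniq_min_size (S_uniq w0) (@sub_ext d) sz).2 map_f.
have track_id d v : v \in S (ext d) -> track v = d.
  move=> vS; set u := remap unstack v.
  have uS : u \in S w0 by apply: ext_sub vS.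
  (* [L e] is the only cell of [S (ext e)] above [u]. By uniqueness [L] commutes with [shift] and
     [freeze], and then the track of [L e] is [e] followed by one map [f]. *)
  have /choice[L LP] e : exists v, v \in S (ext e) /\ remap unstack v = u.
    by have /mapP[v' v'S ->] := sub_ext e _ uS; exists v'.
  have Lv e v' : v' \in S (ext e) -> remap unstack v' = u -> v' = L e.
    by move=> v'S v'u; apply: (inj_ext e) => //; [case: (LP e) | rewrite v'u (LP e).2].
  have L_shift e : L (fun n => e n.+1) = remap shift (L e).
    have [+ L2] := LP (fun n => e n.+1); rewrite -ext_shift => /S_shift/mapP[v' v'S v'E].
    by rewrite v'E (Lv e v') // -unstack_shift -v'E.
  have L_freeze e : L (fun=> e 0) = remap freeze (L e).
    have [+ L2] := LP (fun=> e 0); rewrite -ext_freeze => /S_freeze/mapP[v' v'S v'E].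
    by rewrite v'E (Lv e v') // -unstack_freeze -v'E.
  pose f x := track (L (fun=> x)) 0.
  have trackL e n : track (L e) n = f (e n).
    elim: n e => [|k IH] e; first by rewrite /f L_freeze.
    by rewrite -(IH (fun n => e n.+1)) L_shift.
  (* Only the first two entries of the track enter [S_lt], so a sequence beginning with [x], [y] is
     enough. *)
  have mf x y : lt x y -> lt (f x) (f y).
    move=> xy; pose e n := if n is 0 then x else y.
    have [/S_lt] := LP e; rewrite !trackL /= => -> _.
    by rewrite /track /=.
  have fid x : f x = x.
    apply: contrapT => fx; pose e n := iter n f x.
    have inj_e : injective e.
      by apply: mono_orbit => // h; apply: fx; rewrite -h.
    have [/S_eps + _] := LP e.
    rewrite (_ : track (L e) = fun n => e n.+1); last by apply/funext => n; rewrite trackL.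
    by rewrite eps_shift // /track /ext /=; case: eps.
  by rewrite (Lv d v) //; apply/funext => n; rewrite trackL fid.
(* On the constant track the entry at 0 is the distinguished element [c]. Since [v] has the same
   track, [S_diag] identifies its distinguished element with [c]. *)
exists (ext (fun=> c)) => // v vS.
by have := S_diag vS; rewrite (track_id _ _ vS) /track /= eqxx => /eqP.
Qed.

End Rigid.

(** * Small types *)

(* The type [A] ranges over the universe of the index types of [tree]; thus a
   type is small if and only if it is in bijection with a set. *)
Definition small (T : Type) : Prop :=
  exists (A : Type) (h : A -> T), forall t, exists a, t = h a.

Lemma sval_inj (T : Type) (P : T -> Prop) : injective (@sval T P).
Proof. by move=> [x px] [y py] /= xy; apply: eq_exist. Qed.

Lemma small_El (x : V) : small (El x).
Proof.
have [A [f xE]] := is_range_V x.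
have fx a : f a ∈ x by rewrite xE; apply/elt_range_V; exists a.
exists A, (fun a => exist _ (f a) (fx a)) => -[y yx].
have := yx; rewrite {1}xE => /elt_range_V[a ya]; exists a.
by apply: eq_exist; rewrite ya.
Qed.

Lemma small_image (T U : Type) (f : T -> U) :
  (forall u, exists t, u = f t) -> small T -> small U.
Proof.
move=> fsur [A [h hsur]]; exists A, (f \o h) => u.
by have [t ->] := fsur u; have [a ->] := hsur t; exists a.
Qed.

Lemma small_prod (T U : Type) : small T -> small U -> small (T * U).
Proof.
move=> [A [f fs]] [B [g gs]]; exists (A * B)%type, (fun p => (f p.1, g p.2)).
by move=> [t u]; have [a ->] := fs t; have [b ->] := gs u; exists (a, b).
Qed.

Lemma small_seq (T : Type) : small T -> small (seq T).
Proof.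
move=> [A [f fs]]; exists (seq A), (map f); elim=> [|t s [l ->]].
  by exists [::].
by have [a ->] := fs t; exists (a :: l).
Qed.

Lemma small_unit : small unit.
Proof. by exists unit, id => t; exists t. Qed.

Lemma small_fun (D : Type) (T : Type) : small D -> small T -> small (D -> T).
Proof.
move=> [B [g gs]] [A [f fs]].
have /choice[s sP] d : exists b, d = g b by exact: gs.
exists (B -> A), (fun k d => f (k (s d))) => t.
have /choice[k kP] b : exists a, t (g b) = f a by exact: fs.
by exists k; apply/funext => d; rewrite -kP -sP.
Qed.

Lemma small_sub (T U : Type) (f : T -> U) : injective f -> small U -> small T.
Proof.
move=> inj_f [A [h hs]].
have [[t0 _]|nT] := pselect (exists t : T, True); last first.
  by exists void, (of_void T) => t; case: nT; exists t.
have /choice[k kP] a : exists t, (exists t', f t' = h a) -> f t = h a.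
  have [[t ft]|no] := pselect (exists t', f t' = h a); first by exists t.
  by exists t0.
exists A, k => t; have [a fa] := hs (f t); exists a.
by apply: inj_f; rewrite kP // ; exists t.
Qed.

Lemma small_nat : small nat.
Proof. by exists nat, id => t; exists t. Qed.

Lemma elt_irr (x : V) : x ∉ x.
Proof.
move=> xx; have [|y -> /(_ _ xx)] := @V_foundation (fun y => y = x); first by exists x.
exact.
Qed.

Lemma equipotent_trans y x z : equipotent x y -> equipotent y z -> equipotent x z.
Proof. by move=> [f bf] [g bg]; exists (g \o f); apply: bij_comp. Qed.

Lemma elt_ordinal a b : ordinal_V a -> b ∈ a -> ordinal_V b.
Proof.
move=> [tr_a [irr tr wo]] ba; have sub x : x ∈ b -> x ∈ a by move=> xb; apply: tr_a ba.
split.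
  move=> x y xy yb; have ya := sub _ yb.
  exact: (tr x y b (tr_a _ _ xy ya) ya ba xy yb).
split.
- by move=> x /sub; apply: irr.
- by move=> x y z /sub xa /sub ya /sub za; apply: tr.
- by move=> c cb; apply: wo => x /cb/sub.
Qed.

(** This is the Mostowski collapse of a well-order on [A]: [f x] is the set of all [f y] with [y]
    strictly below [x]. *)
Lemma small_ordinal (A : Type) : exists a, ordinal_V a /\
  exists f : A -> El a, bijective f.
Proof.
pose T : eqType := HB.pack A (gen_eqMixin A).
have [le le_wo] := well_ordering_principle T.
pose lt (x y : A) := ((x : T) != y) && le x y.
have lt_wf : well_founded lt.
  move=> x; apply: contrapT => nx.
  have [|z nz zmin] := @wo_min _ _ le_wo (fun x => ~ Acc lt x); first by exists x.
  apply: nz; constructor => y /andP[/eqP yz yz']; apply: contrapT => ny.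
  by apply: yz; apply: (wo_anti le_wo) => //; apply: zmin.
pose step (x : A) (F : forall y : A, lt y x -> V) : V :=
  range_V (fun p : {y : A | lt y x} => F (sval p) (svalP p)).
pose f := Fix lt_wf (fun=> V) step.
have fE x : f x = range_V (fun p : {y : A | lt y x} => f (sval p)).
  rewrite /f Init.Wf.Fix_eq // => y g h gh; rewrite /step; congr range_V.
  by apply/funext => p; apply: gh.
have fP x z : z ∈ f x <-> exists2 y, lt y x & z = f y.
  rewrite fE elt_range_V; split=> [[[y yx] ->]|[y yx ->]]; first by exists y.
  by exists (exist _ y yx).
have lt_f x y : lt x y -> f x ∈ f y by move=> xy; apply/fP; exists x.
have lt_tot (x y : A) : x = y \/ lt x y \/ lt y x.
  have [->|xy] := @eqVneq T x y; [by left|right].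
  by rewrite /lt xy eq_sym xy; apply/orP; exact: (wo_total le_wo).
have inj_f : injective f.
  move=> x y fxy; case: (lt_tot x y) => [//|[]/lt_f]; rewrite fxy => h.
    by case: (elt_irr h).
  by case: (elt_irr h).
have f_lt x y : f x ∈ f y -> lt x y by move=> /fP[z zy /inj_f->].
pose a := range_V (f : A -> V).
have aP z : z ∈ a <-> exists x, z = f x by exact: elt_range_V.
exists a; split; first split.
- by move=> x y xy /aP[z yz]; move: xy; rewrite yz => /fP[w _ ->]; apply/aP; exists w.
- split.
  + by move=> x _; apply: elt_irr.
  + move=> x y z /aP[x' ->] /aP[y' ->] /aP[z' ->] /f_lt/andP[xy lxy] /f_lt/andP[yz lyz].
    apply: lt_f; rewrite /lt (wo_trans le_wo lxy lyz) andbT.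
    apply/eqP => xz; case/eqP: xy; apply: (wo_anti le_wo) => //.
    by rewrite xz.
  + move=> b ba [x xb]; have [x' xx'] : exists x', x = f x' by apply/aP/ba.
    have [|m mb mmin] := @wo_min _ _ le_wo (fun y => f y ∈ b).
      by exists x'; rewrite -xx'.
    exists (f m) => // y yb; have [y' yy'] : exists y', y = f y' by apply/aP/ba.
    rewrite yy' in yb *; have [->|ym] := @eqVneq T y' m; [by left|right].
    by apply: lt_f; rewrite /lt eq_sym ym mmin.
have fa x : f x ∈ a by apply/aP; exists x.
have inj_fa : injective (fun x : A => exist _ (f x) (fa x) : El a).
  by move=> x y [] /inj_f.
exists (fun x : A => exist _ (f x) (fa x)).
have /choice[g gP] (z : El a) : exists x, sval z = f x by apply/aP/(svalP z).
exists g => [x|z]; last by apply: sval_inj; rewrite /= -gP.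
by apply: inj_f; rewrite -(gP (exist _ (f x) (fa x))).
Qed.

(** An enumeration [h] may repeat values; on the indices picked by the section [r] it is a
    bijection. A membership-minimal ordinal of that size is a cardinal. *)
Lemma small_card (T : Type) : small T -> exists (k : Cn) (f : El k -> T), bijective f.
Proof.
move=> [A [h hs]].
have /choice[r rP] t : exists a, t = h a by exact: hs.
have [a [oa [f bf]]] := small_ordinal {x : A | r (h x) = x}.
have [|k [ok ka] kmin] :=
    @V_foundation (fun b => ordinal_V b /\ equipotent b a).
  by exists a; split=> //; exists id; exists id.
have ck : cardinal_V k.
  split=> // b bk bk'; apply: (kmin b) => //; split; first exact: elt_ordinal bk.
  exact: equipotent_trans ka.
exists (exist _ k ck).
have [g bg] := ka; have [f' ff' f'f] := bf.
exists (fun x => h (sval (f' (g x)))); apply: (bij_comp (f := fun x => h (sval x)) (h := f' \o g)).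
  have rh t : r (h (r t)) = r t by rewrite -rP.
  exists (fun t => exist (fun x => r (h x) = x) (r t) (rh t)) => [x|t] /=; last by rewrite -rP.
  by apply: sval_inj; exact: (svalP x).
by apply: bij_comp bg; exists f.
Qed.

Lemma small_set (T : Type) : small T -> exists (x : V) (f : El x -> T), bijective f.
Proof. by move=> /small_card[k [f bf]]; exists k, f. Qed.

(** * Modules carried by sets *)

Local Open Scope ring_scope.

#[global] Arguments lmodule_lmodType : simpl never.
#[global] Arguments skewfield_ring : simpl never.

Definition mk_linear (R : nzRingType) (M N : lmodType R) (f : M -> N)
    (lf : linear f) : {linear M -> N} :=
  HB.pack f (GRing.isLinear.Build R M N *:%R f lf).

Section Transport.
Variables (R : nzRingType) (L : lmodType R) (x : V).
Variables (f : El x -> L) (g : L -> El x).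
Hypotheses (fK : cancel f g) (gK : cancel g f).

Let zero := g 0.
Let opp (a : El x) := g (- f a).
Let add (a b : El x) := g (f a + f b).
Let scale (c : R) (a : El x) := g (c *: f a).

Fact tr_addA : associative add.
Proof. by move=> a b c; rewrite /add !gK addrA. Qed.
Fact tr_addC : commutative add.
Proof. by move=> a b; rewrite /add addrC. Qed.
Fact tr_add0 : left_id zero add.
Proof. by move=> a; rewrite /add gK add0r fK. Qed.
Fact tr_addN : left_inverse zero opp add.
Proof. by move=> a; rewrite /add gK addNr. Qed.

Definition tr_zmod := GRing.isZmodule.Build (El x) tr_addA tr_addC tr_add0 tr_addN.

Let Z : zmodType := zmod_on tr_zmod.

Fact tr_scaleA (c d : R) (a : Z) : scale c (scale d a) = scale (c * d) a.
Proof. by rewrite /scale gK scalerA. Qed.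
Fact tr_scale1 : left_id 1 (scale : R -> Z -> Z).
Proof. by move=> a; rewrite /scale scale1r fK. Qed.
Fact tr_scaleDr : right_distributive (scale : R -> Z -> Z) +%R.
Proof. by move=> c a b; rewrite /scale /GRing.add /= /add !gK scalerDr. Qed.
Fact tr_scaleDl (a : Z) : {morph (fun c => (scale c a : Z)) : c d / c + d}.
Proof. by move=> c d; rewrite /scale {2}/GRing.add /= /add !gK scalerDl. Qed.

Definition transport : lmodule R :=
  Lmodule (GRing.Zmodule_isLmodule.Build R Z tr_scaleA tr_scale1 tr_scaleDr tr_scaleDl).

Fact transport_linear : linear (f : transport -> L).
Proof.
move=> c a b; rewrite /GRing.scale /GRing.add /= /add gK.
by rewrite /scale gK.
Qed.
End Transport.

Section Iso.
Variable F : nzRingType.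

Definition ap (X Y : lmodule F) (f : @hom (Mod F) X Y) : X -> Y :=
  (f : {linear X -> Y}).

Lemma hom_ext (X Y : lmodule F) (f g : @hom (Mod F) X Y) : ap f =1 ap g -> f = g.
Proof. exact: linear_ext. Qed.

Lemma hom_apP (X Y : lmodule F) (f g : @hom (Mod F) X Y) : f = g -> ap f =1 ap g.
Proof. by move->. Qed.

Lemma ap_cmp (X Y Z : lmodule F) (g : @hom (Mod F) Y Z) (f : @hom (Mod F) X Y) x :
  ap (cmp g f) x = ap g (ap f x).
Proof. by []. Qed.

Lemma ap_id (X : lmodule F) x : ap (@idm (Mod F) X) x = x.
Proof. by []. Qed.

Lemma ap_linear (X Y : lmodule F) (f : @hom (Mod F) X Y) : linear (ap f).
Proof. exact: linearP. Qed.

HB.instance Definition _ (X Y : lmodule F) (f : @hom (Mod F) X Y) :=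
  GRing.isLinear.Build F X Y *:%R (ap f) (ap_linear f).

Definition to_hom (X Y : lmodule F) (f : {linear X -> Y}) : @hom (Mod F) X Y := f.

Lemma ap_to_hom (X Y : lmodule F) (f : {linear X -> Y}) x : ap (to_hom f) x = f x.
Proof. by []. Qed.

Record iso_to (M : lmodule F) (L : lmodType F) := IsoTo {
  iso_fwd : {linear M -> L};
  iso_bwd : {linear L -> M};
  iso_fwdK : cancel iso_fwd iso_bwd;
  iso_bwdK : cancel iso_bwd iso_fwd }.

Lemma transport_iso (L : lmodType F) (x : V) (f : El x -> L) (g : L -> El x)
    (fK : cancel f g) (gK : cancel g f) :
  exists h : iso_to (transport fK gK) L, iso_fwd h =1 f.
Proof.
have lf : linear (f : transport fK gK -> L) by exact: transport_linear.
have lg : linear (g : L -> transport fK gK).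
  by move=> c a b; apply: (can_inj fK); rewrite lf !gK.
by exists (@IsoTo _ _ (mk_linear lf) (mk_linear lg) fK gK).
Qed.

(** Free modules and products are built on types; this replaces them by objects of [Mod F], whose
    carriers are sets. *)
Lemma small_module (L : lmodType F) : small L ->
  exists M : lmodule F, inhabited (iso_to M L).
Proof.
move=> /small_set[x [f [g fK gK]]]; exists (transport fK gK).
by have [h _] := transport_iso fK gK.
Qed.

Lemma small_free (K : choiceType) : small F -> small K -> small {freeg K / F}.
Proof.
move=> sF sK; apply: (@small_image (seq (F * K)) _ (fun s => [freeg s])).
  by move=> x; exists (fgenum x); rewrite Freeg_enum.
by apply: small_seq; apply: small_prod.
Qed.

End Iso.

Local Close Scope ring_scope.

(** * Coding sets of points by morphisms *)

Local Open Scope ring_scope.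

Definition gen_line (F : skewfield) (U : lmodule F) (u : U) : Prop :=
  u <> 0 /\ forall v : U, exists a : F, v = a *: u.

(* In the intended codes [sB] and [sX] are the free modules over [I] and over the
   cells of [I], [sM] maps a cell to its distinguished element, [sU] sends every
   basis vector of [sB] to the generator of [U], [s1]..[s4] are the four
   reindexings and [s5]..[s7] the three restrictions. *)
Record scode (F : skewfield) (U : lmodule F) := Scode {
  sB : obj (Mod F);
  sX : obj (Mod F);
  sU : @hom (Mod F) sB U;
  sM : @hom (Mod F) sX sB;
  s1 : @hom (Mod F) sX sX;
  s2 : @hom (Mod F) sX sX;
  s3 : @hom (Mod F) sX sX;
  s4 : @hom (Mod F) sX sX;
  s5 : @hom (Mod F) sX sX;
  s6 : @hom (Mod F) sX sX;
  s7 : @hom (Mod F) sX sX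
}.

Definition commutes (C : category) (X : obj C) (f g : hom X X) : Prop :=
  cmp f g = cmp g f.

(** [cmp b t] is an idempotent of rank one with the image of [b], and [p] lifts it along [sM z]
    inside the commutant of the seven operators. This determines [b] up to a scalar, which the
    clause on [sU z] fixes. The morphism [e] names a composite, because atomic formulas compose only
    two variables. *)
Definition coded (F : skewfield) (U : lmodule F) (z : scode U)
    (b : @hom (Mod F) U (sB z)) : Prop :=
  cmp (sU z) b = idm (U : obj (Mod F)) /\
  exists (t : @hom (Mod F) (sB z) U) (p : @hom (Mod F) (sX z) (sX z)),
    cmp t b = idm (U : obj (Mod F)) /\
    (exists e : @hom (Mod F) (sB z) (sB z), e = cmp b t /\ cmp (sM z) p = cmp e (sM z)) /\
    commutes p (s1 z) /\ commutes p (s2 z) /\ commutes p (s3 z) /\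
    commutes p (s4 z) /\ commutes p (s5 z) /\ commutes p (s6 z) /\ commutes p (s7 z).

Section Line.
Variables (F : skewfield) (U : lmodule F) (u : U).
Hypothesis Uu : gen_line u.

Lemma skew_inv (a : F) : a <> 0 -> exists b : F, b * a = 1 /\ a * b = 1.
Proof. exact: skewfield_inv. Qed.

Lemma gen_line_eq0 (a : F) : a *: u = 0 -> a = 0.
Proof.
move=> au; apply: contrapT => /skew_inv[b [ba _]]; case: Uu => u0 _; apply: u0.
by rewrite -[u]scale1r -ba -scalerA au scaler0.
Qed.

Lemma gen_line_inj (a b : F) : a *: u = b *: u -> a = b.
Proof.
move=> e; apply/eqP; rewrite -subr_eq0; apply/eqP/gen_line_eq0.
by rewrite scalerBl e subrr.
Qed.

Definition gcoord (v : U) : F := projT1 (cid (Uu.2 v)).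
Lemma gcoordK v : gcoord v *: u = v.
Proof. by rewrite /gcoord; case: cid. Qed.

Lemma gcoord_gen : gcoord u = 1.
Proof. by apply: gen_line_inj; rewrite gcoordK scale1r. Qed.

Fact line_map_linear (N : lmodType F) (n : N) : linear (fun v => gcoord v *: n).
Proof.
move=> a v w; rewrite scalerA -scalerDl; congr (_ *: n).
by apply: gen_line_inj; rewrite scalerDl -scalerA !gcoordK.
Qed.

Definition line_map (N : lmodule F) (n : N) : @hom (Mod F) U N :=
  to_hom (mk_linear (line_map_linear n)).

Lemma line_mapE (N : lmodule F) (n : N) : ap (line_map n) u = n.
Proof. by rewrite /line_map ap_to_hom /= gcoord_gen scale1r. Qed.

Lemma line_ext (N : lmodule F) (f g : @hom (Mod F) U N) : ap f u = ap g u -> f = g.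
Proof. by move=> fg; apply: hom_ext => v; rewrite -(gcoordK v) !linearZ_LR /= fg. Qed.

End Line.

Section Coding.
Variables (F : skewfield) (U : lmodule F) (u : U).
Hypothesis Uu : gen_line u.

Lemma small_skewfield : small F.
Proof. exact: small_El. Qed.

(** For a coded [b], rigidity provides over each [c] a cell whose image under [p] is supported over
    [c], so [cmp b t] is diagonal in the basis. Being of rank one, it leaves for [b] only a multiple
    of one basis vector, and [sU z] forces the multiple to be that vector. The last clause is the
    freeness of [sB z]. *)
Theorem coding (I0 : Type) : small I0 -> exists (z : scode U)
    (e : I0 -> @hom (Mod F) U (sB z)),
  [/\ injective e, forall b, coded b <-> exists i, b = e i
    & forall (N : lmodule F) (h : I0 -> @hom (Mod F) U N),
        exists l : @hom (Mod F) (sB z) N, forall i, cmp l (e i) = h i].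
Proof.
move=> sI; pose I : choiceType := HB.pack I0 (gen_eqMixin I0) (gen_choiceMixin I0).
have [le le_wo] := well_ordering_principle I.
have [eps epsP] := shift_parity I.
pose lt (x y : I) := (x != y) && le x y.
have s_cell : small (cell I).
  apply: small_prod => //; apply: small_fun => //.
  by apply: small_prod; [apply: small_seq|]; exact: small_nat.
have [B [iB]] := small_module (@small_free F I small_skewfield sI).
have [X [iX]] := small_module (@small_free F (cell I) small_skewfield s_cell).
pose fB := iso_fwd iB; pose gB := iso_bwd iB.
pose fX := iso_fwd iX; pose gX := iso_bwd iX.
have fBK : cancel fB gB by exact: iso_fwdK.
have gBK : cancel gB fB by exact: iso_bwdK.
have fXK : cancel fX gX by exact: iso_fwdK.
have gXK : cancel gX fX by exact: iso_bwdK.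
pose op (f : {linear {freeg (cell I) / F} -> {freeg (cell I) / F}}) : @hom (Mod F) X X :=
  to_hom (gX \o f \o fX).
pose fst_map : {linear {freeg (cell I) / F} -> {freeg I / F}} :=
  @free_lift F (cell I) _ (fun w => << w.1 >>).
pose sum_map : {linear {freeg I / F} -> U} := free_lift (fun=> u).
pose Llt (w : cell I) := lt (track w 0) (track w 1).
pose Leps (w : cell I) := eps (track w).
pose Ldg (w : cell I) := track w 0 == w.1.
pose z : scode U := @Scode F U B X (to_hom (sum_map \o fB)) (to_hom (gB \o fst_map \o fX))
  (op (@reindex F (cell I) (remap unstack))) (op (@reindex F (cell I) (remap skip)))
  (op (@reindex F (cell I) (remap shift))) (op (@reindex F (cell I) (remap freeze)))
  (op (@restrict F (cell I) Llt)) (op (@restrict F (cell I) Leps)) (op (@restrict F (cell I) Ldg)).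
pose e (i : I) : @hom (Mod F) U B := line_map Uu (gB << i >>).
have eu i : ap (e i) u = gB << i >> by exact: line_mapE.
exists z, e; split.
- move=> i j /hom_apP/(_ u); rewrite !eu => /(can_inj gBK) ij.
  have := congr1 (coeff (i : I)) ij; rewrite !coeffU eqxx mulr1.
  by case: ((j : I) =P i) => [->//|_ /eqP]; rewrite mulr0 oner_eq0.
- move=> b; split.
    move=> [sb [t [p [tb [[_ [-> mp]] cp]]]]].
    pose P : {linear {freeg (cell I) / F} -> {freeg (cell I) / F}} :=
      fX \o (p : {linear X -> X}) \o gX.
    have PE x : gX (P x) = ap p (gX x) by rewrite /P /= fXK.
    have commP f : commutes p (op f) -> P \o f =1 f \o P.
      move=> /hom_apP cf x; have := cf (gX x); rewrite !ap_cmp !ap_to_hom /= gXK => h.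
      by apply: (can_inj gXK); rewrite PE h.
    have [/commP c1 [/commP c2 [/commP c3 [/commP c4 [/commP c5 [/commP c6 /commP c7]]]]]] := cp.
    have diag (c : I) : exists d : F, ap b (ap t (gB << c >>)) = gB (d *: << c >>).
      have [||||||||w wc wS] := @rigid_cells I le eps le_wo epsP (supp P) _ _ _ _ _ _ _ _ c.
      - by move=> w; exact: uniq_dom.
      - by move=> w; exact: (supp_reindex c1).
      - by move=> w; exact: (supp_reindex c2).
      - by move=> w; exact: (supp_reindex c3).
      - by move=> w; exact: (supp_reindex c4).
      - by move=> w v; exact: (supp_restrict c5).
      - by move=> w v; exact: (supp_restrict c6).
      - by move=> w v; exact: (supp_restrict c7).
      (* [fst_map] sends every vector of this support to [<< c >>], so only the sum of the
         coefficients remains. *)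
      exists (\sum_(v <- supp P w) coeff v (P << w >>)).
      have := hom_apP mp (gX << w >>); rewrite !ap_cmp -PE !ap_to_hom /= !gXK.
      rewrite free_liftE wc => <-; rewrite free_lift_sum; congr (gB _).
      by rewrite scaler_suml !big_seq; apply: eq_bigr => v /wS ->.
    have [u0 gen_u] := Uu.
    pose beta := fB (ap b u).
    have tc c : exists a, ap t (gB << c >>) = a *: u by exact: gen_u.
    (* [cmp t b] is the identity of a nonzero module, so [t] does not vanish on the whole basis. One
       basis vector with nonzero value determines [b]. *)
    have [c [a [a0 tca]]] : exists c a, a <> 0 /\ ap t (gB << c >>) = a *: u.
      apply: contrapT => no; apply: u0.
      have := hom_apP tb u; rewrite ap_cmp ap_id => <-.
      rewrite -(fBK (ap b u)) -(freeg_sumE (fB (ap b u))) !linear_sum big1 // => c _.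
      rewrite -[coeff _ _]mulr1 -freegZ !linearZ_LR /=.
      have [a ta] := tc c; rewrite ta; have [->|a0] := eqVneq a 0.
        by rewrite scale0r scaler0.
      by case: no; exists c, a; split=> //; apply/eqP.
    have [a' [a'a _]] := skew_inv a0; have [d bd] := diag c.
    have bu : ap b u = gB ((a' * d) *: << c >>).
      by rewrite -scalerA linearZ_LR /= -bd tca linearZ_LR /= scalerA a'a scale1r.
    exists c; apply: (line_ext Uu); rewrite eu bu.
    have := hom_apP sb u; rewrite ap_cmp ap_id ap_to_hom /= bu gBK linearZ_LR /=.
    rewrite free_liftE -{2}[u]scale1r => /(gen_line_inj Uu) ->.
    by rewrite scale1r.
  move=> [i0 ->]; move: (i0 : I) => i {i0}; split.
    by apply: (line_ext Uu); rewrite ap_cmp eu ap_to_hom /= gBK free_liftE.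
  pose t : @hom (Mod F) B U :=
    to_hom (@free_lift F I _ (fun j : I => if j == i then u else 0) \o fB).
  (* The projection to the cells over [i] commutes with every [remap], which keeps the distinguished
     element, and with every [restrict], since both are diagonal. *)
  pose p : @hom (Mod F) X X := op (@restrict F (cell I) (fun w : cell I => w.1 == i)).
  have comm (f : {linear {freeg (cell I) / F} -> {freeg (cell I) / F}}) :
      (forall w : cell I, f (if w.1 == i then << w >> else 0) =
        @restrict F (cell I) (fun w : cell I => w.1 == i) (f << w >>)) -> commutes p (op f).
    move=> fw; apply: hom_ext => x; rewrite !ap_cmp !ap_to_hom /= !gXK; congr (gX _).
    move: (fX x) => y.
    have : @restrict F (cell I) (fun w : cell I => w.1 == i) \o f =
           f \o @restrict F (cell I) (fun w : cell I => w.1 == i) :> {linear _ -> _}.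
      by apply: free_linear_eq => w /=; rewrite [in RHS]free_liftE fw.
    by move=> /(congr1 (fun h : {linear _ -> _} => h y)).
  exists t, p; split.
    by apply: (line_ext Uu); rewrite ap_cmp eu ap_to_hom /= gBK free_liftE eqxx.
  split.
    exists (cmp (e i) t); split=> //; apply: hom_ext => x.
    rewrite !ap_cmp !ap_to_hom /= gXK gBK; move: (fX x) => y.
    pose t' : {linear {freeg I / F} -> U} := free_lift (fun j : I => if j == i then u else 0).
    have : gB \o (fst_map \o @restrict F (cell I) (fun w : cell I => w.1 == i)) =
           (e i : {linear U -> B}) \o (t' \o fst_map) :> {linear _ -> _}.
      apply: free_linear_eq => w /=; rewrite !free_liftE.
      case: eqP => [<-|_]; first by rewrite free_liftE; exact/esym/eu.
      by rewrite fglift0 linear0; exact/esym/(linear0 (e i : {linear U -> B})).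
    by move=> /(congr1 (fun h : {linear _ -> _} => h y)).
  have comm_re t0 : commutes p (op (@reindex F (cell I) (remap t0))).
    apply: comm => w; rewrite !free_liftE /=.
    by case: (w.1 == i); rewrite ?free_liftE ?linear0.
  have comm_restr L : commutes p (op (@restrict F (cell I) L)).
    apply: comm => w; rewrite !free_liftE.
    by case wi: (w.1 == i); case Lw: (L w); rewrite ?free_liftE ?linear0 ?wi ?Lw.
  by split; [exact (comm_re _) | split; [exact (comm_re _) | split; [exact (comm_re _) |
    split; [exact (comm_re _) | split; [exact (comm_restr _) | split; exact (comm_restr _)]]]]].
- move=> N h; exists (to_hom (@free_lift F I _ (fun i : I => ap (h i) u) \o fB)) => i.
  by apply: (line_ext Uu); rewrite ap_cmp eu ap_to_hom /= gBK free_liftE.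
Qed.
End Coding.

Local Close Scope ring_scope.

(** * Definability in the category of modules *)

Section Morphism.
Variable C : category.

(** Equal packages give the arrows the same ends only up to transport along equations between
    objects; by proof irrelevance these equations are [erefl] and the transport is trivial. *)
Lemma Morphism_inj (X Y : obj C) (f g : hom X Y) : Morphism f = Morphism g -> f = g.
Proof.
move=> e; have H m : m = Morphism f -> forall (a : dom m = X) (b : cod m = Y),
    eq_rect _ (hom X) (eq_rect _ (fun X => hom X (cod m)) (arrow m) _ a) _ b = f.
  by move=> -> /= a b; rewrite (Prop_irrelevance a erefl) (Prop_irrelevance b erefl).
exact/esym/(H (Morphism g) (esym e) erefl erefl).
Qed.

Lemma comp_sat (X Y Z : obj C) (h : hom X Z) (f : hom Y Z) (g : hom X Y) :
  (exists X Y Z (u : hom Y Z) (v : hom X Y), [/\ Morphism f = Morphism u,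
     Morphism g = Morphism v & Morphism h = Morphism (cmp u v)]) <-> h = cmp f g.
Proof.
split=> [[X' [Y' [Z' [u [v [fu gv hw]]]]]]|->]; last by exists X, Y, Z, f, g.
have eX := congr1 (@dom C) gv; have eY := congr1 (@cod C) gv.
have eZ := congr1 (@cod C) fu; move: eX eY eZ => /= eX eY eZ; subst X' Y' Z'.
by move/Morphism_inj: hw => ->; move/Morphism_inj: gv => ->; move/Morphism_inj: fu => ->.
Qed.
End Morphism.

(* A context assigns to every skewfield [F] a type [cE F] of situations, in which
   the first [nO] object variables and [nM] morphism variables have prescribed
   values; [D G Q] says that a single formula defines [Q] in all situations. *)
Record ctx := Ctx {
  cE : skewfield -> Type;
  nO : nat;
  nM : nat;
  rO : forall F, cE F -> nat -> obj (Mod F);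
  rM : forall F, cE F -> nat -> morphism (Mod F)
}.
Arguments rO : clear implicits.
Arguments rM : clear implicits.

Definition D (G : ctx) (Q : forall F, cE G F -> Prop) : Prop :=
  exists p, forall F (e : cE G F) eo em,
    (forall i, i < nO G -> eo i = rO G F e i) ->
    (forall i, i < nM G -> em i = rM G F e i) ->
    (cat_sat eo em p <-> Q F e).

Definition ovar (G : ctx) := forall F, cE G F -> obj (Mod F).
Definition mvar (G : ctx) (X Y : ovar G) := forall F e, hom (X F e) (Y F e).

Variant isO (G : ctx) (X : ovar G) : Prop :=
  IsO n of n < nO G & forall F e, rO G F e n = X F e.
Variant isM (G : ctx) (X Y : ovar G) (f : mvar X Y) : Prop :=
  IsM n of n < nM G & forall F e, rM G F e n = Morphism (f F e).
Arguments isM : clear implicits.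
Arguments isM G {X Y} f.
Arguments isO : clear implicits.
Arguments D : clear implicits.

Definition sub (G' G : ctx) (r : forall F, cE G' F -> cE G F) : Prop :=
  [/\ nO G <= nO G', nM G <= nM G',
      forall F e i, i < nO G -> rO G' F e i = rO G F (r F e) i
    & forall F e i, i < nM G -> rM G' F e i = rM G F (r F e) i].
Arguments sub : clear implicits.

Lemma sub_refl G : sub G G (fun F e => e).
Proof. by split. Qed.

Lemma sub_trans G3 G2 G1 r2 r1 : sub G3 G2 r2 -> sub G2 G1 r1 ->
  sub G3 G1 (fun F e => r1 F (r2 F e)).
Proof.
move=> [a1 a2 a3 a4] [b1 b2 b3 b4]; split.
- exact: leq_trans b1 a1.
- exact: leq_trans b2 a2.
- by move=> F e i li; rewrite a3 ?b3 //; apply: leq_trans b1.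
by move=> F e i li; rewrite a4 ?b4 //; apply: leq_trans b2.
Qed.

Lemma D_sub G' G r Q : sub G' G r -> D G Q -> D G' (fun F e => Q F (r F e)).
Proof.
move=> [a1 a2 a3 a4] [p pP]; exists p => F e eo em eoP emP; apply: pP => i li.
  by rewrite eoP ?a3 //; apply: leq_trans a1.
by rewrite emP ?a4 //; apply: leq_trans a2.
Qed.

Lemma isO_sub G' G r X : sub G' G r -> isO G X -> isO G' (fun F e => X F (r F e)).
Proof.
move=> [a1 a2 a3 a4] [n ln nP]; exists n; first exact: leq_trans a1.
by move=> F e; rewrite a3.
Qed.

Lemma isM_sub G' G r X Y (f : @mvar G X Y) : sub G' G r -> isM G f ->
  @isM G' (fun F e => X F (r F e)) (fun F e => Y F (r F e)) (fun F e => f F (r F e)).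
Proof.
move=> [a1 a2 a3 a4] [n ln nP]; exists n; first exact: leq_trans a2.
by move=> F e; rewrite a4.
Qed.

Definition extO (G : ctx) : ctx := {|
  cE F := (cE G F * obj (Mod F))%type;
  nO := (nO G).+1;
  nM := nM G;
  rO F e i := if i == nO G then e.2 else rO G F e.1 i;
  rM F e i := rM G F e.1 i |}.

Definition extH (G : ctx) (X Y : ovar G) : ctx := {|
  cE F := {e : cE G F & hom (X F e) (Y F e)};
  nO := nO G;
  nM := (nM G).+1;
  rO F e i := rO G F (projT1 e) i;
  rM F e i := if i == nM G then Morphism (projT2 e) else rM G F (projT1 e) i |}.

(** The situations change but the variables do not. This serves both to repack data into a record
    and to keep only the situations that satisfy a condition. *)
Definition pull (G : ctx) (E : skewfield -> Type) (r : forall F, E F -> cE G F) : ctx := {|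
  cE := E;
  nO := nO G;
  nM := nM G;
  rO F e i := rO G F (r F e) i;
  rM F e i := rM G F (r F e) i |}.

Lemma sub_extO G : sub (extO G) G (fun F e => e.1).
Proof. by split=> //= F e i li; rewrite ltn_eqF. Qed.
Lemma sub_extH G X Y : sub (@extH G X Y) G (fun F e => projT1 e).
Proof. by split=> //= F e i li; rewrite ltn_eqF. Qed.
Lemma sub_pull G E r : sub (@pull G E r) G r.
Proof. by split. Qed.

Lemma isO_here G : isO (extO G) (fun F e => e.2).
Proof. by exists (nO G) => //= F e; rewrite eqxx. Qed.
Lemma isM_here G X Y : @isM (@extH G X Y) (fun F e => X F (projT1 e))
  (fun F e => Y F (projT1 e)) (fun F e => projT2 e).
Proof. by exists (nM G) => //= F e; rewrite eqxx. Qed.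

Section Rules.
Variable G : ctx.
Implicit Types (P Q : forall F, cE G F -> Prop) (X Y Z : ovar G).

Lemma D_iff P Q : (forall F e, P F e <-> Q F e) -> D G P -> D G Q.
Proof. by move=> PQ [p pP]; exists p => F e eo em ? ?; rewrite -PQ; exact: pP. Qed.

Lemma D_not P : D G P -> D G (fun F e => ~ P F e).
Proof.
by move=> [p pP]; exists (CNot p) => F e eo em ho hm /=; rewrite (pP F e eo em ho hm).
Qed.
Lemma D_and P Q : D G P -> D G Q -> D G (fun F e => P F e /\ Q F e).
Proof.
move=> [p pP] [q qQ]; exists (CAnd p q) => F e eo em ho hm /=.
by rewrite (pP F e eo em ho hm) (qQ F e eo em ho hm).
Qed.
Lemma D_or P Q : D G P -> D G Q -> D G (fun F e => P F e \/ Q F e).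
Proof.
move=> [p pP] [q qQ]; exists (COr p q) => F e eo em ho hm /=.
by rewrite (pP F e eo em ho hm) (qQ F e eo em ho hm).
Qed.
Lemma D_imp P Q : D G P -> D G Q -> D G (fun F e => P F e -> Q F e).
Proof.
move=> [p pP] [q qQ]; exists (CImp p q) => F e eo em ho hm /=.
by rewrite (pP F e eo em ho hm) (qQ F e eo em ho hm).
Qed.

(** The bound variable takes the number [nO G], the first one whose value the context does not
    prescribe. *)
Lemma D_exO (Q : forall F, cE G F -> obj (Mod F) -> Prop) :
  D (extO G) (fun F e => Q F e.1 e.2) -> D G (fun F e => exists x, Q F e x).
Proof.
move=> [p pP]; exists (CExO (nO G) p) => F e eo em ho hm /=.
have H x : cat_sat [eta eo with nO G |-> x] em p <-> Q F e x.
  apply: (pP F (e, x)) => i /=; last exact: hm.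
  by rewrite ltnS leq_eqVlt; case: eqP => //= _; apply: ho.
by split=> -[x] /H; exists x.
Qed.

(** The language quantifies over all morphisms at once; the quantifier is relativised by [CMor], and
    a morphism with the right ends is turned back into an element of the hom type. *)
Lemma D_exH X Y (Q : forall F e, hom (X F e) (Y F e) -> Prop) :
  isO G X -> isO G Y ->
  D (extH X Y) (fun F e => Q F (projT1 e) (projT2 e)) ->
  D G (fun F e => exists f, Q F e f).
Proof.
move=> [x lx xP] [y ly yP] [p pP].
exists (CExM (nM G) (CAnd (CMor (nM G) x y) p)) => F e eo em ho hm /=.
have H f : cat_sat eo [eta em with nM G |-> Morphism f] p <-> Q F e f.
  apply: (pP F (existT _ e f)) => i /=; first exact: ho.
  by rewrite ltnS leq_eqVlt; case: eqP => //= _; apply: hm.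
rewrite eqxx !ho // xP yP.
split=> [[u [[dX cY] pu]]|[f Qf]]; last first.
  by exists (@Morphism (Mod F) (X F e) (Y F e) f); split=> //; apply/H.
by case: u dX cY pu => dm cd f /= dX cY; subst dm cd => /H Qf; exists f.
Qed.

Lemma D_comp X Y Z (h : mvar X Z) (f : mvar Y Z) (g : mvar X Y) :
  isM G h -> isM G f -> isM G g -> D G (fun F e => h F e = cmp (f F e) (g F e)).
Proof.
move=> [a la aP] [b lb bP] [c lc cP]; exists (CComp a b c) => F e eo em ho hm /=.
by rewrite !hm // aP bP cP; exact: (@comp_sat (Mod F) _ _ _ (h F e) (f F e) (g F e)).
Qed.

Lemma D_eq X Y (f g : mvar X Y) : isM G f -> isM G g -> D G (fun F e => f F e = g F e).
Proof.
move=> [a la aP] [b lb bP]; exists (CEqM a b) => F e eo em ho hm /=.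
by rewrite !hm // aP bP; split=> [/(@Morphism_inj (Mod F))|->].
Qed.

Lemma D_id X (f : mvar X X) : isO G X -> isM G f -> D G (fun F e => f F e = idm (X F e)).
Proof.
move=> [a la aP] [b lb bP]; exists (CId b a) => F e eo em ho hm /=.
by rewrite hm // ho // aP bP; split=> [/(@Morphism_inj (Mod F))|->].
Qed.

Lemma D_True : D G (fun F e => True).
Proof. by exists (CAllO 0 (CEqO 0 0)). Qed.

End Rules.

Section Rules2.
Variable G : ctx.
Implicit Types (P Q : forall F, cE G F -> Prop) (X Y Z : ovar G).

Lemma D_allO (Q : forall F, cE G F -> obj (Mod F) -> Prop) :
  D (extO G) (fun F e => Q F e.1 e.2) -> D G (fun F e => forall x, Q F e x).
Proof.
move=> /D_not DQ; apply: (D_iff _ (D_not (D_exO (Q := fun F e x => ~ Q F e x) DQ))) => F e.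
split=> [nQ x|aQ [x]//]; apply: contrapT => nx; apply: nQ; by exists x.
Qed.

Lemma D_allH X Y (Q : forall F e, hom (X F e) (Y F e) -> Prop) :
  isO G X -> isO G Y ->
  D (extH X Y) (fun F e => Q F (projT1 e) (projT2 e)) ->
  D G (fun F e => forall f, Q F e f).
Proof.
move=> iX iY /D_not DQ.
apply: (D_iff _ (D_not (D_exH (Q := fun F e x => ~ Q F e x) iX iY DQ))) => F e.
split=> [nQ x|aQ [x]//]; apply: contrapT => nx; apply: nQ; by exists x.
Qed.
End Rules2.

(** The rules ask for a variable that carries a given datum. The search goes through the chain of
    extensions, the newest first, and then through the hypotheses. *)
Ltac mk_sub G' G :=
  lazymatch G' with
  | G => constr:(sub_refl G)
  | extO ?H => let s := mk_sub H G in constr:(sub_trans (sub_extO H) s)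
  | @extH ?H ?X ?Y => let s := mk_sub H G in constr:(sub_trans (@sub_extH H X Y) s)
  | @pull ?H ?E ?r => let s := mk_sub H G in constr:(sub_trans (@sub_pull H E r) s)
  end.

Ltac var_here G' G :=
  lazymatch G with
  | extO ?H =>
    first [lazymatch goal with |- isO _ _ =>
             let s := mk_sub G' G in exact (isO_sub s (isO_here H)) end | var_here G' H]
  | @extH ?H ?X ?Y =>
    first [lazymatch goal with |- @isM _ _ _ _ =>
             let s := mk_sub G' G in exact (isM_sub s (@isM_here H X Y)) end | var_here G' H]
  | @pull ?H ?E ?r => var_here G' H
  end.

Ltac var :=
  match goal with
  | |- isO ?G' _ => first [var_here G' G' |
      match goal with H : isO ?G _ |- _ =>
        let s := mk_sub G' G in exact (isO_sub s H) end]
  | |- @isM ?G' _ _ _ => first [var_here G' G' |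
      match goal with H : @isM ?G _ _ _ |- _ =>
        let s := mk_sub G' G in exact (isM_sub s H) end]
  end.

(** Composites are not terms of the language, so the common value has to be named by a quantified
    morphism. *)
Lemma D_comp2 G X Y Y' Z (f : mvar Y Z) (g : @mvar G X Y) (f' : mvar Y' Z) (g' : mvar X Y') :
  isO G X -> isO G Z -> isM G f -> isM G g -> isM G f' -> isM G g' ->
  D G (fun F e => cmp (f F e) (g F e) = cmp (f' F e) (g' F e)).
Proof.
move=> iX iZ hf hg hf' hg'.
apply: (@D_iff _ (fun F e => exists h, h = cmp (f F e) (g F e) /\ h = cmp (f' F e) (g' F e))).
  by move=> F e; split=> [[h [-> //]]|e']; eexists.
apply: D_exH => //; apply: D_and; apply: D_comp; var.
Qed.

Lemma D_comp_id G X Y (f : mvar Y X) (g : @mvar G X Y) :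
  isO G X -> isM G f -> isM G g ->
  D G (fun F e => cmp (f F e) (g F e) = idm (X F e)).
Proof.
move=> iX hf hg.
apply: (@D_iff _ (fun F e => exists h, h = cmp (f F e) (g F e) /\ h = idm (X F e))).
  by move=> F e; split=> [[h [-> //]]|e']; eexists.
apply: D_exH => //; apply: D_and; first by apply: D_comp; var.
apply: D_id; var.
Qed.


(** * Tuples of morphisms as blocks of consecutive variables *)

Fixpoint homs (C : category) (A : Type) (ev : A -> obj C * obj C) (l : seq A) : Type :=
  if l is a :: l' then (hom (ev a).1 (ev a).2 * homs ev l')%type else unit.

Fixpoint hnth (C : category) (A : Type) (ev : A -> obj C * obj C) (d : morphism C)
    (l : seq A) : homs ev l -> nat -> morphism C :=
  match l with
  | [::] => fun _ _ => d
  | a :: l' => fun h n => if n is n'.+1 then hnth d h.2 n' else Morphism h.1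
  end.

Section HomsCtx.
Variable A : eqType.

Definition evO (G : ctx) (av : A -> ovar G * ovar G) F (e : cE G F) (a : A) :=
  ((av a).1 F e, (av a).2 F e).

Definition extHs (G : ctx) (av : A -> ovar G * ovar G) (l : seq A) : ctx := {|
  cE F := {e : cE G F & homs (evO av e) l};
  nO := nO G;
  nM := nM G + size l;
  rO F e i := rO G F (projT1 e) i;
  rM F e i := if i < nM G then rM G F (projT1 e) i
              else hnth (rM G F (projT1 e) i) (projT2 e) (i - nM G) |}.

Lemma sub_extHs G av l : sub (@extHs G av l) G (fun F e => projT1 e).
Proof. by split=> //= [|F e i ->//]; exact: leq_addr. Qed.

Lemma hnth_dflt (C : category) (ev : A -> obj C * obj C) d d' l (h : homs ev l) n :
  n < size l -> hnth d h n = hnth d' h n.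
Proof. by elim: l h n => //= a l IH [f h] [|n] //= /IH. Qed.

Lemma D_exHs (G : ctx) (av : A -> ovar G * ovar G) l
    (Q : forall F (e : cE G F), homs (evO av e) l -> Prop) :
  (forall a, a \in l -> isO G (av a).1 /\ isO G (av a).2) ->
  D (extHs av l) (fun F e => Q F (projT1 e) (projT2 e)) ->
  D G (fun F e => exists h, Q F e h).
Proof.
elim: l G av Q => [|a l IH] G av Q iO DQ.
  apply: (@D_iff _ (fun F e => Q F e tt)); first by move=> F e; split=> [|[[]//]]; exists tt.
  pose r F (e : cE G F) : cE (extHs av [::]) F := existT _ e tt.
  apply: (D_sub (r := r) _ DQ).
  split=> //=; first by rewrite addn0.
  by move=> F e i; rewrite addn0 => ->.
pose G' := @extH G (av a).1 (av a).2.
pose av' b : ovar G' * ovar G' :=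
  (fun F e => (av b).1 F (projT1 e), fun F e => (av b).2 F (projT1 e)).
pose Q' F (e : cE G' F) (h : homs (evO av' e) l) := Q F (projT1 e) (projT2 e, h).
apply: (@D_iff _ (fun F e => exists f h, Q F e (f, h))).
  move=> F e; split=> [[f [h q]]|[[f h] q]]; first by exists (f, h).
  by exists f, h.
have [i1 i2] := iO a (mem_head _ _).
apply: D_exH => //; apply: (IH G' av' Q').
  by move=> b bl; have [j1 j2] := iO b (mem_behead (s := a :: l) bl); rewrite /av' /G'; split; var.
pose r F (e : cE (extHs av' l) F) : cE (extHs av (a :: l)) F :=
  existT _ (projT1 (projT1 e)) (projT2 (projT1 e), projT2 e).
apply: (D_sub (r := r) _ DQ); split=> //=; first by rewrite addSnnS.
move=> F e i li; rewrite ltnS.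
have [lt_i|gt_i|->] := ltngtP i (nM G) => //=; last by rewrite subnn.
(* The first morphism of the block already belongs to [G'], so positions in the remaining block are
   lower by one. *)
have -> : i - nM G = (i - (nM G).+1).+1 by lia.
by apply: hnth_dflt; lia.
Qed.

Fixpoint isHs (G : ctx) (av : A -> ovar G * ovar G) (l : seq A) :
    (forall F (e : cE G F), homs (evO av e) l) -> Prop :=
  match l with
  | [::] => fun _ => True
  | a :: l' => fun h => isM G (fun F e => (h F e).1) /\ isHs (fun F e => (h F e).2)
  end.

Lemma isHs_names (G : ctx) (av : A -> ovar G * ovar G) l
    (h : forall F (e : cE G F), homs (evO av e) l) d n :
  (forall F e i, i < size l -> rM G F e (n + i) = hnth (d F e) (h F e) i) ->
  n + size l <= nM G -> isHs h.
Proof.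
elim: l h n => [|a l IH] //= h n hn ln; split.
  by exists n; [lia|] => F e; have := hn F e 0 isT; rewrite addn0.
apply: (IH _ n.+1) => [F e i li|]; last by lia.
by rewrite -(hn F e i.+1) // addSnnS.
Qed.

Lemma isHs_here (G : ctx) (av : A -> ovar G * ovar G) l :
  @isHs (extHs av l)
    (fun a => (fun F e => (av a).1 F (projT1 e), fun F e => (av a).2 F (projT1 e))) l
    (fun F e => projT2 e).
Proof.
apply: (@isHs_names (extHs av l)
  (fun a => (fun F e => (av a).1 F (projT1 e), fun F e => (av a).2 F (projT1 e))) l
  (fun F e => projT2 e) (fun F e => rM G F (projT1 e) 0) (nM G)) => [F e i li|//=].
rewrite /= ltnNge leq_addr /= addKn; exact: hnth_dflt.
Qed.

Lemma isHs_sub G' G r (av : A -> ovar G * ovar G) l h : sub G' G r -> @isHs G av l h ->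
  @isHs G' (fun a => (fun F e => (av a).1 F (r F e), fun F e => (av a).2 F (r F e))) l
    (fun F e => h F (r F e)).
Proof.
move=> s; elim: l h => [|a l IH] h //= [h1 h2]; split; first exact: (isM_sub s h1).
exact: IH h2.
Qed.

End HomsCtx.

Section ScodeCtx.
Variables (G : ctx) (U : ovar G).

Let N := extO (extO G).
Let tgt (n : nat) : ovar N :=
  match n with 0 => fun F e => e.1.2 | 1 => fun F e => e.2 | _ => fun F e => U e.1.1 end.
Let av (p : nat * nat) : ovar N * ovar N := (tgt p.1, tgt p.2).
(** Source and target of the nine morphisms of an [scode], in the order of its fields: 0, 1 and 2
    stand for [sB], [sX] and [U], so the pairs belong to [sU], [sM] and the seven operators. *)
Let nl : seq (nat * nat) :=
  [:: (0, 2); (1, 0); (1, 1); (1, 1); (1, 1); (1, 1); (1, 1); (1, 1); (1, 1)].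
Let NS := extHs av nl.

Definition extS : ctx := @pull NS (fun F => {e : cE G F & scode (U e)})
  (fun F e => let z := projT2 e in
    existT (fun e : cE N F => homs (evO av e) nl) (projT1 e, sB z, sX z)
      (sU z, (sM z, (s1 z, (s2 z, (s3 z, (s4 z, (s5 z, (s6 z, (s7 z, tt)))))))))).

Lemma sub_extS : sub extS G (fun F e => projT1 e).
Proof.
exact: (sub_trans (@sub_pull NS _ _) (sub_trans (sub_extHs _ _)
  (sub_trans (sub_extO _) (sub_extO _)))).
Qed.

Lemma D_exS (Q : forall F e, scode (U e) -> Prop) :
  isO G U -> D extS (fun F e => Q F (projT1 e) (projT2 e)) ->
  D G (fun F e => exists z, Q F e z).
Proof.
move=> iU DQ.
pose mk F (e : cE N F) (h : homs (evO av e) nl) : scode (U e.1.1) :=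
  @Scode F (U e.1.1) e.1.2 e.2 h.1 h.2.1 h.2.2.1 h.2.2.2.1 h.2.2.2.2.1 h.2.2.2.2.2.1
    h.2.2.2.2.2.2.1 h.2.2.2.2.2.2.2.1 h.2.2.2.2.2.2.2.2.1.
pose r F (e : cE NS F) : cE extS F :=
  existT (fun e => scode (U e)) (projT1 e).1.1 (mk F (projT1 e) (projT2 e)).
have sr : sub NS extS r.
  by split=> // F e i _; case: e => [[[e B] X] [? [? [? [? [? [? [? [? [? []]]]]]]]]]].
apply: (@D_iff _ (fun F e => exists B X h, Q F e (mk F (e, B, X) h))).
  move=> F e; split=> [[B [X [h q]]]|[[B X u m t1 t2 t3 t4 t5 t6 t7] q]].
    by exists (mk F (e, B, X) h).
  by exists B, X, (u, (m, (t1, (t2, (t3, (t4, (t5, (t6, (t7, tt))))))))).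
apply: D_exO; apply: D_exO; apply: (@D_exHs _ N av nl (fun F e h => Q F e.1.1 (mk F e h))).
  have iO n : isO N (tgt n) by rewrite /tgt /N; case: n => [|[|n]]; var.
  by move=> p _; split; exact: iO.
exact: (D_sub sr DQ).
Qed.

Record isS (z : forall F (e : cE G F), scode (U e)) : Prop := IsS {
  isS_B : isO G (fun F e => sB (z F e));
  isS_X : isO G (fun F e => sX (z F e));
  isS_U : isM G (fun F e => sU (z F e));
  isS_M : isM G (fun F e => sM (z F e));
  isS_1 : isM G (fun F e => s1 (z F e));
  isS_2 : isM G (fun F e => s2 (z F e));
  isS_3 : isM G (fun F e => s3 (z F e));
  isS_4 : isM G (fun F e => s4 (z F e));
  isS_5 : isM G (fun F e => s5 (z F e));
  isS_6 : isM G (fun F e => s6 (z F e));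
  isS_7 : isM G (fun F e => s7 (z F e))
}.
End ScodeCtx.

Lemma isS_sub G' G r (U : ovar G) z : sub G' G r -> @isS G U z ->
  @isS G' (fun F e => U F (r F e)) (fun F e => z F (r F e)).
Proof.
move=> s [hB hX h1 h2 h3 h4 h5 h6 h7 h8 h9]; split.
- exact: (isO_sub s hB).
- exact: (isO_sub s hX).
- exact: (isM_sub s h1).
- exact: (isM_sub s h2).
- exact: (isM_sub s h3).
- exact: (isM_sub s h4).
- exact: (isM_sub s h5).
- exact: (isM_sub s h6).
- exact: (isM_sub s h7).
- exact: (isM_sub s h8).
- exact: (isM_sub s h9).
Qed.

Lemma isS_here G (U : ovar G) :
  @isS (extS U) (fun F e => U F (projT1 e)) (fun F e => projT2 e).
Proof.
have h k : k < 9 -> nM G + k < nM G + 9 by rewrite ltn_add2l.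
split.
- by exists (nO G) => [|F e]; rewrite /= ?ltnS ?leqnSn // (ltn_eqF (ltnSn _)) eqxx.
- by exists (nO G).+1 => // F e /=; rewrite eqxx.
- by exists (nM G + 0) => [|F e]; rewrite /= ?h // ltnNge leq_addr addKn.
- by exists (nM G + 1) => [|F e]; rewrite /= ?h // ltnNge leq_addr addKn.
- by exists (nM G + 2) => [|F e]; rewrite /= ?h // ltnNge leq_addr addKn.
- by exists (nM G + 3) => [|F e]; rewrite /= ?h // ltnNge leq_addr addKn.
- by exists (nM G + 4) => [|F e]; rewrite /= ?h // ltnNge leq_addr addKn.
- by exists (nM G + 5) => [|F e]; rewrite /= ?h // ltnNge leq_addr addKn.
- by exists (nM G + 6) => [|F e]; rewrite /= ?h // ltnNge leq_addr addKn.
- by exists (nM G + 7) => [|F e]; rewrite /= ?h // ltnNge leq_addr addKn.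
- by exists (nM G + 8) => [|F e]; rewrite /= ?h // ltnNge leq_addr addKn.
Qed.

Ltac mk_sub G' G ::=
  lazymatch G' with
  | G => constr:(sub_refl G)
  | extO ?H => let s := mk_sub H G in constr:(sub_trans (sub_extO H) s)
  | @extH ?H ?X ?Y => let s := mk_sub H G in constr:(sub_trans (@sub_extH H X Y) s)
  | @pull ?H ?E ?r => let s := mk_sub H G in constr:(sub_trans (@sub_pull H E r) s)
  | @extHs ?A ?H ?av ?l => let s := mk_sub H G in constr:(sub_trans (@sub_extHs A H av l) s)
  | @extS ?H ?U => let s := mk_sub H G in constr:(sub_trans (@sub_extS H U) s)
  end.

Ltac var_here G' G ::=
  lazymatch G with
  | extO ?H =>
    first [lazymatch goal with |- isO _ _ =>
             let s := mk_sub G' G in exact (isO_sub s (isO_here H)) end | var_here G' H]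
  | @extH ?H ?X ?Y =>
    first [lazymatch goal with |- @isM _ _ _ _ =>
             let s := mk_sub G' G in exact (isM_sub s (@isM_here H X Y)) end | var_here G' H]
  | @pull ?H ?E ?r => var_here G' H
  | @extHs ?A ?H ?av ?l => var_here G' H
  | @extS ?H ?U =>
    first [lazymatch goal with |- @isS _ _ _ =>
             let s := mk_sub G' G in exact (isS_sub s (@isS_here H U)) end | var_here G' H]
  end.

Ltac var ::=
  match goal with
  | |- isO ?G' _ => first [var_here G' G' |
      match goal with H : isO ?G _ |- _ =>
        let s := mk_sub G' G in exact (isO_sub s H) end |
      match goal with H : @isS ?G ?U _ |- _ =>
        let s := mk_sub G' G in first
          [exact (isO_sub s (isS_B H)) | exact (isO_sub s (isS_X H))] end]
  | |- @isM ?G' _ _ _ => first [var_here G' G' |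
      match goal with H : @isM ?G _ _ _ |- _ =>
        let s := mk_sub G' G in exact (isM_sub s H) end |
      match goal with H : @isS ?G ?U _ |- _ =>
        let s := mk_sub G' G in first
          [ exact (isM_sub s (isS_U H)) | exact (isM_sub s (isS_M H))
          | exact (isM_sub s (isS_1 H)) | exact (isM_sub s (isS_2 H))
          | exact (isM_sub s (isS_3 H)) | exact (isM_sub s (isS_4 H))
          | exact (isM_sub s (isS_5 H)) | exact (isM_sub s (isS_6 H))
          | exact (isM_sub s (isS_7 H)) ] end]
  | |- @isS ?G' _ _ => first [var_here G' G' |
      match goal with H : @isS ?G _ _ |- _ =>
        let s := mk_sub G' G in exact (isS_sub s H) end]
  end.

Lemma D_coded G (U : ovar G) z (b : mvar U (fun F e => sB (z F e))) :
  isO G U -> isS z -> isM G b -> D G (fun F e => coded (b F e)).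
Proof.
move=> iU iz ib; rewrite /coded.
apply: D_and; first by apply: D_comp_id; var.
apply: D_exH; [var | var |].
apply: D_exH; [var | var |].
apply: D_and; first by apply: D_comp_id; var.
apply: D_and.
  apply: D_exH; [var | var |].
  by apply: D_and; [apply: D_comp | apply: D_comp2]; var.
do 6 (apply: D_and; [by apply: D_comp2; var|]).
by apply: D_comp2; var.
Qed.


(** * Relations on tuples of morphisms out of the line *)

Section Pcode.
Variables (F : skewfield) (A : Type) (tv : A -> obj (Mod F)).

Definition fan (Y : obj (Mod F)) (a : A) := (Y, tv a).

Fixpoint comp_homs (U Y : obj (Mod F)) l :
    homs (fan Y) l -> hom U Y -> homs (fan U) l :=
  match l with
  | [::] => fun _ _ => tt
  | a :: l' => fun h c => (cmp h.1 c : hom U (tv a), comp_homs h.2 c)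
  end.

Definition pcode (U : lmodule F) (l : seq A) :=
  {z : scode U & homs (fan (sB z)) l}.

(* A point [c] of the coded set stands for the tuple of its composites with the
   legs of [p]. *)
Definition prel (U : lmodule F) l (p : pcode U l) (args : homs (fan U) l) : Prop :=
  exists c, coded c /\ comp_homs (projT2 p) c = args.

Variables (U : lmodule F) (u : U).
Hypothesis Uu : gen_line u.

Lemma small_line_hom (N : obj (Mod F)) : small (@hom (Mod F) U N).
Proof.
apply: (@small_sub _ _ (fun f : @hom (Mod F) U N => ap f u)); last exact: small_El.
by move=> f g /(line_ext Uu).
Qed.

Lemma small_homs l : small (homs (fan U) l).
Proof.
elim: l => [|a l IH] /=; first exact: small_unit.
by apply: small_prod => //; exact: small_line_hom.
Qed.

Lemma homs_lift (I : Type) (B : obj (Mod F)) (e : I -> @hom (Mod F) U B) l :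
  (forall (N : lmodule F) (h : I -> @hom (Mod F) U N),
     exists f : @hom (Mod F) B N, forall i, cmp f (e i) = h i) ->
  forall g : I -> homs (fan U) l,
    exists h : homs (fan B) l, forall i, comp_homs h (e i) = g i.
Proof.
move=> lift; elim: l => [|a l IH] g; first by exists tt => i /=; case: (g i).
have [f fP] := lift (tv a) (fun i => (g i).1).
have [h hP] := IH (fun i => (g i).2).
by exists (f, h) => i; rewrite [LHS]/= hP [X in (X, _)]fP; case: (g i).
Qed.

(** The relation itself serves as index set: [coding] provides a point for each tuple in [S], and
    freeness provides legs whose composites with that point are the components. Smallness holds
    because a map out of the line is determined by its value at [u]. *)
Lemma pcode_complete l (S : homs (fan U) l -> Prop) :
  exists p : pcode U l, forall args, prel p args <-> S args.
Proof.
have sI : small {args | S args} by apply: small_sub (@sval_inj _ S) (small_homs l).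
have [z [e [inj_e eP lift]]] := coding Uu sI.
have [h hP] := homs_lift lift (fun i => sval i).
exists (existT _ z h) => args; split.
  by move=> [c [/eP[i ->] <-]] /=; rewrite hP; exact: (svalP i).
move=> Sa; exists (e (exist _ args Sa)); split; first by apply/eP; eexists.
by rewrite /= hP.
Qed.
End Pcode.

Section PcodeCtx.
Variable A : eqType.

Section Here.
Variables (G : ctx) (U : ovar G) (tv : A -> ovar G).

Definition tgt_at F (e : cE G F) (a : A) : obj (Mod F) := tv a e.

Definition fanv (Y : ovar G) (a : A) : ovar G * ovar G := (Y, tv a).

Definition pvar (l : seq A) := forall F (e : cE G F), pcode (tgt_at e) (U e) l.
Definition avar (l : seq A) := forall F (e : cE G F), homs (fan (tgt_at e) (U e)) l.

Definition isA l (args : avar l) : Prop := @isHs A G (fanv U) l args.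

Definition isP l (p : pvar l) : Prop :=
  isS (fun F e => projT1 (p F e)) /\
  @isHs A G (fanv (fun F e => sB (projT1 (p F e)))) l (fun F e => projT2 (p F e)).

Lemma D_comp_homs (Y : ovar G) l
    (h : forall F (e : cE G F), homs (fan (tgt_at e) (Y F e)) l) (c : mvar U Y) (args : avar l) :
  @isHs A G (fanv Y) l h -> isM G c -> isA args ->
  D G (fun F e => comp_homs (h F e) (c F e) = args F e).
Proof.
rewrite /isA; elim: l h args => [|a l IH] h args.
  move=> _ _ _; apply: D_iff (D_True G) => F e; split=> // _.
  by case: (args F e) (comp_homs _ _) => -[].
move=> /= [h1 h2] ic [a1 a2].
apply: (@D_iff _ (fun F e => (args F e).1 = cmp (h F e).1 (c F e) /\
                             comp_homs (h F e).2 (c F e) = (args F e).2)).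
  by move=> F e; case: (args F e) => x y /=; split=> [[-> ->]|[-> ->]].
by apply: D_and; [apply: (@D_comp _ _ _ _ (fun F e => (args F e).1)) | apply: IH].
Qed.

End Here.

Lemma isA_sub G' G r (U : ovar G) (tv : A -> ovar G) l args : sub G' G r ->
  @isA G U tv l args ->
  @isA G' (fun F e => U F (r F e)) (fun a F e => tv a F (r F e)) l (fun F e => args F (r F e)).
Proof. exact: isHs_sub. Qed.

Lemma isP_sub G' G r (U : ovar G) (tv : A -> ovar G) l p : sub G' G r ->
  @isP G U tv l p ->
  @isP G' (fun F e => U F (r F e)) (fun a F e => tv a F (r F e)) l (fun F e => p F (r F e)).
Proof. by move=> s [iz ih]; split; [exact: (isS_sub s iz) | exact: (isHs_sub s ih)]. Qed.

Lemma D_prel G (U : ovar G) (tv : A -> ovar G) l (p : pvar U tv l) (args : avar U tv l) :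
  isO G U -> isP p -> isA args -> D G (fun F e => prel (p F e) (args F e)).
Proof.
move=> iU [iz ih] ia; rewrite /prel.
apply: D_exH; [var | var |].
apply: D_and.
  by apply: D_coded; [var | var | var].
apply: (@D_comp_homs (extH U (fun F e => sB (projT1 (p F e)))) (fun F e => U F (projT1 e)) (fun a F e => tv a F (projT1 e))
  (fun F e => sB (projT1 (p F (projT1 e)))) l (fun F e => projT2 (p F (projT1 e)))
  (fun F e => projT2 e) (fun F e => args F (projT1 e))).
- exact: (isHs_sub (sub_extH _ _) ih).
- by var.
- exact: (isA_sub (sub_extH _ _) ia).
Qed.

Section ExtP.
Variables (G : ctx) (U : ovar G) (tv : A -> ovar G) (l : seq A).

Let NS := extS U.
Let av (a : A) : ovar NS * ovar NS :=
  (fun F e => sB (projT2 e), fun F e => tv a (projT1 e)).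
Let NH := extHs av l.

Definition extP : ctx := @pull NH (fun F => {e : cE G F & pcode (tgt_at tv e) (U e) l})
  (fun F e => let p := projT2 e in
    existT (fun e : cE NS F => homs (evO av e) l)
      (existT (fun e => scode (U e)) (projT1 e) (projT1 p)) (projT2 p)).

Lemma sub_extP : sub extP G (fun F e => projT1 e).
Proof.
exact: (sub_trans (@sub_pull NH _ _) (sub_trans (sub_extHs _ _) (sub_extS U))).
Qed.

Lemma isP_here : @isP extP (fun F e => U (projT1 e)) (fun a F e => tv a (projT1 e)) l
  (fun F e => projT2 e).
Proof.
split.
  exact: (isS_sub (sub_trans (@sub_pull NH _ _) (sub_extHs _ _)) (isS_here U)).
exact: (isHs_sub (@sub_pull NH _ _) (isHs_here av l)).
Qed.

Lemma D_exPcode (Q : forall F e, pcode (tgt_at tv e) (U e) l -> Prop) :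
  isO G U -> {in l, forall a, isO G (tv a)} ->
  D extP (fun F e => Q F (projT1 e) (projT2 e)) -> D G (fun F e => exists p, Q F e p).
Proof.
move=> iU itv DQ.
apply: (@D_iff _ (fun F e => exists (z : scode (U e)) h, Q F e (existT _ z h))).
  by move=> F e; split=> [[z [h q]]|[[z h] q]]; [eexists; exact: q | exists z, h].
apply: D_exS => //.
apply: (@D_exHs _ NS av l (fun F e h => Q F (projT1 e) (existT _ (projT2 e) h))).
  move=> a al; split; first exact: (isS_B (isS_here U)).
  exact: (isO_sub (sub_extS U) (itv a al)).
pose r F (e : cE NH F) : cE extP F :=
  existT (fun e => pcode (tgt_at tv e) (U e) l) (projT1 (projT1 e))
    (existT (fun z => homs (fan _ (sB z)) l) (projT2 (projT1 e)) (projT2 e)).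
apply: (D_sub (r := r) _ DQ).
by split=> // F e i _; case: e => [[]].
Qed.

(** By [pcode_complete] every relation is [prel] of some code, so a second-order quantifier becomes
    a block of quantifiers over objects and morphisms. *)
Lemma D_exP (Q : forall F (e : cE G F), (homs (fan (tgt_at tv e) (U e)) l -> Prop) -> Prop) :
  isO G U -> {in l, forall a, isO G (tv a)} ->
  (forall F (e : cE G F), exists u : (U e : lmodule F), gen_line u) ->
  D extP (fun F e => Q F (projT1 e) (prel (projT2 e))) -> D G (fun F e => exists S, Q F e S).
Proof.
move=> iU itv line DQ.
apply: (@D_iff _ (fun F e => exists p : pcode (tgt_at tv e) (U e) l, Q F e (prel p))).
  move=> F e; split=> [[p q]|[S q]]; first by exists (prel p).
  have [u Uu] := line F e; have [p pS] := pcode_complete Uu S.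
  by exists p; rewrite (_ : prel p = S) //; apply/funext => x; apply/propext.
exact: D_exPcode.
Qed.

Lemma D_allP (Q : forall F (e : cE G F), (homs (fan (tgt_at tv e) (U e)) l -> Prop) -> Prop) :
  isO G U -> {in l, forall a, isO G (tv a)} ->
  (forall F (e : cE G F), exists u : (U e : lmodule F), gen_line u) ->
  D extP (fun F e => Q F (projT1 e) (prel (projT2 e))) -> D G (fun F e => forall S, Q F e S).
Proof.
move=> iU itv line DQ.
apply: (@D_iff _ (fun F e => ~ exists S, ~ Q F e S)).
  move=> F e; split=> [nQ S|aQ [S]//]; apply: contrapT => nS; apply: nQ; by exists S.
by apply/D_not/D_exP => //; apply: D_not DQ.
Qed.
End ExtP.

End PcodeCtx.

(** * Cardinals as initial well-orders *)

Lemma small_range (T : Type) (f : T -> V) : small T ->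
  exists r, forall z, z ∈ r <-> exists t, z = f t.
Proof.
move=> [A [h hs]]; exists (range_V (f \o h)) => z; rewrite elt_range_V.
split=> [[a ->]|[t ->]]; first by exists (h a).
by have [a ->] := hs t; exists a.
Qed.

Lemma separation (x : V) (P : V -> Prop) :
  exists y, forall z, z ∈ y <-> z ∈ x /\ P z.
Proof.
have [|y yP] := @small_range {z : El x | P (sval z)} (fun z => sval (sval z)).
  by apply: small_sub (@sval_inj _ _) (small_El x).
exists y => z; rewrite yP; split=> [[[[w wx] Pw] ->]//|[zx Pz]].
by exists (exist (fun z : El x => P (sval z)) (exist _ z zx) Pz).
Qed.

Definition mkEl (x y : V) (yx : y ∈ x) : El x := exist _ y yx.

Section InitialWo.
Variable H : Type.

(* The relations below take nested pairs ended by [tt] because relations on the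
   points of a code are predicates on [homs]. *)
Definition matches (C : H -> Prop) (W : H -> H -> Prop) (b0 : H)
    (R : H * (H * unit) -> Prop) : Prop :=
  (forall b, C b -> W b b0 -> exists b', C b' /\ R (b, (b', tt)) /\
     forall c, C c -> R (b, (c, tt)) -> c = b') /\
  (forall b', C b' -> exists b, C b /\ W b b0 /\ R (b, (b', tt)) /\
     forall c, C c -> W c b0 -> R (c, (b', tt)) -> c = b).

(** The order type of [C] is an initial ordinal: a relation with [matches C W b0 R] is a bijection
    from the segment below [b0] onto [C]. Only points and relations on points are quantified, as
    codes permit. *)
Definition initial_wo (C : H -> Prop) (W : H -> H -> Prop) : Prop :=
  (forall b, C b -> ~ W b b) /\
  (forall a b c, C a -> C b -> C c -> W a b -> W b c -> W a c) /\
  (forall S : H * unit -> Prop, (exists b, C b /\ S (b, tt)) ->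
     exists m, C m /\ S (m, tt) /\ forall b, C b -> S (b, tt) -> b = m \/ W m b) /\
  (forall b0, C b0 -> forall R, ~ matches C W b0 R).

(** [o] is an isomorphism from [C], ordered by [W], onto [k], ordered by membership; its values
    outside [C] are arbitrary. *)
Definition card_rep (C : H -> Prop) (W : H -> H -> Prop) (k : V) (o : H -> V) : Prop :=
  (forall b, C b -> o b ∈ k) /\
  (forall a, a ∈ k -> exists b, C b /\ o b = a) /\
  (forall b b', C b -> C b' -> o b = o b' -> b = b') /\
  (forall b b', C b -> C b' -> (W b b' <-> o b ∈ o b')).

Variables (C : H -> Prop) (W : H -> H -> Prop).

(** [o] is the Mostowski collapse of the order, and its range is a set [k] because [H] is small. A
    bijection of some [o b0] with [k], read as a relation on points, is what the last clause of
    [initial_wo] forbids. *)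
Lemma initial_wo_rep : small H -> initial_wo C W ->
  exists (k : Cn) (o : H -> V), card_rep C W k o.
Proof.
move=> sH [irr [tr [wo ini]]].
pose lt b' b := C b' /\ C b /\ W b' b.
have lt_wf : well_founded lt.
  move=> x; apply: contrapT => nx.
  have acc_out y : ~ C y -> Acc lt y by move=> ny; constructor => z [_ []].
  have [|m [Cm [nm mmin]]] := wo (fun p => ~ Acc lt p.1).
    by exists x; split=> //; apply: contrapT => /acc_out.
  apply: nm; constructor => y [Cy [_ ym]]; apply: contrapT => ny.
  have [ym'|my] := mmin y Cy ny; first by subst y; case: (irr m Cm ym).
  by case: (irr _ Cm (tr _ _ _ Cm Cy Cm my ym)).
have lt_tot x y : C x -> C y -> x = y \/ W x y \/ W y x.
  move=> Cx Cy; have [|m [Cm [mxy mmin]]] := wo (fun p => p.1 = x \/ p.1 = y).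
    by exists x; split=> //; left.
  case: mxy => /= e; subst m.
    by have [->|] := mmin y Cy (or_intror erefl); [left | right; left].
  by have [->|] := mmin x Cx (or_introl erefl); [left | right; right].
have rg b (f : {b' | lt b' b} -> V) : exists r, forall z, z ∈ r <-> exists t, z = f t.
  by apply: small_range; apply: small_sub (@sval_inj _ _) sH.
pose step b (F : forall b', lt b' b -> V) : V :=
  projT1 (cid (rg b (fun p => F (sval p) (svalP p)))).
pose o := Fix lt_wf (fun=> V) step.
have oP b z : z ∈ o b <-> exists b', lt b' b /\ z = o b'.
  rewrite /o Init.Wf.Fix_eq; last first.
    move=> x f g fg; congr step.
    by apply: functional_extensionality_dep => y; apply: functional_extensionality_dep => p.
  rewrite {1}/step; case: cid => r /= ->; split=> [[[b' l] ->]|[b' [l ->]]].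
    by exists b'.
  by exists (exist _ b' l).
have W_o b b' : C b -> C b' -> W b b' -> o b ∈ o b'.
  by move=> Cb Cb' w; apply/oP; exists b.
have inj_o b b' : C b -> C b' -> o b = o b' -> b = b'.
  move=> Cb Cb' e; case: (lt_tot b b') => [//|//|//|[|] w].
    by have := W_o _ _ Cb Cb' w; rewrite e => /elt_irr.
  by have := W_o _ _ Cb' Cb w; rewrite e => /elt_irr.
have o_W b b' : C b -> C b' -> o b ∈ o b' -> W b b'.
  by move=> Cb Cb' /oP[c [[Cc [_ w]] /inj_o->]].
have [k kP'] : exists k, forall z, z ∈ k <-> exists t : {b | C b}, z = o (sval t).
  by apply: small_range; apply: small_sub (@sval_inj _ _) sH.
have kP z : z ∈ k <-> exists b, C b /\ z = o b.
  rewrite kP'; split=> [[[b Cb] ->]|[b [Cb ->]]]; first by exists b.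
  by exists (exist _ b Cb).
have ck : cardinal_V k.
  split.
    split.
      move=> x y xy /kP[b [Cb yE]]; move: xy; rewrite yE => /oP[c [[Cc _] ->]].
      by apply/kP; exists c.
    split.
    - by move=> x _; exact: elt_irr.
    - move=> x y z /kP[a [Ca ->]] /kP[b [Cb ->]] /kP[c [Cc ->]] ab bc.
      by apply: W_o => //; apply: (tr a b c) => //; apply: o_W.
    - move=> s sk [x xs].
      have [|m [Cm [ms mmin]]] := wo (fun p => o p.1 ∈ s).
        by have /kP[b [Cb xE]] := sk _ xs; exists b; rewrite /= -xE.
      exists (o m) => // y ys; have /kP[b [Cb yE]] := sk _ ys; subst y.
      by have [->|w] := mmin b Cb ys; [left | right; exact: W_o].
  move=> a /kP[b0 [Cb0 ->]] [f [g fg gf]].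
  apply: (ini b0 Cb0 (fun p => exists q : o p.1 ∈ o b0, sval (f (mkEl q)) = o p.2.1)).
  split=> [b Cb /(W_o _ _ Cb Cb0) q|b' Cb'].
    have /kP[b' [Cb' fb']] := svalP (f (mkEl q)); exists b'; split=> //.
    split; first by exists q.
    move=> c Cc [q' /=]; rewrite (Prop_irrelevance q' q) fb' => /inj_o.
    by move=> /(_ Cb' Cc).
  have kb : o b' ∈ k by apply/kP; exists b'.
  have := svalP (g (mkEl kb)); move/oP => [b [[Cb [_ w]] gb]].
  exists b; split=> //; split=> //; split.
    exists (W_o _ _ Cb Cb0 w) => /=.
    rewrite (_ : mkEl _ = g (mkEl kb)) ?gf //.
    by apply: sval_inj; rewrite /= gb.
  move=> c Cc wc [q /= fc]; apply: inj_o => //; rewrite -gb.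
  have -> : mkEl kb = f (mkEl q) by apply: sval_inj; rewrite /= fc.
  by rewrite fg.
exists (exist _ k ck), o; split; first by move=> b Cb; apply/kP; exists b.
split; first by move=> a /kP[b [Cb ->]]; exists b.
by split=> // b b' Cb Cb'; split; [exact: W_o | exact: o_W].
Qed.

(** [o] carries the well-order of [k] back to [C]. A relation matching the segment below [b0] with
    all of [C] would give a bijection of [o b0] with [k], against [k] being a cardinal. *)
Lemma rep_initial_wo (k : Cn) (o : H -> V) : card_rep C W k o -> initial_wo C W.
Proof.
case: k => k /= [[tr_k [irr tr wo]] ini] [ok [ko [inj_o WP]]].
split; first by move=> b Cb; rewrite (WP b b Cb Cb); exact: elt_irr.
split.
  move=> a b c Ca Cb Cc; rewrite (WP a b) // (WP b c) // (WP a c) //.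
  by apply: tr; exact: ok.
split.
  move=> S [b [Cb Sb]].
  have [s sP] := separation k (fun z => exists b, C b /\ o b = z /\ S (b, tt)).
  have [||m ms mmin] := wo s; first by move=> x /sP[].
    by exists (o b); apply/sP; split; [exact: ok | exists b].
  have /sP[mk [c [Cc [cm Sc]]]] := ms; exists c; split=> //; split=> // d Cd Sd.
  have [|e|e] := mmin (o d); first by apply/sP; split; [exact: ok | exists d].
    by left; apply: inj_o => //; rewrite e cm.
  by right; apply/WP => //; rewrite cm.
move=> b0 Cb0 R [R1 R2]; apply: (ini (o b0) (ok _ Cb0)).
have /choice[f fP] (x : El (o b0)) : exists y : El k,
    exists b b', C b /\ C b' /\ W b b0 /\ R (b, (b', tt)) /\ sval x = o b /\ sval y = o b'.
  have [b [Cb bx]] := ko _ (tr_k _ _ (svalP x) (ok _ Cb0)).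
  have Wb : W b b0 by apply/WP => //; rewrite bx; exact: (svalP x).
  have [b' [Cb' [Rb _]]] := R1 b Cb Wb; exists (mkEl (ok _ Cb')), b, b'.
  by do !split.
have /choice[g gP] (y : El k) : exists x : El (o b0),
    exists b b', C b /\ C b' /\ W b b0 /\ R (b, (b', tt)) /\ sval x = o b /\ sval y = o b'.
  have [b' [Cb' by']] := ko _ (svalP y).
  have [b [Cb [Wb [Rb _]]]] := R2 b' Cb'.
  have q : o b ∈ o b0 by apply/WP.
  by exists (mkEl q), b, b'; do !split.
exists f, g => [x|y]; apply: sval_inj.
  have [b [b' [Cb [Cb' [Wb [Rb [xb fb]]]]]]] := fP x.
  have [c [c' [Cc [Cc' [Wc [Rc [xc fc]]]]]]] := gP (f x).
  rewrite xb xc; have e : c' = b' by apply: inj_o => //; rewrite -fc.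
  subst c'; have [d [Cd [Wd [Rd dP]]]] := R2 b' Cb'.
  by rewrite (dP c) // (dP b).
have [b [b' [Cb [Cb' [Wb [Rb [xb fb]]]]]]] := fP (g y).
have [c [c' [Cc [Cc' [Wc [Rc [xc fc]]]]]]] := gP y.
rewrite fb fc; have e : c = b by apply: inj_o => //; rewrite -xc.
subst c; have [d [Cd [Rd dP]]] := R1 b Cb Wb.
by rewrite (dP c') // (dP b').
Qed.
End InitialWo.

Section Bisim.
Variables (H1 H2 : Type) (C1 : H1 -> Prop) (W1 : H1 -> H1 -> Prop).
Variables (C2 : H2 -> Prop) (W2 : H2 -> H2 -> Prop).

(** This compares points of two different codes without reference to [V]: ordinals are equal as soon
    as their elements can be matched, recursively, in both directions. *)
Definition bisimulation (R : H1 * (H2 * unit) -> Prop) : Prop :=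
  forall b1 b2, C1 b1 -> C2 b2 -> R (b1, (b2, tt)) ->
    (forall a1, C1 a1 -> W1 a1 b1 -> exists a2, C2 a2 /\ W2 a2 b2 /\ R (a1, (a2, tt))) /\
    (forall a2, C2 a2 -> W2 a2 b2 -> exists a1, C1 a1 /\ W1 a1 b1 /\ R (a1, (a2, tt))).

Variables (k1 k2 : Cn) (o1 : H1 -> V) (o2 : H2 -> V).
Hypotheses (rep1 : card_rep C1 W1 k1 o1) (rep2 : card_rep C2 W2 k2 o2).

(** In a membership-minimal counterexample the two ordinals have the same elements, since the
    bisimulation matches the points below and these have equal values by minimality. *)
Lemma bisimulation_eq R b1 b2 : bisimulation R -> C1 b1 -> C2 b2 -> R (b1, (b2, tt)) ->
  o1 b1 = o2 b2.
Proof.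
case: rep1 rep2 => [ok1 [ko1 [inj1 WP1]]] [ok2 [ko2 [inj2 WP2]]] bR.
move=> C1b C2b Rb; apply: contrapT => ne.
have [|x [c1 [c2 [C1c [C2c [Rc [xc nc]]]]]] xmin] := @V_foundation (fun x =>
    exists c1 c2, C1 c1 /\ C2 c2 /\ R (c1, (c2, tt)) /\ x = o1 c1 /\ o1 c1 <> o2 c2).
  by exists (o1 b1), b1, b2.
have [bR1 bR2] := bR _ _ C1c C2c Rc.
have [[tr1 _] _] := svalP k1; have [[tr2 _] _] := svalP k2.
have sub a1 a2 : C1 a1 -> C2 a2 -> R (a1, (a2, tt)) -> W1 a1 c1 -> o1 a1 = o2 a2.
  move=> C1a C2a Ra Wa; apply: contrapT => na.
  by apply: (xmin (o1 a1)); [rewrite xc; apply/WP1 | exists a1, a2].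
apply: nc; apply: V_extensionality => z; split=> zc.
  have [a1 [C1a az]] := ko1 z (tr1 _ _ zc (ok1 _ C1c)).
  have Wa : W1 a1 c1 by apply/WP1 => //; rewrite az.
  have [a2 [C2a [Wa2 Ra]]] := bR1 a1 C1a Wa.
  by rewrite -az (sub a1 a2) //; apply/WP2.
have [a2 [C2a az]] := ko2 z (tr2 _ _ zc (ok2 _ C2c)).
have Wa : W2 a2 c2 by apply/WP2 => //; rewrite az.
have [a1 [C1a [Wa1 Ra]]] := bR2 a2 C2a Wa.
by rewrite -az -(sub a1 a2) //; apply/WP1.
Qed.

Lemma bisimulation_rep : bisimulation (fun p => o1 p.1 = o2 p.2.1).
Proof.
case: rep1 rep2 => [ok1 [ko1 [inj1 WP1]]] [ok2 [ko2 [inj2 WP2]]].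
have [[tr1 _] _] := svalP k1; have [[tr2 _] _] := svalP k2.
move=> b1 b2 C1b C2b /= e; split=> [a1 C1a /(WP1 _ _ C1a C1b) w|a2 C2a /(WP2 _ _ C2a C2b) w].
  have [a2 [C2a az]] : exists b, C2 b /\ o2 b = o1 a1.
    by apply: ko2; apply: tr2 (ok2 _ C2b); rewrite -e.
  by exists a2; split=> //; split; [apply/WP2 => //; rewrite az -e | rewrite az].
have [a1 [C1a az]] : exists b, C1 b /\ o1 b = o2 a2.
  by apply: ko1; apply: tr1 (ok1 _ C1b); rewrite e.
by exists a1; split=> //; split; [apply/WP1 => //; rewrite az e | rewrite az].
Qed.

(** Elements of different cardinals may be compared in L2, so equality of points has to make sense
    across two codes. *)
Lemma elt_eq_bisim b1 b2 : C1 b1 -> C2 b2 ->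
  (o1 b1 = o2 b2 <-> exists R, bisimulation R /\ R (b1, (b2, tt))).
Proof.
move=> C1b C2b; split=> [e|[R [bR Rb]]]; last exact: bisimulation_eq Rb.
by eexists; split; [exact: bisimulation_rep|].
Qed.

Lemma card_eq_bisim : k1 = k2 <-> exists R, bisimulation R /\
  (forall b1, C1 b1 -> exists b2, C2 b2 /\ R (b1, (b2, tt))) /\
  (forall b2, C2 b2 -> exists b1, C1 b1 /\ R (b1, (b2, tt))).
Proof.
have [ok1 [ko1 [inj1 WP1]]] := rep1; have [ok2 [ko2 [inj2 WP2]]] := rep2.
split=> [e|[R [bR [R1 R2]]]].
  eexists; split; first exact: bisimulation_rep; split=> [b1 C1b|b2 C2b] /=.
    by have := ok1 _ C1b; rewrite e => /ko2[b2 [C2b be]]; exists b2.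
  by have := ok2 _ C2b; rewrite -e => /ko1[b1 [C1b be]]; exists b1.
apply: sval_inj; apply: V_extensionality => z; split=> zk.
  have [b1 [C1b <-]] := ko1 _ zk; have [b2 [C2b Rb]] := R1 _ C1b.
  by rewrite (bisimulation_eq bR C1b C2b Rb); exact: ok2.
have [b2 [C2b <-]] := ko2 _ zk; have [b1 [C1b Rb]] := R2 _ C2b.
by rewrite -(bisimulation_eq bR C1b C2b Rb); exact: ok1.
Qed.
End Bisim.

(** * The ring of endomorphisms of a line *)

Section RingOps.
Local Open Scope ring_scope.

(* Among modules: nonzero, and every morphism into it is zero or split epi. *)
Definition one_dim (C : category) (U : obj C) : Prop :=
  (exists f g : hom U U, f <> g) /\
  forall (Z : obj C) (f : hom Z U),
    (forall (W : obj C) (g h : hom W Z), cmp f g = cmp f h) \/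
    exists g : hom U Z, cmp f g = idm U.

(* A biproduct [P] of [U] with itself, and its codiagonal [c]. *)
Definition sum_of (C : category) (U : obj C) (f1 f2 f3 : hom U U) : Prop :=
  exists (P : obj C) (i1 i2 : hom U P) (p1 p2 c : hom P U) (d : hom U P) (z : hom U U),
    (forall a : hom U U, cmp z a = z) /\
    cmp p1 i1 = idm U /\ cmp p2 i2 = idm U /\ cmp p1 i2 = z /\ cmp p2 i1 = z /\
    (forall v w : hom U P, cmp p1 v = cmp p1 w -> cmp p2 v = cmp p2 w -> v = w) /\
    cmp c i1 = idm U /\ cmp c i2 = idm U /\ f2 = cmp p1 d /\ f3 = cmp p2 d /\ f1 = cmp c d.

Variable F : skewfield.

(** The test morphism is the map from [F] to [U] that multiplies a nonzero vector [u] by scalars: it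
    is nonzero at 1, hence split epi, and so [u] generates. Conversely, a nonzero value of [f] is a
    nonzero multiple of the generator, and dividing by the factor gives a section. *)
Lemma one_dim_line (U : lmodule F) :
  @one_dim (Mod F) U <-> exists u : U, gen_line u.
Proof.
have [R [iR]] := small_module (small_El _ : small (F^o : lmodType F)).
pose fR := iso_fwd iR; pose gR := iso_bwd iR.
have gRK : cancel gR fR by exact: iso_bwdK.
split.
  move=> [[f [g fg]] simple_U].
  have [u u0] : exists u : U, u <> 0.
    apply: contrapT => no; apply: fg; apply: hom_ext => v.
    have -> : v = 0 by apply: contrapT => v0; apply: no; exists v.
    by rewrite !linear0.
  exists u; split=> // v.
  have lm : linear (fun r : F^o => (r : F) *: u).
    by move=> a b c; rewrite scalerDl scalerA.
  have [h|[h hP]] := simple_U R (to_hom (mk_linear lm \o fR)).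
    have := hom_apP (h R (idm (R : obj (Mod F))) (to_hom (\0 : {linear R -> R}))) (gR 1).
    rewrite !ap_cmp ap_id !ap_to_hom /= linear0 scale0r gRK scale1r.
    by move/u0.
  have := hom_apP hP v; rewrite ap_cmp ap_id ap_to_hom /= => <-.
  by eexists.
move=> [u Uu]; split.
  exists (idm (U : obj (Mod F))), (to_hom (\0 : {linear U -> U})) => e.
  by case: Uu => u0 _; apply: u0; have := hom_apP e u; rewrite ap_id ap_to_hom.
move=> Z f; have [[z fz]|no] := pselect (exists z : Z, ap f z <> 0); last first.
  left=> W g h; apply: hom_ext => x; rewrite !ap_cmp.
  have f0 z : ap f z = 0 by apply: contrapT => fz; apply: no; exists z.
  by rewrite !f0.
right; have [a fa] := Uu.2 (ap f z).
have [b [ba _]] : exists b : F, b * a = 1 /\ a * b = 1.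
  by apply: skew_inv => a0; apply: fz; rewrite fa a0 scale0r.
exists (line_map Uu (b *: z)); apply: (line_ext Uu).
by rewrite ap_cmp line_mapE linearZ_LR /= fa scalerA ba scale1r.
Qed.

Variables (U : lmodule F) (u : U).
Hypothesis Uu : gen_line u.

Definition val_at (f : @hom (Mod F) U U) : F := gcoord Uu (ap f u).

Lemma val_atE f : ap f u = val_at f *: u.
Proof. by rewrite /val_at gcoordK. Qed.

Lemma val_at_inj f g : val_at f = val_at g -> f = g.
Proof. by move=> fg; apply: (line_ext Uu); rewrite !val_atE fg. Qed.

Lemma val_at_surj (a : F) : exists f, val_at f = a.
Proof.
exists (line_map Uu (a *: u)); apply: (gen_line_inj Uu).
by rewrite -val_atE line_mapE.
Qed.

(* The endomorphism ring of a line is the opposite of [F]. *)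
Lemma val_at_cmp (f g : @hom (Mod F) U U) :
  val_at (cmp (f : @hom (Mod F) U U) g) = val_at g * val_at f.
Proof.
apply: (gen_line_inj Uu).
by rewrite -val_atE ap_cmp (val_atE g) linearZ_LR /= val_atE scalerA.
Qed.

(** The projections are jointly monic, so [d] must be the sum of [i1] after [f2] and [i2] after
    [f3]; the codiagonal is the identity after each injection and so adds the two. *)
Lemma sum_ofP (f1 f2 f3 : @hom (Mod F) U U) :
  sum_of f1 f2 f3 <-> val_at f1 = val_at f2 + val_at f3.
Proof.
split.
  move=> [P [i1 [i2 [p1 [p2 [c [d [z [z0 [p11 [p22 [p12 [p21 [mono [c1 [c2 [e2 [e3 e1]]]]]]]]]]]]]]]]]].
  (* A map that absorbs every composition on the right vanishes: compose it with the zero map. *)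
  have zu : ap z u = 0.
    have := hom_apP (z0 (to_hom (\0 : {linear U -> U}))) u.
    by rewrite ap_cmp ap_to_hom /= linear0.
  have ap2 (X Y Z : lmodule F) (g g' : @hom (Mod F) Y Z) (f : @hom (Mod F) X Y)
    (h : @hom (Mod F) X Z) x : cmp g f = h -> ap g (ap f x) = ap h x.
    by move=> <-.
  have dE : d = line_map Uu (ap i1 (ap f2 u) + ap i2 (ap f3 u)).
    apply: mono; apply: (line_ext Uu); rewrite !ap_cmp line_mapE linearD /=.
      rewrite (ap2 _ _ _ p1 p1 i1 _ _ p11) (ap2 _ _ _ p1 p1 i2 _ _ p12) ap_id.
      by rewrite (val_atE f3) linearZ_LR /= zu scaler0 addr0 e2.
    rewrite (ap2 _ _ _ p2 p2 i1 _ _ p21) (ap2 _ _ _ p2 p2 i2 _ _ p22) ap_id.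
    by rewrite (val_atE f2) linearZ_LR /= zu scaler0 add0r e3.
  apply: (gen_line_inj Uu); rewrite scalerDl -!val_atE e1 ap_cmp {1}dE line_mapE linearD /=.
  by rewrite (ap2 _ _ _ c c i1 _ _ c1) (ap2 _ _ _ c c i2 _ _ c2) !ap_id.
move=> e.
have [P [iP]] := small_module (small_prod (small_El _) (small_El _) : small (U * U)%type).
pose fP := iso_fwd iP; pose gP := iso_bwd iP.
have gPK : cancel gP fP by exact: iso_bwdK.
have fPK : cancel fP gP by exact: iso_fwdK.
have l1 : linear (fun x : U => gP (x, 0)).
  move=> a x y; rewrite -linearP; congr (gP _).
  by rewrite [RHS]surjective_pairing [(_ + _).1]/= [(_ + _).2]/= scaler0 addr0.
have l2 : linear (fun x : U => gP (0, x)).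
  move=> a x y; rewrite -linearP; congr (gP _).
  by rewrite [RHS]surjective_pairing [(_ + _).1]/= [(_ + _).2]/= scaler0 addr0.
have l3 : linear (fun x : P => (fP x).1) by move=> a x y; rewrite linearP.
have l4 : linear (fun x : P => (fP x).2) by move=> a x y; rewrite linearP.
have l5 : linear (fun x : P => (fP x).1 + (fP x).2).
  by move=> a x y; rewrite linearP /= scalerDr addrACA.
exists P, (to_hom (mk_linear l1)), (to_hom (mk_linear l2)), (to_hom (mk_linear l3)),
  (to_hom (mk_linear l4)), (to_hom (mk_linear l5)),
  (line_map Uu (gP (ap f2 u, ap f3 u))), (to_hom (\0 : {linear U -> U})).
split; first by move=> a; apply: hom_ext.
split; first by apply: hom_ext => x; rewrite ap_cmp !ap_to_hom /= gPK.
split; first by apply: hom_ext => x; rewrite ap_cmp !ap_to_hom /= gPK.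
split; first by apply: hom_ext => x; rewrite ap_cmp !ap_to_hom /= gPK.
split; first by apply: hom_ext => x; rewrite ap_cmp !ap_to_hom /= gPK.
split.
  move=> v w /hom_apP vw1 /hom_apP vw2; apply: hom_ext => x; apply: (can_inj fPK).
  have := vw1 x; have := vw2 x; rewrite !ap_cmp !ap_to_hom /=.
  by case: (fP (ap v x)) (fP (ap w x)) => ? ? [? ?] /= -> ->.
split; first by apply: hom_ext => x; rewrite ap_cmp !ap_to_hom /= gPK addr0.
split; first by apply: hom_ext => x; rewrite ap_cmp !ap_to_hom /= gPK add0r.
split; first by apply: (line_ext Uu); rewrite ap_cmp line_mapE ap_to_hom /= gPK.
split; first by apply: (line_ext Uu); rewrite ap_cmp line_mapE ap_to_hom /= gPK.
apply: (line_ext Uu); rewrite ap_cmp line_mapE ap_to_hom /= gPK.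
by rewrite !val_atE -scalerDl e.
Qed.
End RingOps.

Lemma D_comp_sym (K : ctx) (X Y Z : ovar K) (h : mvar X Z) (f : mvar Y Z) (g : mvar X Y) :
  isM K h -> isM K f -> isM K g -> D K (fun F e => cmp (f F e) (g F e) = h F e).
Proof.
move=> ih iF ig; apply: D_iff (D_comp ih iF ig) => F e; split=> /esym; exact.
Qed.

Lemma D_sum_body (K : ctx) (U P : ovar K) (i1 i2 : mvar U P) (p1 p2 c : mvar P U)
    (d : mvar U P) (z f1 f2 f3 : mvar U U) :
  isO K U -> isO K P -> isM K i1 -> isM K i2 -> isM K p1 -> isM K p2 -> isM K c ->
  isM K d -> isM K z -> isM K f1 -> isM K f2 -> isM K f3 ->
  D K (fun F e =>
    (forall a : hom (U F e) (U F e), cmp (z F e) a = z F e) /\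
    cmp (p1 F e) (i1 F e) = idm (U F e) /\ cmp (p2 F e) (i2 F e) = idm (U F e) /\
    cmp (p1 F e) (i2 F e) = z F e /\ cmp (p2 F e) (i1 F e) = z F e /\
    (forall v w : hom (U F e) (P F e), cmp (p1 F e) v = cmp (p1 F e) w ->
       cmp (p2 F e) v = cmp (p2 F e) w -> v = w) /\
    cmp (c F e) (i1 F e) = idm (U F e) /\ cmp (c F e) (i2 F e) = idm (U F e) /\
    f2 F e = cmp (p1 F e) (d F e) /\ f3 F e = cmp (p2 F e) (d F e) /\
    f1 F e = cmp (c F e) (d F e)).
Proof.
move=> iU iP j1 j2 q1 q2 ic id iz if1 if2 if3.
apply: D_and; first by apply: D_allH => //; apply: D_comp_sym; var.
do 2 (apply: D_and; [by apply: D_comp_id|]).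
do 2 (apply: D_and; [by apply: D_comp_sym|]).
apply: D_and.
  apply: D_allH => //; apply: D_allH; [var | var |].
  by do 2 (apply: D_imp; [by apply: D_comp2; var|]); apply: D_eq; var.
do 2 (apply: D_and; [by apply: D_comp_id|]).
by do 2 (apply: D_and; [by apply: D_comp|]); apply: D_comp.
Qed.

Section RingDef.
Variable G : ctx.

Lemma D_one_dim (U : ovar G) : isO G U -> D G (fun F e => one_dim (U F e)).
Proof.
move=> iU; apply: D_and.
  apply: D_exH => //; apply: D_exH; [var | var |].
  by apply: D_not; apply: D_eq; var.
apply: D_allO; apply: D_allH; [var | var |]; apply: D_or.
  apply: D_allO; apply: D_allH; [var | var |]; apply: D_allH; [var | var |].
  by apply: D_comp2; var.
by apply: D_exH; [var | var |]; apply: D_comp_id; var.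
Qed.

Lemma D_sum_of (U : ovar G) (f1 f2 f3 : mvar U U) :
  isO G U -> isM G f1 -> isM G f2 -> isM G f3 ->
  D G (fun F e => sum_of (f1 F e) (f2 F e) (f3 F e)).
Proof.
move=> iU if1 if2 if3; apply: D_exO.
pose N := extO G.
pose tgt (n : nat) : ovar N := if n is 0 then fun F e => U F e.1 else fun F e => e.2.
pose l := [:: (0, 1); (0, 1); (1, 0); (1, 0); (1, 0); (0, 1); (0, 0)].
pose av (p : nat * nat) := (tgt p.1, tgt p.2).
pose Q F (e : cE N F) (h : homs (evO av e) l) :=
  let i1 := h.1 in let i2 := h.2.1 in let p1 := h.2.2.1 in let p2 := h.2.2.2.1 in
  let c := h.2.2.2.2.1 in let d := h.2.2.2.2.2.1 in let z := h.2.2.2.2.2.2.1 in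
    (forall a : hom (U F e.1) (U F e.1), cmp z a = z) /\
    cmp p1 i1 = idm (U F e.1) /\ cmp p2 i2 = idm (U F e.1) /\ cmp p1 i2 = z /\ cmp p2 i1 = z /\
    (forall v w : hom (U F e.1) e.2, cmp p1 v = cmp p1 w -> cmp p2 v = cmp p2 w -> v = w) /\
    cmp c i1 = idm (U F e.1) /\ cmp c i2 = idm (U F e.1) /\ f2 F e.1 = cmp p1 d /\
    f3 F e.1 = cmp p2 d /\ f1 F e.1 = cmp c d.
apply: (@D_iff _ (fun F e => exists h, Q F e h)).
  move=> F e; split=> [[[i1 [i2 [p1 [p2 [c [d [z []]]]]]]] q]|].
    by exists i1, i2, p1, p2, c, d, z.
  move=> [i1 [i2 [p1 [p2 [c [d [z q]]]]]]].
  by exists (i1, (i2, (p1, (p2, (c, (d, (z, tt))))))).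
have iO n : isO N (tgt n) by rewrite /tgt /N; case: n => [|n]; var.
apply: D_exHs; first by move=> a _; split; exact: iO.
have [i1 [i2 [p1 [p2 [ic [id [iz _]]]]]]] := isHs_here av l.
have iU' : isO (extHs av l) (fun F e => U F (projT1 e).1).
  exact: (isO_sub (sub_extHs _ _) (iO 0)).
have iP : isO (extHs av l) (fun F e => (projT1 e).2).
  exact: (isO_sub (sub_extHs _ _) (iO 1)).
have jf1 := isM_sub (sub_trans (sub_extHs av l) (sub_extO G)) if1.
have jf2 := isM_sub (sub_trans (sub_extHs av l) (sub_extO G)) if2.
have jf3 := isM_sub (sub_trans (sub_extHs av l) (sub_extO G)) if3.
exact: (@D_sum_body _ _ _ _ _ _ _ _ _ _ _ _ _ iU' iP i1 i2 p1 p2 ic id iz jf1 jf2 jf3).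
Qed.
End RingDef.

(** * Coding cardinals *)

Section Kcode.
Variables (F : skewfield) (U : lmodule F).

(** A coded set with a binary relation on its points, the candidate for a cardinal with its order;
    [is_card] selects the good ones. *)
Definition kcode := {z : scode U & pcode (fun _ : unit => sB z) U [:: tt; tt]}.

Definition kB (K : kcode) : obj (Mod F) := sB (projT1 K).
Definition kC (K : kcode) (b : @hom (Mod F) U (kB K)) : Prop := coded b.
Definition kW (K : kcode) (b c : @hom (Mod F) U (kB K)) : Prop :=
  prel (projT2 K) (b, (c, tt)).

Lemma kcode_rep (u : U) (k : Cn) : gen_line u ->
  exists (K : kcode) o, card_rep (@kC K) (@kW K) k o.
Proof.
move=> Uu; have [z [e [inj_e eP lift]]] := coding Uu (small_El k).
(* The default [k] is given outside the coded points only, where [card_rep] leaves [o] free. *)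
pose o (b : @hom (Mod F) U (sB z)) : V :=
  if pselect (exists x, b = e x) is left h then sval (projT1 (cid h)) else k.
have oE x : o (e x) = sval x.
  rewrite /o; case: pselect => [h|[]]; last by exists x.
  by case: (cid h) => y /= /inj_e <-.
have [p pP] := pcode_complete (tv := fun _ : unit => sB z) (l := [:: tt; tt]) Uu
  (fun bc => o bc.1 ∈ o bc.2.1).
exists (existT _ z p), o; split; first by move=> b /eP[x ->]; rewrite oE; exact: (svalP x).
split.
  move=> a ak; exists (e (exist _ a ak)); split; last by rewrite oE.
  by apply/eP; eexists.
split=> [b b' /eP[x ->] /eP[y ->]|b b' Cb Cb']; last exact: (pP (b, (b', tt))).
by rewrite !oE => xy; congr e; apply: sval_inj.
Qed.

Lemma Cn_inhabited : exists k : Cn, True.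
Proof. by have [k _] := small_card small_nat; exists k. Qed.

Definition k0 : Cn := projT1 (cid Cn_inhabited).

Definition is_card (K : kcode) : Prop := initial_wo (@kC K) (@kW K).

Definition card_of (K : kcode) : Cn :=
  if pselect (exists (k : Cn) o, card_rep (@kC K) (@kW K) k o) is left h
  then projT1 (cid h) else k0.

Definition ord_of (K : kcode) : @hom (Mod F) U (kB K) -> V :=
  if pselect (exists o, card_rep (@kC K) (@kW K) (card_of K) o) is left h
  then projT1 (cid h) else fun=> k0.

Lemma card_rep_uniq K (k k' : Cn) o o' :
  card_rep (@kC K) (@kW K) k o -> card_rep (@kC K) (@kW K) k' o' -> k = k'.
Proof.
move=> r r'; apply/(card_eq_bisim r r').
(* Both representations belong to one code, so the identity relation is a bisimulation. *)
exists (fun p => p.1 = p.2.1); split; last by split=> b Cb; exists b.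
move=> b c Cb Cc /= <-; split=> a Ca Wa; by exists a.
Qed.

Lemma card_ofP K (u : U) : gen_line u -> is_card K -> card_rep (@kC K) (@kW K) (card_of K) (@ord_of K).
Proof.
move=> Uu iK.
have h : exists (k : Cn) o, card_rep (@kC K) (@kW K) k o.
  by apply: initial_wo_rep iK; exact: small_line_hom Uu _.
have h' : exists o, card_rep (@kC K) (@kW K) (card_of K) o.
  by rewrite /card_of; case: pselect => // h'; case: cid.
by rewrite /ord_of; case: pselect => // h''; case: cid.
Qed.

Lemma card_of_rep K (k : Cn) o : card_rep (@kC K) (@kW K) k o -> card_of K = k.
Proof.
move=> r; rewrite /card_of; case: pselect => [h|[]]; last by exists k, o.
by case: cid => k' [o' r'] /=; exact: card_rep_uniq r' r.
Qed.
End Kcode.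

Definition isK (G : ctx) (U : ovar G) (K : forall F (e : cE G F), kcode (U F e)) : Prop :=
  isS (fun F e => projT1 (K F e)) /\
  @isP _ G U (fun _ F e => kB (K F e)) [:: tt; tt] (fun F e => projT2 (K F e)).

Lemma isK_sub G' G r (U : ovar G) K : sub G' G r -> @isK G U K ->
  @isK G' (fun F e => U F (r F e)) (fun F e => K F (r F e)).
Proof. by move=> s [iz ip]; split; [exact: (isS_sub s iz) | exact: (isP_sub s ip)]. Qed.

Lemma isK_B G (U : ovar G) K : @isK G U K -> isO G (fun F e => kB (K F e)).
Proof. by case=> iz _; exact: (isS_B iz). Qed.

Ltac mk_sub G' G ::=
  lazymatch G' with
  | G => constr:(sub_refl G)
  | extO ?H => let s := mk_sub H G in constr:(sub_trans (sub_extO H) s)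
  | @extH ?H ?X ?Y => let s := mk_sub H G in constr:(sub_trans (@sub_extH H X Y) s)
  | @pull ?H ?E ?r => let s := mk_sub H G in constr:(sub_trans (@sub_pull H E r) s)
  | @extHs ?A ?H ?av ?l => let s := mk_sub H G in constr:(sub_trans (@sub_extHs A H av l) s)
  | @extS ?H ?U => let s := mk_sub H G in constr:(sub_trans (@sub_extS H U) s)
  | @extP ?A ?H ?U ?tv ?l =>
    let s := mk_sub H G in constr:(sub_trans (@sub_extP A H U tv l) s)
  end.

Ltac var_here G' G ::=
  lazymatch G with
  | extO ?H =>
    first [lazymatch goal with |- isO _ _ =>
             let s := mk_sub G' G in exact (isO_sub s (isO_here H)) end | var_here G' H]
  | @extH ?H ?X ?Y =>
    first [lazymatch goal with |- @isM _ _ _ _ =>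
             let s := mk_sub G' G in exact (isM_sub s (@isM_here H X Y)) end | var_here G' H]
  | @pull ?H ?E ?r => var_here G' H
  | @extHs ?A ?H ?av ?l => var_here G' H
  | @extS ?H ?U =>
    first [lazymatch goal with |- @isS _ _ _ =>
             let s := mk_sub G' G in exact (isS_sub s (@isS_here H U)) end | var_here G' H]
  | @extP ?A ?H ?U ?tv ?l =>
    first [lazymatch goal with |- @isP _ _ _ _ _ _ =>
             let s := mk_sub G' G in exact (isP_sub s (@isP_here A H U tv l)) end |
           var_here G' H]
  end.

Ltac kvar :=
  match goal with
  | |- @isK ?G' _ _ => match goal with H : @isK ?G _ _ |- _ =>
      let s := mk_sub G' G in exact (isK_sub s H) end
  | |- isO ?G' _ => match goal with H : @isK ?G _ _ |- _ =>
      let s := mk_sub G' G in exact (isO_sub s (isK_B H)) end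
  | |- @isP _ ?G' _ _ _ _ => first [var_here G' G' | match goal with H : @isP _ ?G _ _ _ _ |- _ =>
      let s := mk_sub G' G in exact (isP_sub s H) end]
  | _ => var
  end.

Section KcodeDef.
Variables (G : ctx) (U : ovar G).

Lemma D_kC K (b : mvar U (fun F e => kB (K F e))) :
  isO G U -> isK K -> isM G b -> D G (fun F e => kC (b F e)).
Proof. by move=> iU [iz _] ib; exact: D_coded. Qed.

Lemma D_rel2 (A : eqType) (tv : A -> ovar G) a1 a2 (p : pvar U tv [:: a1; a2])
    (b : mvar U (tv a1)) (c : mvar U (tv a2)) :
  isO G U -> isP p -> isM G b -> isM G c ->
  D G (fun F e => prel (p F e) (b F e, (c F e, tt))).
Proof. by move=> iU ip ib ic; apply: (D_prel iU ip). Qed.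

Lemma D_rel1 (A : eqType) (tv : A -> ovar G) a1 (p : pvar U tv [:: a1])
    (b : mvar U (tv a1)) :
  isO G U -> isP p -> isM G b -> D G (fun F e => prel (p F e) (b F e, tt)).
Proof. by move=> iU ip ib; apply: (D_prel iU ip). Qed.

Lemma D_kW K (b c : mvar U (fun F e => kB (K F e))) :
  isO G U -> isK K -> isM G b -> isM G c -> D G (fun F e => kW (b F e) (c F e)).
Proof. by move=> iU [_ ip] ib ic; apply: D_rel2. Qed.
End KcodeDef.

Section IsCardDef.
Variables (G : ctx) (U : ovar G) (K : forall F (e : cE G F), kcode (U e)).
Hypotheses (iU : isO G U) (iK : isK K).
Hypothesis line : forall F (e : cE G F), exists u : (U e : lmodule F), gen_line u.

Lemma D_is_card : D G (fun F e => is_card (K e)).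
Proof.
have iB := isK_B iK.
rewrite /is_card /initial_wo.
apply: D_and.
  apply: D_allH => //; apply: D_imp; first by apply: D_kC; kvar.
  by apply: D_not; apply: D_kW; kvar.
apply: D_and.
  do 3 (apply: D_allH; [var | var |]).
  do 3 (apply: D_imp; [by apply: D_kC; kvar|]).
  do 2 (apply: D_imp; [by apply: D_kW; kvar|]).
  by apply: D_kW; kvar.
apply: D_and.
  apply: (@D_allP _ G U (fun _ : unit => fun F e => kB (K e)) [:: tt] (fun F e S => 
   (exists b, kC b /\ S (b, tt)) ->
     exists m, kC m /\ S (m, tt) /\ forall b, kC b -> S (b, tt) -> b = m \/ kW m b)) => //.
  apply: D_imp.
    apply: D_exH; [var | var |].
    apply: D_and; first by apply: D_kC; kvar.
    by apply: D_rel1; kvar.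
  apply: D_exH; [var | var |].
  apply: D_and; first by apply: D_kC; kvar.
  apply: D_and; first by apply: D_rel1; kvar.
  apply: D_allH; [var | var |].
  apply: D_imp; first by apply: D_kC; kvar.
  apply: D_imp; first by apply: D_rel1; kvar.
  by apply: D_or; [apply: D_eq | apply: D_kW]; kvar.
apply: D_allH => //; apply: D_imp; first by apply: D_kC; kvar.
pose G1 := extH U (fun F e => kB (K e)).
apply: (@D_allP _ G1 (fun F e => U (projT1 e)) (fun _ : unit => fun F e => kB (K (projT1 e)))
  [:: tt; tt] (fun F e S => ~ matches (@kC _ _ (K (projT1 e))) (@kW _ _ (K (projT1 e)))
    (projT2 e) S)).
- by rewrite /G1; var.
- by move=> a _; rewrite /G1; var.
- by move=> F e; exact: line.
rewrite /G1; apply: D_not; apply: D_and.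
  apply: D_allH; [var | var |].
  apply: D_imp; first by apply: D_kC; kvar.
  apply: D_imp; first by apply: D_kW; kvar.
  apply: D_exH; [var | var |].
  apply: D_and; first by apply: D_kC; kvar.
  apply: D_and; first by apply: D_rel2; kvar.
  apply: D_allH; [var | var |].
  apply: D_imp; first by apply: D_kC; kvar.
  by apply: D_imp; [apply: D_rel2 | apply: D_eq]; kvar.
apply: D_allH; [var | var |].
apply: D_imp; first by apply: D_kC; kvar.
apply: D_exH; [var | var |].
apply: D_and; first by apply: D_kC; kvar.
apply: D_and; first by apply: D_kW; kvar.
apply: D_and; first by apply: D_rel2; kvar.
apply: D_allH; [var | var |].
apply: D_imp; first by apply: D_kC; kvar.
apply: D_imp; first by apply: D_kW; kvar.
by apply: D_imp; [apply: D_rel2 | apply: D_eq]; kvar.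
Qed.
End IsCardDef.

Section BisimDef.
Variables (G : ctx) (U : ovar G) (K1 K2 : forall F (e : cE G F), kcode (U e)).
Hypotheses (iU : isO G U) (iK1 : isK K1) (iK2 : isK K2).
Hypothesis line : forall F (e : cE G F), exists u : (U e : lmodule F), gen_line u.

Let tv (b : bool) : ovar G := fun F e => if b then kB (K1 e) else kB (K2 e).

Lemma D_bisim (p : pvar U tv [:: true; false]) : isP p ->
  D G (fun F e => bisimulation (@kC _ _ (K1 e)) (@kW _ _ (K1 e)) (@kC _ _ (K2 e))
    (@kW _ _ (K2 e)) (prel (p F e))).
Proof.
move=> ip; have iB1 := isK_B iK1; have iB2 := isK_B iK2.
do 2 (apply: D_allH; [var | var |]).
do 2 (apply: D_imp; [by apply: D_kC; kvar|]).
apply: D_imp; first by apply: D_rel2; kvar.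
apply: D_and.
  apply: D_allH; [var | var |].
  apply: D_imp; first by apply: D_kC; kvar.
  apply: D_imp; first by apply: D_kW; kvar.
  apply: D_exH; [var | var |].
  apply: D_and; first by apply: D_kC; kvar.
  by apply: D_and; [apply: D_kW | apply: D_rel2]; kvar.
apply: D_allH; [var | var |].
apply: D_imp; first by apply: D_kC; kvar.
apply: D_imp; first by apply: D_kW; kvar.
apply: D_exH; [var | var |].
apply: D_and; first by apply: D_kC; kvar.
by apply: D_and; [apply: D_kW | apply: D_rel2]; kvar.
Qed.
End BisimDef.


Section EqDef.
Variables (G : ctx) (U : ovar G) (K1 K2 : forall F (e : cE G F), kcode (U e)).
Hypotheses (iU : isO G U) (iK1 : isK K1) (iK2 : isK K2).
Hypothesis line : forall F (e : cE G F), exists u : (U e : lmodule F), gen_line u.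

Let tv (b : bool) : ovar G := fun F e => if b then kB (K1 e) else kB (K2 e).

Lemma isO_tv (l : seq bool) : {in l, forall b, isO G (tv b)}.
Proof. by move=> [] _; [exact: isK_B iK1 | exact: isK_B iK2]. Qed.

Lemma D_card_eq (k1 k2 : forall F (e : cE G F), Cn) :
  (forall F e, exists o, card_rep (@kC _ _ (K1 e)) (@kW _ _ (K1 e)) (k1 F e) o) ->
  (forall F e, exists o, card_rep (@kC _ _ (K2 e)) (@kW _ _ (K2 e)) (k2 F e) o) ->
  D G (fun F e => k1 F e = k2 F e).
Proof.
move=> r1 r2.
pose Q F (e : cE G F) (R : homs (fan (tgt_at tv e) (U e)) [:: true; false] -> Prop) :=
  bisimulation (@kC _ _ (K1 e)) (@kW _ _ (K1 e)) (@kC _ _ (K2 e)) (@kW _ _ (K2 e)) R /\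
  (forall b1 : hom (U e) (kB (K1 e)), kC b1 ->
     exists b2 : hom (U e) (kB (K2 e)), kC b2 /\ R (b1, (b2, tt))) /\
  (forall b2 : hom (U e) (kB (K2 e)), kC b2 ->
     exists b1 : hom (U e) (kB (K1 e)), kC b1 /\ R (b1, (b2, tt))).
apply: (@D_iff _ (fun F e => exists R, Q F e R)).
  move=> F e; have [o1 h1] := r1 F e; have [o2 h2] := r2 F e.
  by split=> /(card_eq_bisim h1 h2).
apply: D_exP => //; first exact: isO_tv.
apply: D_and.
  exact: (@D_bisim (extP U tv _) (fun F e => U (projT1 e)) (fun F e => K1 (projT1 e))
    (fun F e => K2 (projT1 e)) (isO_sub (sub_extP _ _ _) iU) (isK_sub (sub_extP _ _ _) iK1)
    (isK_sub (sub_extP _ _ _) iK2) (fun F e => projT2 e) (isP_here _ _ _)).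
apply: D_and.
  apply: D_allH; [kvar | kvar |]; apply: D_imp; first by apply: D_kC; kvar.
  apply: D_exH; [kvar | kvar |].
  by apply: D_and; [apply: D_kC | apply: D_rel2]; kvar.
apply: D_allH; [kvar | kvar |]; apply: D_imp; first by apply: D_kC; kvar.
apply: D_exH; [kvar | kvar |].
by apply: D_and; [apply: D_kC | apply: D_rel2]; kvar.
Qed.

Lemma D_elt_eq (o1 : forall F (e : cE G F), hom (U e) (kB (K1 e)) -> V)
    (o2 : forall F (e : cE G F), hom (U e) (kB (K2 e)) -> V)
    (b1 : mvar U (fun F e => kB (K1 e))) (b2 : mvar U (fun F e => kB (K2 e))) :
  (forall F e, exists k : Cn, card_rep (@kC _ _ (K1 e)) (@kW _ _ (K1 e)) k (o1 F e)) ->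
  (forall F e, exists k : Cn, card_rep (@kC _ _ (K2 e)) (@kW _ _ (K2 e)) k (o2 F e)) ->
  isM G b1 -> isM G b2 -> (forall F e, kC (b1 F e)) -> (forall F e, kC (b2 F e)) ->
  D G (fun F e => o1 F e (b1 F e) = o2 F e (b2 F e)).
Proof.
move=> r1 r2 ib1 ib2 c1 c2.
pose Q F (e : cE G F) (R : homs (fan (tgt_at tv e) (U e)) [:: true; false] -> Prop) :=
  bisimulation (@kC _ _ (K1 e)) (@kW _ _ (K1 e)) (@kC _ _ (K2 e)) (@kW _ _ (K2 e)) R /\
  R (b1 F e, (b2 F e, tt)).
apply: (@D_iff _ (fun F e => exists R, Q F e R)).
  move=> F e; have [k1 h1] := r1 F e; have [k2 h2] := r2 F e.
  by split=> /(elt_eq_bisim h1 h2 (c1 F e) (c2 F e)).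
apply: D_exP => //; first exact: isO_tv.
apply: D_and.
  exact: (@D_bisim (extP U tv _) (fun F e => U (projT1 e)) (fun F e => K1 (projT1 e))
    (fun F e => K2 (projT1 e)) (isO_sub (sub_extP _ _ _) iU) (isK_sub (sub_extP _ _ _) iK1)
    (isK_sub (sub_extP _ _ _) iK2) (fun F e => projT2 e) (isP_here _ _ _)).
by apply: D_rel2; kvar.
Qed.
End EqDef.

(** Some data exist only under a condition, such as a generator once an object is known to be a
    line. The guard puts the condition into the situations, so that [Q] has to be defined only where
    it holds. *)
Lemma D_guard G (P Q : forall F, cE G F -> Prop) :
  D G P ->
  D (@pull G (fun F => {e : cE G F | P F e}) (fun F e => sval e)) (fun F e => Q F (sval e)) ->
  D G (fun F e => P F e /\ Q F e).
Proof.
move=> [p pP] [q qQ]; exists (CAnd p q) => F e eo em ho hm /=.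
rewrite (pP F e eo em ho hm); split=> -[Pe] q'; split=> //.
  by apply/(qQ F (exist _ e Pe) eo em ho hm).
by apply/(qQ F (exist _ e Pe) eo em ho hm).
Qed.

Section Quantifiers.
Variables (G : ctx) (U : ovar G).
Hypothesis iU : isO G U.
Variable u : forall F (e : cE G F), (U e : lmodule F).
Hypothesis Uu : forall F (e : cE G F), gen_line (u e).

Definition ext_ring : ctx := extH U U.

Lemma D_ex_ring (Q : forall F (e : cE G F), F -> Prop) :
  D ext_ring (fun F e => Q F (projT1 e) (val_at (Uu (projT1 e)) (projT2 e))) ->
  D G (fun F e => exists x, Q F e x).
Proof.
move=> DQ; apply: (@D_iff _ (fun F e => exists f : hom (U e) (U e), Q F e (val_at (Uu e) f))).
  move=> F e; split=> [[f q]|[x q]]; first by eexists; exact: q.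
  by have [f fx] := val_at_surj (Uu e) x; exists f; rewrite fx.
exact: D_exH.
Qed.

Section Elt.
Variable K : forall F (e : cE G F), kcode (U e).
Hypothesis iK : isK K.

Definition ext_elt : ctx :=
  @pull (extH U (fun F e => kB (K e)))
    (fun F => {e : cE (extH U (fun F e => kB (K e))) F | kC (projT2 e)}) (fun F e => sval e).

Lemma D_ex_elt (k : forall F (e : cE G F), Cn)
    (o : forall F (e : cE G F), hom (U e) (kB (K e)) -> V)
    (Q : forall F (e : cE G F), V -> Prop) :
  (forall F e, card_rep (@kC _ _ (K e)) (@kW _ _ (K e)) (k F e) (o F e)) ->
  D ext_elt (fun F e => Q F (projT1 (sval e)) (o F (projT1 (sval e)) (projT2 (sval e)))) ->
  D G (fun F e => exists2 x, x ∈ k F e & Q F e x).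
Proof.
move=> r DQ; apply: (@D_iff _ (fun F e => exists b : hom (U e) (kB (K e)), kC b /\ Q F e (o F e b))).
  move=> F e; have [ok [ko _]] := r F e.
  split=> [[b [Cb q]]|[x /ko[b [Cb <-]] q]]; last by exists b.
  by exists (o F e b) => //; exact: ok.
have iB := isK_B iK; apply: D_exH => //.
apply: (@D_guard (extH U (fun F e => kB (K e))) (fun F e => kC (projT2 e))
  (fun F e => Q F (projT1 e) (o F (projT1 e) (projT2 e)))).
  by apply: D_kC; kvar.
exact: DQ.
Qed.
End Elt.

Let NS := extS U.
Let NP := @extP unit NS (fun F e => U (projT1 e)) (fun _ F e => sB (projT2 e)) [:: tt; tt].
Let NK := @pull NP (fun F => {e : cE G F & kcode (U e)}) (fun F e =>
  existT (fun e : cE NS F => pcode (tgt_at (fun _ : unit => (fun F (e : cE NS F) => sB (projT2 e))) e)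
            (U (projT1 e)) [:: tt; tt])
    (existT (fun e => scode (U e)) (projT1 e) (projT1 (projT2 e))) (projT2 (projT2 e))).

Definition ext_card : ctx :=
  @pull NK (fun F => {e : cE NK F | is_card (projT2 e)}) (fun F e => sval e).

Lemma sub_NK : sub NK G (fun F e => projT1 e).
Proof.
exact: (sub_trans (@sub_pull NP _ _) (sub_trans (@sub_extP unit NS _ _ _) (sub_extS U))).
Qed.

Lemma isK_NK : @isK NK (fun F e => U (projT1 e)) (fun F e => projT2 e).
Proof.
split; last exact: (isP_sub (@sub_pull NP _ _) (@isP_here unit NS _ _ _)).
exact: (isS_sub (sub_trans (@sub_pull NP _ _) (@sub_extP unit NS _ _ _)) (isS_here U)).
Qed.

(** Many codes represent one cardinal, but [Q] sees a code only through [card_of], and [kcode_rep]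
    ensures that every cardinal is reached. *)
Lemma D_ex_card (Q : forall F (e : cE G F), Cn -> Prop) :
  D ext_card (fun F e => Q F (projT1 (sval e)) (card_of (projT2 (sval e)))) ->
  D G (fun F e => exists k, Q F e k).
Proof.
move=> DQ.
apply: (@D_iff _ (fun F e => exists K : kcode (U e), is_card K /\ Q F e (card_of K))).
  move=> F e; split=> [[K [_ q]]|[k q]]; first by exists (card_of K).
  have [K [o r]] := kcode_rep k (Uu e); exists K; split; first exact: rep_initial_wo r.
  by rewrite (card_of_rep r).
have DK : D NK (fun F e => is_card (projT2 e) /\ Q F (projT1 e) (card_of (projT2 e))).
  apply: (@D_guard NK (fun F e => is_card (projT2 e))) DQ.
  apply: (@D_is_card NK (fun F e => U (projT1 e)) (fun F e => projT2 e)).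
  - exact: (isO_sub sub_NK iU).
  - exact: isK_NK.
  - by move=> F e; exists (u (projT1 e)).
apply: (@D_iff _ (fun F e => exists (z : scode (U e)) (p : pcode (fun _ : unit => sB z) (U e) [:: tt; tt]),
   let K : kcode (U e) := existT _ z p in is_card K /\ Q F e (card_of K))).
  by move=> F e; split=> [[z [p q]]|[[z p] q]]; [eexists; exact: q | exists z, p].
apply: D_exS => //.
pose Q' F (e : cE NS F) p := let K : kcode (U (projT1 e)) := existT _ (projT2 e) p in
  is_card K /\ Q F (projT1 e) (card_of K).
apply: (@D_exPcode unit NS (fun F e => U (projT1 e)) (fun _ F e => sB (projT2 e)) [:: tt; tt] Q').
- exact: (isO_sub (sub_extS U) iU).
- by move=> a _; exact: (isS_B (isS_here U)).
pose r F (e : cE NP F) : cE NK F :=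
  existT (fun e => kcode (U e)) (projT1 (projT1 e)) (existT _ (projT2 (projT1 e)) (projT2 e)).
apply: (D_sub (r := r) _ DK).
by split=> // F e i _; case: e => [[]].
Qed.

End Quantifiers.

(** * Defining satisfaction of L2 formulas in the category *)

(* A predicate of type (js, n) becomes a relation on tuples of morphisms from the
   line to the codes of the cardinals [js] and, [n] times, to the line itself. *)
Definition args_type (js : seq nat) (n : nat) : seq (option nat) :=
  map some js ++ nseq n None.

Section Denotation.
Variables (F : skewfield) (U : lmodule F) (u : U).
Hypothesis Uu : gen_line u.
Variable K : nat -> kcode U.

Definition atgt (a : option nat) : obj (Mod F) := if a is Some k then kB (K k) else U.

Fixpoint den_ok l : homs (fan atgt U) l -> Prop :=
  match l with
  | [::] => fun _ => True
  | Some k :: l' => fun h => kC (K := K k) h.1 /\ den_ok h.2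
  | None :: l' => fun h => den_ok h.2
  end.

Fixpoint den_cs l : homs (fan atgt U) l -> seq V :=
  match l with
  | [::] => fun _ => [::]
  | Some k :: l' => fun h => ord_of (K := K k) h.1 :: den_cs h.2
  | None :: l' => fun h => den_cs h.2
  end.

Fixpoint den_vs l : homs (fan atgt U) l -> seq F :=
  match l with
  | [::] => fun _ => [::]
  | Some k :: l' => fun h => den_vs h.2
  | None :: l' => fun h => val_at Uu h.1 :: den_vs h.2
  end.

(** Only tuples whose components at cardinal places are coded points denote; whatever [S] says about
    other tuples is discarded. *)
Definition den_rel l (S : homs (fan atgt U) l -> Prop) : classical_sets.set (seq V * seq F) :=
  fun c => exists h, den_ok h /\ c = (den_cs h, den_vs h) /\ S h.

Variable kk : nat -> Cn.
Definition rep_on (js : seq nat) : Prop := forall k, k \in js ->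
  card_rep (@kC _ _ (K k)) (@kW _ _ (K k)) (kk k) (@ord_of _ _ (K k)).

Lemma den_inj js n (h h' : homs (fan atgt U) (args_type js n)) : rep_on js ->
  den_ok h -> den_ok h' -> den_cs h = den_cs h' -> den_vs h = den_vs h' -> h = h'.
Proof.
elim: js h h' => [|k js IH] h h' rep.
  elim: n h h' => [|n IH] /=; first by move=> [] [].
  move=> [f h] [f' h'] /= ok ok' cs [] /val_at_inj -> vs.
  by congr pair; apply: IH.
case: h h' => f h [f' h'] /= [cf ok] [cf' ok'] [ff' cs] vs.
have [_ [_ [inj _]]] := rep k (mem_head _ _).
rewrite (inj _ _ cf cf' ff'); congr pair; apply: IH => // j jj.
by apply: rep; rewrite inE jj orbT.
Qed.

Lemma den_dom js n (h : homs (fan atgt U) (args_type js n)) : rep_on js ->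
  den_ok h -> rel_dom (map kk js) n (den_cs h, den_vs h).
Proof.
rewrite /rel_dom /=; elim: js h => [|k js IH] h rep.
  elim: n h => [|n IH] //= [f h] /= /IH[c s]; split=> //.
  by rewrite s.
case: h => f h /= [cf ok].
have [ok' _] := rep k (mem_head _ _).
have [|c s] := IH h _ ok; last by do !split=> //; exact: ok'.
by move=> j jj; apply: rep; rewrite inE jj orbT.
Qed.

Lemma den_ex js n (c : seq V * seq F) : rep_on js -> rel_dom (map kk js) n c ->
  exists h : homs (fan atgt U) (args_type js n), den_ok h /\ c = (den_cs h, den_vs h).
Proof.
case: c => cs vs; rewrite /rel_dom /=; elim: js cs => [|k js IH] cs rep [cP sP].
  case: cs cP => // _; elim: n vs sP => [|n IH] vs sP.
    by case: vs sP => // _; exists tt.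
  case: vs sP => // v vs [/IH[h [ok [e1 e2]]]]; have [f fv] := val_at_surj Uu v.
  by exists (f, h); split=> //=; rewrite -e1 -e2 fv.
case: cs cP => // a cs /= [ak cP].
have [|h [ok [e1 e2]]] := IH cs _ (conj cP sP).
  by move=> j jj; apply: rep; rewrite inE jj orbT.
have [_ [ko _]] := rep k (mem_head _ _); have [b [Cb ba]] := ko a ak.
by exists (b, h); split=> //=; rewrite -e1 -e2 ba.
Qed.

Lemma den_relE js n (S : homs (fan atgt U) (args_type js n) -> Prop) h : rep_on js ->
  den_ok h -> (den_rel S (den_cs h, den_vs h) <-> S h).
Proof.
move=> rep ok; split=> [[h' [ok' [[e1 e2] S']]]|Sh]; last by exists h.
by rewrite (den_inj rep ok ok' e1 e2).
Qed.

Lemma den_rel_sub js n (S : homs (fan atgt U) (args_type js n) -> Prop) : rep_on js ->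
  (den_rel S `<=` rel_dom (map kk js) n)%classic.
Proof. by move=> rep c [h [ok [-> _]]]; exact: den_dom. Qed.

Lemma den_rel_surj js n (Q : classical_sets.set (seq V * seq F)) : rep_on js ->
  (Q `<=` rel_dom (map kk js) n)%classic ->
  exists S : homs (fan atgt U) (args_type js n) -> Prop, Q = den_rel S.
Proof.
move=> rep Qd; exists (fun h => Q (den_cs h, den_vs h)).
apply/seteqP; split=> c.
  by move=> Qc; have [h [ok e]] := den_ex rep (Qd _ Qc); exists h; rewrite -e.
by move=> [h [_ [->]]].
Qed.
End Denotation.


(* The data of the variables of an L2 formula over the situations of [G]: the line
   standing for the ring, their values, and the codes of the cardinals. *)
Record env (G : ctx) := Env {
  vU : ovar G;
  vu : forall F (e : cE G F), (vU e : lmodule F);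
  vUu : forall F (e : cE G F), gen_line (vu e);
  vr : forall F (e : cE G F), nat -> F;
  vk : forall F (e : cE G F), nat -> Cn;
  ve : forall F (e : cE G F), nat -> V;
  vp : forall F (e : cE G F), nat -> classical_sets.set (seq V * seq F);
  vc : nat -> forall F (e : cE G F), kcode (vU e)
}.
Arguments vU {G} v F e : rename.
Arguments vu {G} v F e : rename.
Arguments vUu {G} v F e : rename.
Arguments vr {G} v F e : rename.
Arguments vk {G} v F e : rename.
Arguments ve {G} v F e : rename.
Arguments vp {G} v F e : rename.
Arguments vc {G} v k F e : rename.

Section Ok.
Variables (G : ctx) (v : env G).

Definition holds_in (p : L2_formula) : Prop :=
  D G (fun F e => L2_sat (vr v F e) (vk v F e) (ve v F e) (vp v F e) p).

Definition ringOK (r : nat) : Prop :=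
  exists f : mvar (vU v) (vU v), isM G f /\
    forall F e, val_at (vUu v F e) (f F e) = vr v F e r.

Definition kvar_t := forall F (e : cE G F), kcode (vU v F e).

Definition cardOK (K : kvar_t) (k : nat) : Prop :=
  isK K /\ forall F e, card_rep (@kC _ _ (K F e)) (@kW _ _ (K F e)) (vk v F e k)
    (@ord_of _ _ (K F e)).

Definition eltOK (K : kvar_t) (a : nat) : Prop :=
  exists b : mvar (vU v) (fun F e => kB (K F e)), isM G b /\
    forall F e, kC (b F e) /\ ord_of (b F e) = ve v F e a.

Definition ptgt (kap : nat -> kvar_t) (a : option nat) : ovar G :=
  fun F e => atgt (fun k => kap k F e) a.

(** The type of [p] depends on the codes of the cardinals. Keeping them in [kap], which agrees with
    [vc v] on [js] only, lets [set_k] change [vc v] at a fresh name without transporting [p]. *)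
Definition predOK (P : nat) (js : seq nat) (n : nat) : Prop :=
  exists kap : nat -> kvar_t, {in js, forall k, kap k = vc v k} /\
    exists p : pvar (vU v) (ptgt kap) (args_type js n), isP p /\
      forall F e h, den_ok h ->
        (vp v F e P (den_cs h, den_vs (vUu v F e) h) <-> prel (p F e) h).

Definition env_ok (rs ks : seq nat) (es : seq (nat * nat))
    (ps : seq (nat * (seq nat * nat))) : Prop :=
  [/\ isO G (vU v), forall r, r \in rs -> ringOK r,
      forall k, k \in ks -> cardOK (vc v k) k,
      forall a k, (a, k) \in es -> k \in ks /\ eltOK (vc v k) a
    & forall P js n, (P, (js, n)) \in ps -> {subset js <= ks} /\ predOK P js n].

Lemma args_exist (kap : nat -> kvar_t) (rs : seq nat) (es : seq (nat * nat))
    (cs js vs : seq nat) n :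
  (forall r, r \in rs -> ringOK r) ->
  (forall a k, (a, k) \in es -> eltOK (vc v k) a) ->
  {in js, forall k, kap k = vc v k} ->
  all2 (fun a k => (a, k) \in es) cs js -> {subset vs <= rs} -> size vs = n ->
  exists h : avar (vU v) (ptgt kap) (args_type js n), isA h /\ forall F e,
    den_ok (h F e) /\ den_cs (h F e) = map (ve v F e) cs /\
    den_vs (vUu v F e) (h F e) = map (vr v F e) vs.
Proof.
move=> okr oke; elim: js cs => [|k js IH] [|a cs] //= kapE.
  move=> _ vrs <-; elim: vs vrs => [|r vs IH] vrs.
    by exists (fun F e => tt).
  have [h [ih hP]] : exists h : avar (vU v) (ptgt kap) (args_type [::] (size vs)), isA h /\
      forall F e, den_ok (h F e) /\ den_cs (h F e) = [::] /\
      den_vs (vUu v F e) (h F e) = map (vr v F e) vs.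
    by apply: IH => x xv; apply: vrs; rewrite inE xv orbT.
  have [f [jf fP]] := okr r (vrs _ (mem_head _ _)).
  exists (fun F e => (f F e, h F e)); split; first by split.
  by move=> F e /=; have [ok [-> ->]] := hP F e; rewrite fP.
move=> /andP[ak csjs] vrs sn.
have [|h [ih hP]] := IH cs _ csjs vrs sn.
  by move=> j jj; apply: kapE; rewrite inE jj orbT.
have := oke _ _ ak; rewrite -(kapE k (mem_head _ _)) => -[b [jb bP]].
exists (fun F e => (b F e, h F e)); split; first by split.
move=> F e /=; have [ok [-> ->]] := hP F e; have [Cb <-] := bP F e.
by split; [split|].
Qed.

End Ok.

Definition env_sub G' G (r : forall F, cE G' F -> cE G F) (v : env G) : env G' := {|
  vU := fun F e => vU v F (r F e);
  vu := fun F e => vu v F (r F e);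
  vUu := fun F e => vUu v F (r F e);
  vr := fun F e => vr v F (r F e);
  vk := fun F e => vk v F (r F e);
  ve := fun F e => ve v F (r F e);
  vp := fun F e => vp v F (r F e);
  vc := fun k F e => vc v k F (r F e) |}.

Lemma env_ok_sub G' G r (v : env G) rs ks es ps : sub G' G r ->
  env_ok v rs ks es ps -> env_ok (env_sub r v) rs ks es ps.
Proof.
move=> s [iU okr okk oke okp]; split.
- exact: (isO_sub s iU).
- move=> x /okr[f [jf fP]]; exists (fun F e => f F (r F e)); split; first exact: (isM_sub s jf).
  by move=> F e; exact: fP.
- move=> k /okk[iK kP]; split; first exact: (isK_sub s iK).
  by move=> F e; exact: kP.
- move=> a k /oke[kks [b [jb bP]]]; split=> //; exists (fun F e => b F (r F e)).
  by split; [exact: (isM_sub s jb) | move=> F e; exact: bP].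
move=> P js n /okp[jks [kap [kapE [p [ip pP]]]]]; split=> //.
exists (fun k F e => kap k F (r F e)); split; first by move=> k /kapE->.
exists (fun F e => p F (r F e)); split; first exact: (isP_sub s ip).
by move=> F e; exact: pP.
Qed.

Definition set_r G (v : env G) (r : nat) (x : forall F, cE G F -> F) : env G := {|
  vU := vU v; vu := vu v; vUu := vUu v;
  vr := fun F e => [eta vr v F e with r |-> x F e];
  vk := vk v; ve := ve v; vp := vp v; vc := vc v |}.
Definition set_e G (v : env G) (a : nat) (x : forall F, cE G F -> V) : env G := {|
  vU := vU v; vu := vu v; vUu := vUu v;
  vr := vr v; vk := vk v;
  ve := fun F e => [eta ve v F e with a |-> x F e]; vp := vp v; vc := vc v |}.
Definition set_p G (v : env G) (P : nat)
   (x : forall F, cE G F -> classical_sets.set (seq V * seq F)) : env G := {|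
  vU := vU v; vu := vu v; vUu := vUu v;
  vr := vr v; vk := vk v; ve := ve v;
  vp := fun F e => [eta vp v F e with P |-> x F e]; vc := vc v |}.
Definition set_k G (v : env G) (k : nat) (x : forall F, cE G F -> Cn) (K : kvar_t v) : env G := {|
  vU := vU v; vu := vu v; vUu := vUu v;
  vr := vr v; vk := fun F e => [eta vk v F e with k |-> x F e];
  ve := ve v; vp := vp v; vc := fun j => if j == k then K else vc v j |}.

Section Update.
Variables (G : ctx) (v : env G) (rs ks : seq nat) (es : seq (nat * nat)).
Variable ps : seq (nat * (seq nat * nat)).
Hypothesis ok : env_ok v rs ks es ps.

Lemma set_r_ok r (f : mvar (vU v) (vU v)) : r \notin rs -> isM G f ->
  env_ok (set_r v r (fun F e => val_at (vUu v F e) (f F e))) (r :: rs) ks es ps.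
Proof.
case: ok => iU okr okk oke okp nr jf; split=> // s.
rewrite inE => /predU1P[->|srs]; first by exists f; split=> // F e; rewrite /= eqxx.
have [g [jg gP]] := okr s srs; exists g; split=> // F e; rewrite gP /=.
by case: eqP => // sr; rewrite -sr srs in nr.
Qed.

Lemma set_e_ok a k (b : mvar (vU v) (fun F e => kB (vc v k F e))) :
  a \notin unzip1 es -> k \in ks -> isM G b -> (forall F e, kC (b F e)) ->
  env_ok (set_e v a (fun F e => ord_of (b F e))) rs ks ((a, k) :: es) ps.
Proof.
case: ok => iU okr okk oke okp na kks jb Cb; split=> // a' k'.
rewrite inE => /predU1P[[-> ->]|ake].
  by split=> //; exists b; split=> // F e; rewrite /= eqxx.
have [kks' [c [jc cP]]] := oke a' k' ake; split=> //; exists c; split=> // F e.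
have [Cc ->] := cP F e; split=> //=; case: eqP => // aa.
by case/negP: na; apply/mapP; exists (a', k').
Qed.

Lemma set_k_ok k (K : kvar_t v) (x : forall F, cE G F -> Cn) : k \notin ks -> isK K ->
  (forall F e, card_rep (@kC _ _ (K F e)) (@kW _ _ (K F e)) (x F e) (@ord_of _ _ (K F e))) ->
  env_ok (set_k k x K) rs (k :: ks) es ps.
Proof.
case: ok => iU okr okk oke okp nk iK KP; split=> //.
- move=> j; rewrite inE => /predU1P[->|jks]; rewrite /cardOK /=.
    by rewrite eqxx; split=> // F e; exact: KP.
  have jk : (j == k) = false by apply/eqP => jk; rewrite -jk jks in nk.
  by rewrite jk; exact: okk.
- move=> a j /oke[jks b]; split; first by rewrite inE jks orbT.
  have jk : (j == k) = false by apply/eqP => jk; rewrite -jk jks in nk.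
  by rewrite /= jk.
move=> P js n /okp[jks [kap [kapE pP]]]; split; first by move=> j /jks; rewrite inE orbC => ->.
exists kap; split=> // j jj /=; rewrite kapE //; case: eqP => // jk.
by rewrite -jk jks in nk.
Qed.

Lemma set_p_ok P js n (p : pvar (vU v) (ptgt (vc v)) (args_type js n)) :
  P \notin unzip1 ps -> {subset js <= ks} -> isP p ->
  env_ok (set_p v P (fun F e => den_rel (vUu v F e) (prel (p F e)))) rs ks es
    ((P, (js, n)) :: ps).
Proof.
case: ok => iU okr okk oke okp nP jks ip; split=> // P' js' n'.
rewrite inE => /predU1P[[-> -> ->]|pP].
  split=> //; exists (vc v); split=> //; exists p; split=> // F e h hok /=; rewrite eqxx.
  have rep : rep_on (fun k => vc v k F e) (vk v F e) js.
    by move=> k kjs; have [_ KP] := okk k (jks k kjs); exact: KP.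
  exact: (den_relE (vUu v F e) _ rep hok).
have [jks' [kap [kapE [q [iq qP]]]]] := okp P' js' n' pP; split=> //.
exists kap; split=> //; exists q; split=> // F e h hok; rewrite -qP //=.
by case: eqP => // PP; case/negP: nP; apply/mapP; exists (P', (js', n')).
Qed.

End Update.


Section PredQuantifier.
Variables (G : ctx) (v : env G) (rs ks : seq nat) (es : seq (nat * nat)).
Variable ps : seq (nat * (seq nat * nat)).
Hypothesis ok : env_ok v rs ks es ps.
Variables (js : seq nat) (n : nat).
Hypothesis jks : {subset js <= ks}.

Definition ext_pred : ctx := extP (vU v) (ptgt (vc v)) (args_type js n).

Lemma D_ex_pred
    (Q : forall F (e : cE G F), classical_sets.set (seq V * seq F) -> Prop) :
  D ext_pred (fun F e => Q F (projT1 e) (den_rel (vUu v F (projT1 e)) (prel (projT2 e)))) ->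
  D G (fun F e => exists2 S, (S `<=` rel_dom (map (vk v F e) js) n)%classic & Q F e S).
Proof.
have [iU okr okk oke okp] := ok.
have rep F (e : cE G F) : rep_on (fun k => vc v k F e) (vk v F e) js.
  by move=> k kjs; have [_ KP] := okk k (jks kjs); exact: KP.
move=> DQ; apply: (@D_iff _ (fun F e =>
    exists p : pcode (tgt_at (ptgt (vc v)) e) (vU v F e) (args_type js n),
      Q F e (den_rel (vUu v F e) (prel p)))).
  move=> F e; split=> [[p q]|[S /(den_rel_surj (vUu v F e) (@rep F e))[T ->] q]].
    by exists (den_rel (vUu v F e) (prel p)) => //; exact: den_rel_sub (@rep F e).
  have [p pT] := pcode_complete (vUu v F e) T; exists p.
  by rewrite (_ : prel p = T) //; apply/funext => x; apply/propext.
apply: D_exPcode => // a; rewrite mem_cat => /orP[/mapP[k /jks/okk[iK _] ->]|/nseqP[-> _]].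
  exact: isK_B iK.
exact: iU.
Qed.
End PredQuantifier.

Lemma D_forall G (T : forall F, cE G F -> Type) (Q : forall F (e : cE G F), T F e -> Prop) :
  D G (fun F e => exists x, ~ Q F e x) -> D G (fun F e => forall x, Q F e x).
Proof.
move=> /D_not; apply: D_iff => F e; split=> [nQ x|aQ [x]//].
by apply: contrapT => nx; apply: nQ; exists x.
Qed.

Lemma D_forall2 G (T : forall F, cE G F -> Type) (P Q : forall F (e : cE G F), T F e -> Prop) :
  D G (fun F e => exists2 x, P F e x & ~ Q F e x) -> D G (fun F e => forall x, P F e x -> Q F e x).
Proof.
move=> /D_not; apply: D_iff => F e; split=> [nQ x Px|aQ [x /aQ]//].
by apply: contrapT => nx; apply: nQ; exists x.
Qed.

(** Induction on the formula for all contexts at once, since each quantifier enlarges the context.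
    The four [key] facts are the steps under a quantifier; universal quantifiers are reduced to
    existential ones by negation. *)
Theorem L2_definable (p : L2_formula) rs ks es ps : L2_wf rs ks es ps p ->
  forall G (v : env G), env_ok v rs ks es ps -> holds_in v p.
Proof.
have key_r r q rs' ks' es' ps' G (v : env G) : env_ok v rs' ks' es' ps' -> r \notin rs' ->
    (forall G (v : env G), env_ok v (r :: rs') ks' es' ps' -> holds_in v q) ->
    D (extH (vU v) (vU v)) (fun F e => L2_sat
      [eta vr v F (projT1 e) with r |-> val_at (vUu v F (projT1 e)) (projT2 e)]
      (vk v F (projT1 e)) (ve v F (projT1 e)) (vp v F (projT1 e)) q).
  move=> ok nr IH; set G' := extH _ _.
  exact: (IH G' _ (set_r_ok (env_ok_sub (sub_extH (vU v) (vU v)) ok) nr (isM_here _ _))).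
have key_k k q rs' ks' es' ps' G (v : env G) : env_ok v rs' ks' es' ps' -> k \notin ks' ->
    (forall G (v : env G), env_ok v rs' (k :: ks') es' ps' -> holds_in v q) ->
    D (ext_card (vU v)) (fun F e => L2_sat (vr v F (projT1 (sval e)))
      [eta vk v F (projT1 (sval e)) with k |-> card_of (projT2 (sval e))]
      (ve v F (projT1 (sval e))) (vp v F (projT1 (sval e))) q).
  move=> ok nk IH.
  have s : sub (ext_card (vU v)) G (fun F e => projT1 (sval e)).
    exact: (sub_trans (sub_pull _) (sub_NK (vU v))).
  have iK : @isK (ext_card (vU v)) (fun F e => vU v F (projT1 (sval e)))
      (fun F e => projT2 (sval e)).
    exact: (isK_sub (sub_pull _) (isK_NK (vU v))).
  exact: (IH _ _ (set_k_ok (env_ok_sub s ok) nk iK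
    (fun F e => card_ofP (vUu v F (projT1 (sval e))) (svalP e)))).
have key_e a k q rs' ks' es' ps' G (v : env G) : env_ok v rs' ks' es' ps' ->
    a \notin unzip1 es' -> k \in ks' ->
    (forall G (v : env G), env_ok v rs' ks' ((a, k) :: es') ps' -> holds_in v q) ->
    D (ext_elt (U := vU v) (vc v k)) (fun F e => L2_sat (vr v F (projT1 (sval e)))
      (vk v F (projT1 (sval e)))
      [eta ve v F (projT1 (sval e)) with a |-> ord_of (projT2 (sval e))]
      (vp v F (projT1 (sval e))) q).
  move=> ok na kks IH.
  have s : sub (ext_elt (U := vU v) (vc v k)) G (fun F e => projT1 (sval e)).
    exact: (sub_trans (sub_pull _) (sub_extH _ _)).
  apply: (IH _ _ (set_e_ok (env_ok_sub s ok) na kks (b := fun F e => projT2 (sval e)) _ _)).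
    exact: (isM_sub (sub_pull _) (isM_here _ _)).
  by move=> F e; exact: (svalP e).
have key_p P js n q rs' ks' es' ps' G (v : env G) : env_ok v rs' ks' es' ps' ->
    P \notin unzip1 ps' -> {subset js <= ks'} ->
    (forall G (v : env G), env_ok v rs' ks' es' ((P, (js, n)) :: ps') -> holds_in v q) ->
    D (ext_pred v js n) (fun F e => L2_sat (vr v F (projT1 e)) (vk v F (projT1 e))
      (ve v F (projT1 e))
      [eta vp v F (projT1 e) with P |->
         den_rel (vUu v F (projT1 e)) (prel (projT2 e))] q).
  move=> ok nP jks IH.
  apply: (IH _ _ (set_p_ok (env_ok_sub (sub_extP _ _ _) ok) nP jks (p := fun F e => projT2 e) _)).
  exact: isP_here.
elim: p rs ks es ps => [r1 r2 r3|r1 r2 r3|r1 r2|k1 k2|a1 a2|P cs vs|p IH|p IHp q IHq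
  |p IHp q IHq|p IHp q IHq|r p IH|r p IH|k p IH|k p IH|a k p IH|a k p IH
  |P js n p IH|P js n p IH] rs ks es ps /=.
- move=> /and3P[h1 h2 h3] G v [iU okr _ _ _].
  have [f1 [i1 e1]] := okr _ h1; have [f2 [i2 e2]] := okr _ h2.
  have [f3 [i3 e3]] := okr _ h3.
  apply: D_iff (D_sum_of iU i1 i2 i3) => F e /=.
  by rewrite (sum_ofP (vUu v F e)) e1 e2 e3.
- move=> /and3P[h1 h2 h3] G v [iU okr _ _ _].
  have [f1 [i1 e1]] := okr _ h1; have [f2 [i2 e2]] := okr _ h2.
  have [f3 [i3 e3]] := okr _ h3.
  (* By [val_at_cmp] composition reverses products, so [r2 * r3] is the value of [f3] after [f2]. *)
  apply: D_iff (D_comp i1 i3 i2) => F e /=.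
  rewrite -e1 -e2 -e3 -val_at_cmp; split=> [->//|]; exact: val_at_inj.
- move=> /andP[h1 h2] G v [iU okr _ _ _].
  have [f1 [i1 e1]] := okr _ h1; have [f2 [i2 e2]] := okr _ h2.
  apply: D_iff (D_eq i1 i2) => F e /=.
  rewrite -e1 -e2; split=> [->//|]; exact: val_at_inj.
- move=> /andP[h1 h2] G v [iU _ okk _ _].
  have [i1 r1] := okk _ h1; have [i2 r2] := okk _ h2.
  apply: (D_card_eq iU i1 i2) => F e.
  + by exists (vu v F e); exact: vUu.
  + by eexists; exact: r1.
  + by eexists; exact: r2.
- move=> /andP[/mapP[[b1 k1] h1 /= ->] /mapP[[b2 k2] h2 /= ->]] G v [iU _ okk oke _].
  have [kk1 [f1 [j1 c1]]] := oke _ _ h1; have [kk2 [f2 [j2 c2]]] := oke _ _ h2.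
  have [i1 r1] := okk _ kk1; have [i2 r2] := okk _ kk2.
  (* The two elements may belong to different cardinals, so equality of morphisms would not express
     equality of elements. *)
  have DE := @D_elt_eq G (vU v) (vc v k1) (vc v k2) iU i1 i2
    (fun F e => ex_intro _ (vu v F e) (vUu v F e)) (fun F e => @ord_of _ _ (vc v k1 F e))
    (fun F e => @ord_of _ _ (vc v k2 F e)) f1 f2 _ _ j1 j2 (fun F e => (c1 F e).1)
    (fun F e => (c2 F e).1).
  apply: D_iff (DE _ _) => F e /=; first last.
  + by exists (vk v F e k2); exact: r2.
  + by exists (vk v F e k1); exact: r1.
  by have [_ ->] := c1 F e; have [_ ->] := c2 F e.
- move=> /andP[/allP vrs /hasP[[P' [js n]] Pps /and3P[/eqP /= PP' /eqP sn al]]] G v.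
  move=> [iU okr okk oke okp]; subst P'.
  have [jks [kap [kapE [p [ip pP]]]]] := okp _ _ _ Pps.
  have [h [ih hP]] := args_exist okr (fun a k ak => (oke a k ak).2) kapE al vrs sn.
  apply: D_iff (D_prel iU ip ih) => F e /=.
  by have [hok [<- <-]] := hP F e; rewrite -pP.
- by move=> wf G v ok; apply: D_not; exact: IH wf G v ok.
- move=> /andP[wp wq] G v ok; apply: D_and; [exact: IHp wp G v ok | exact: IHq wq G v ok].
- move=> /andP[wp wq] G v ok; apply: D_or; [exact: IHp wp G v ok | exact: IHq wq G v ok].
- move=> /andP[wp wq] G v ok; apply: D_imp; [exact: IHp wp G v ok | exact: IHq wq G v ok].
- move=> /andP[nr wf] G v ok; have [iU _ _ _ _] := ok.
  apply: (@D_forall G (fun F _ => F : Type)).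
  apply: (@D_ex_ring G (vU v) iU (vu v) (vUu v) (fun F e x =>
    ~ L2_sat [eta vr v F e with r |-> x] (vk v F e) (ve v F e) (vp v F e) p)).
  by apply: D_not; exact: (key_r r p rs ks es ps G v ok nr (IH _ _ _ _ wf)).
- move=> /andP[nr wf] G v ok; have [iU _ _ _ _] := ok.
  apply: (@D_ex_ring G (vU v) iU (vu v) (vUu v) (fun F e x =>
    L2_sat [eta vr v F e with r |-> x] (vk v F e) (ve v F e) (vp v F e) p)).
  exact: (key_r r p rs ks es ps G v ok nr (IH _ _ _ _ wf)).
- move=> /andP[nk wf] G v ok; have [iU _ _ _ _] := ok.
  apply: (@D_forall G (fun _ _ => Cn)).
  apply: (@D_ex_card G (vU v) iU (vu v) (vUu v) (fun F e x =>
    ~ L2_sat (vr v F e) [eta vk v F e with k |-> x] (ve v F e) (vp v F e) p)).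
  by apply: D_not; exact: (key_k k p rs ks es ps G v ok nk (IH _ _ _ _ wf)).
- move=> /andP[nk wf] G v ok; have [iU _ _ _ _] := ok.
  apply: (@D_ex_card G (vU v) iU (vu v) (vUu v) (fun F e x =>
    L2_sat (vr v F e) [eta vk v F e with k |-> x] (ve v F e) (vp v F e) p)).
  exact: (key_k k p rs ks es ps G v ok nk (IH _ _ _ _ wf)).
- move=> /and3P[na kks wf] G v ok; have [iU _ okk _ _] := ok.
  have [iK KP] := okk k kks.
  apply: (@D_forall2 G (fun _ _ => V)).
  apply: (@D_ex_elt G (vU v) iU _ iK _ _ (fun F e x =>
    ~ L2_sat (vr v F e) (vk v F e) [eta ve v F e with a |-> x] (vp v F e) p) KP).
  by apply: D_not; exact: (key_e a k p rs ks es ps G v ok na kks (IH _ _ _ _ wf)).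
- move=> /and3P[na kks wf] G v ok; have [iU _ okk _ _] := ok.
  have [iK KP] := okk k kks; apply: (@D_ex_elt G (vU v) iU _ iK _ _ (fun F e x =>
    L2_sat (vr v F e) (vk v F e) [eta ve v F e with a |-> x] (vp v F e) p) KP).
  exact: (key_e a k p rs ks es ps G v ok na kks (IH _ _ _ _ wf)).
- move=> /and3P[nP /allP jks wf] G v ok.
  apply: (@D_forall2 G (fun F _ => classical_sets.set (seq V * seq F))).
  apply: (@D_ex_pred G v _ _ _ _ ok js n jks (fun F e x =>
    ~ L2_sat (vr v F e) (vk v F e) (ve v F e) [eta vp v F e with P |-> x] p)).
  by apply: D_not; exact: (key_p P js n p rs ks es ps G v ok nP jks (IH _ _ _ _ wf)).
- move=> /and3P[nP /allP jks wf] G v ok; apply: (@D_ex_pred G v _ _ _ _ ok js n jks (fun F e x =>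
    L2_sat (vr v F e) (vk v F e) (ve v F e) [eta vp v F e with P |-> x] p)).
  exact: (key_p P js n p rs ks es ps G v ok nP jks (IH _ _ _ _ wf)).
Qed.


(** * Coincidence of valuations and passage to sentences *)

Lemma with_in (T : Type) (f g : nat -> T) (s : seq nat) i x : {in s, f =1 g} ->
  {in i :: s, [eta f with i |-> x] =1 [eta g with i |-> x]}.
Proof. by move=> fg j; rewrite inE /=; case: eqP => //= _; apply: fg. Qed.

Lemma exists_iff (T : Type) (P Q : T -> Prop) : (forall x, P x <-> Q x) ->
  ((exists x, P x) <-> exists x, Q x).
Proof. by move=> PQ; split=> -[x /PQ]; exists x. Qed.

Lemma exists2_iff (T : Type) (R P Q : T -> Prop) : (forall x, P x <-> Q x) ->
  ((exists2 x, R x & P x) <-> exists2 x, R x & Q x).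
Proof. by move=> PQ; split=> -[x Rx /PQ]; exists x. Qed.

Lemma forall_iff (T : Type) (P Q : T -> Prop) : (forall x, P x <-> Q x) ->
  ((forall x, P x) <-> forall x, Q x).
Proof. by move=> PQ; split=> h x; apply/PQ. Qed.

Lemma L2_sat_agree (R : nzRingType) p rs ks es ps (er er' : nat -> R) ek ek' ee ee' ep ep' :
  L2_wf rs ks es ps p -> {in rs, er =1 er'} -> {in ks, ek =1 ek'} ->
  {in unzip1 es, ee =1 ee'} -> {in unzip1 ps, ep =1 ep'} ->
  (forall a k, (a, k) \in es -> k \in ks) ->
  (L2_sat er ek ee ep p <-> L2_sat er' ek' ee' ep' p).
Proof.
elim: p rs ks es ps er er' ek ek' ee ee' ep ep' => [r1 r2 r3|r1 r2 r3|r1 r2|k1 k2|a1 a2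
  |P cs vs|p IH|p IHp q IHq|p IHp q IHq|p IHp q IHq|r p IH|r p IH|k p IH|k p IH|a k p IH|a k p IH
  |P js n p IH|P js n p IH] rs ks es ps er er' ek ek' ee ee' ep ep' /=.
- by move=> /and3P[h1 h2 h3] hr _ _ _ _; rewrite !hr.
- by move=> /and3P[h1 h2 h3] hr _ _ _ _; rewrite !hr.
- by move=> /andP[h1 h2] hr _ _ _ _; rewrite !hr.
- by move=> /andP[h1 h2] _ hk _ _ _; rewrite !hk.
- by move=> /andP[h1 h2] _ _ he _ _; rewrite !he.
- move=> /andP[/allP vrs /hasP[[P' [js n]] Pps /and3P[/eqP /= PP' _ al]]] hr _ he hp _.
  subst P'; rewrite (hp P); last by apply/mapP; exists (P, (js, n)).
  rewrite (_ : map er vs = map er' vs); last by apply/eq_in_map => r /vrs; exact: hr.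
  rewrite (_ : map ee cs = map ee' cs) //; apply/eq_in_map => a acs; apply: he.
  elim: cs js al acs {Pps} => // b cs IH [|j js] //= /andP[bj al].
  rewrite inE => /predU1P[->|]; first by apply/mapP; exists (b, j).
  exact: IH al.
- by move=> wf hr hk he hp esk; rewrite (IH _ _ _ _ _ _ _ _ _ _ _ _ wf hr hk he hp esk).
- move=> /andP[wp wq] hr hk he hp esk; rewrite (IHp _ _ _ _ _ _ _ _ _ _ _ _ wp hr hk he hp esk).
  by rewrite (IHq _ _ _ _ _ _ _ _ _ _ _ _ wq hr hk he hp esk).
- move=> /andP[wp wq] hr hk he hp esk; rewrite (IHp _ _ _ _ _ _ _ _ _ _ _ _ wp hr hk he hp esk).
  by rewrite (IHq _ _ _ _ _ _ _ _ _ _ _ _ wq hr hk he hp esk).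
- move=> /andP[wp wq] hr hk he hp esk; rewrite (IHp _ _ _ _ _ _ _ _ _ _ _ _ wp hr hk he hp esk).
  by rewrite (IHq _ _ _ _ _ _ _ _ _ _ _ _ wq hr hk he hp esk).
- move=> /andP[_ wf] hr hk he hp esk; apply: forall_iff => x.
  exact: IH wf (with_in x hr) hk he hp esk.
- move=> /andP[_ wf] hr hk he hp esk; apply: exists_iff => x.
  exact: IH wf (with_in x hr) hk he hp esk.
- move=> /andP[_ wf] hr hk he hp esk; apply: forall_iff => x.
  by apply: IH wf hr (with_in x hk) he hp _ => a j /esk; rewrite inE orbC => ->.
- move=> /andP[_ wf] hr hk he hp esk; apply: exists_iff => x.
  by apply: IH wf hr (with_in x hk) he hp _ => a j /esk; rewrite inE orbC => ->.
- move=> /and3P[_ kks wf] hr hk he hp esk; rewrite (hk k kks); apply: forall_iff => x.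
  suff -> : L2_sat er ek [eta ee with a |-> x] ep p <->
            L2_sat er' ek' [eta ee' with a |-> x] ep' p by [].
  by apply: IH wf hr hk (with_in x he) hp _ => b j; rewrite inE => /predU1P[[_ ->]//|/esk].
- move=> /and3P[_ kks wf] hr hk he hp esk; rewrite (hk k kks); apply: exists2_iff => x.
  by apply: IH wf hr hk (with_in x he) hp _ => b j; rewrite inE => /predU1P[[_ ->]//|/esk].
- move=> /and3P[_ /allP jks wf] hr hk he hp esk.
  rewrite (_ : map ek js = map ek' js); last by apply/eq_in_map => j /jks; exact: hk.
  apply: forall_iff => x.
  suff -> : L2_sat er ek ee [eta ep with P |-> x] p <->
            L2_sat er' ek' ee' [eta ep' with P |-> x] p by [].
  exact: IH wf hr hk he (with_in x hp) esk.
- move=> /and3P[_ /allP jks wf] hr hk he hp esk.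
  rewrite (_ : map ek js = map ek' js); last by apply/eq_in_map => j /jks; exact: hk.
  apply: exists2_iff => x; exact: IH wf hr hk he (with_in x hp) esk.
Qed.

Lemma L2_holds_sat (R : nzRingType) p (er : nat -> R) ek ee ep : L2_sentence p ->
  (L2_sat er ek ee ep p <-> L2_holds R p).
Proof.
move=> wf; split=> [h er' ek' ee' ep'|]; last exact.
have [H _] : L2_sat er ek ee ep p <-> L2_sat er' ek' ee' ep' p by exact: L2_sat_agree wf _ _ _ _ _.
exact: H.
Qed.

(** [D] says nothing about the free variables of its formula. When the truth value is independent of
    the valuation, quantifying each name in both sorts yields a sentence with the same meaning. *)
Definition close (s : seq nat) (p : cat_formula) : cat_formula :=
  foldr (fun i q => CAllO i (CAllM i q)) p s.

Lemma cat_wf_bound p : exists n, forall os ms, {subset iota 0 n <= os} ->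
  {subset iota 0 n <= ms} -> cat_wf os ms p.
Proof.
have sub m n (s : seq nat) : m <= n -> {subset iota 0 n <= s} -> {subset iota 0 m <= s}.
  by move=> mn ns i; rewrite mem_iota => /andP[_ im]; apply: ns; rewrite mem_iota; lia.
have subl m n (s : seq nat) : {subset iota 0 (m + n) <= s} -> {subset iota 0 m <= s}.
  by apply: sub; exact: leq_addr.
have subr m n (s : seq nat) : {subset iota 0 (m + n) <= s} -> {subset iota 0 n <= s}.
  by apply: sub; exact: leq_addl.
have at_ m n (s : seq nat) : m < n -> {subset iota 0 n <= s} -> m \in s.
  by move=> mn; apply; rewrite mem_iota; lia.
have cons n i (s : seq nat) : {subset iota 0 n <= s} -> {subset iota 0 n <= i :: s}.
  by move=> ns j /ns; rewrite inE orbC => ->.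
elim: p => [f X Y|h f g|f X|X Y|f g|p [n IH]|p [m IHp] q [n IHq]|p [m IHp] q [n IHq]
  |p [m IHp] q [n IHq]|X p [n IH]|X p [n IH]|f p [n IH]|f p [n IH]] /=.
- by exists (f + X + Y).+1 => os ms so sm; rewrite !(at_ _ (f + X + Y).+1) //; lia.
- by exists (f + h + g).+1 => os ms so sm; rewrite !(at_ _ (f + h + g).+1) //; lia.
- by exists (f + X).+1 => os ms so sm; rewrite !(at_ _ (f + X).+1) //; lia.
- by exists (Y + X).+1 => os ms so sm; rewrite !(at_ _ (Y + X).+1) //; lia.
- by exists (f + g).+1 => os ms so sm; rewrite !(at_ _ (f + g).+1) //; lia.
- by exists n.
- exists (m + n) => os ms so sm.
  by apply/andP; split; [apply: IHp; [exact: subl so|exact: subl sm]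
    |apply: IHq; [exact: subr so|exact: subr sm]].
- exists (m + n) => os ms so sm.
  by apply/andP; split; [apply: IHp; [exact: subl so|exact: subl sm]
    |apply: IHq; [exact: subr so|exact: subr sm]].
- exists (m + n) => os ms so sm.
  by apply/andP; split; [apply: IHp; [exact: subl so|exact: subl sm]
    |apply: IHq; [exact: subr so|exact: subr sm]].
- by exists n => os ms so sm; apply: IH => //; apply: cons.
- by exists n => os ms so sm; apply: IH => //; apply: cons.
- by exists n => os ms so sm; apply: IH => //; apply: cons.
- by exists n => os ms so sm; apply: IH => //; apply: cons.
Qed.

Lemma close_wf s p os ms :
  (forall os ms, {subset s <= os} -> {subset s <= ms} -> cat_wf os ms p) ->
  cat_wf os ms (close s p).
Proof.
move=> wf; have : forall os ms, (forall os' ms', {subset s <= os'} -> {subset s <= ms'} ->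
    {subset os <= os'} -> {subset ms <= ms'} -> cat_wf os' ms' p) -> cat_wf os ms (close s p).
  move=> {}os {}ms {wf}; elim: s os ms => [|i s IH] os ms wf /=.
    by apply: wf.
  apply: IH => os' ms' so sm oo mm; apply: wf.
  - by move=> j; rewrite inE => /predU1P[->|/so//]; apply: oo; rewrite mem_head.
  - by move=> j; rewrite inE => /predU1P[->|/sm//]; apply: mm; rewrite mem_head.
  - by move=> j jo; apply: oo; rewrite inE jo orbT.
  - by move=> j jo; apply: mm; rewrite inE jo orbT.
by apply=> os' ms' so sm _ _; exact: wf.
Qed.

Lemma close_sat (C : category) (X0 : obj C) s p (H : Prop) :
  (forall (eo : nat -> obj C) em, cat_sat eo em p <-> H) ->
  forall (eo : nat -> obj C) em, cat_sat eo em (close s p) <-> H.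
Proof.
move=> pH; elim: s => [|i s IH] //= eo em.
split=> [h|h x u]; last by apply/IH.
exact/IH/(h X0 (Morphism (idm X0))).
Qed.

Lemma lmodule_inhabited (F : nzRingType) : exists M : lmodule F, True.
Proof.
have sm : small ('rV[F]_0 : lmodType F) by exists unit, (fun=> 0%R) => v; exists tt; exact: thinmx0.
by have [M _] := small_module sm; exists M.
Qed.

Theorem L2_to_cat p : L2_sentence p -> exists2 q, cat_sentence q &
  forall F : skewfield, cat_holds (Mod F) q <-> L2_holds F p.
Proof.
move=> wf; pose M0 (F : skewfield) : obj (Mod F) := projT1 (cid (@lmodule_inhabited F)).
(* One situation and no prescribed variable: what is defined in [G0] depends on [F] alone. *)
pose G0 : ctx := @Ctx (fun=> unit) 0 0 (fun F _ _ => M0 F) (fun F _ _ => Morphism (idm (M0 F))).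
pose G1 := extO G0.
pose G2 := @pull G1 (fun F => {e : cE G1 F | one_dim e.2}) (fun F e => sval e).
pose U2 : ovar G2 := fun F e => (sval e).2.
have line F (e : cE G2 F) : exists u : (U2 F e : lmodule F), gen_line u.
  exact/one_dim_line/(svalP e).
pose u2 F (e : cE G2 F) := projT1 (cid (line F e)).
have Uu2 F (e : cE G2 F) : gen_line (u2 F e) := projT2 (cid (line F e)).
pose K2 F (e : cE G2 F) : kcode (U2 F e) := projT1 (cid (kcode_rep k0 (Uu2 F e))).
(* No variable is in scope, so apart from the line and its generator these values only fill the
   record. *)
pose v : env G2 := @Env G2 U2 u2 Uu2 (fun F e i => 0%R) (fun F e i => k0)
  (fun F e i => k0 : V) (fun F e i => classical_sets.set0) (fun i => K2).
have ok : env_ok v [::] [::] [::] [::].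
  by split=> //; exact: (isO_sub (sub_pull _) (isO_here G0)).
have D2 : D G2 (fun F e => L2_holds F p).
  by apply: D_iff (L2_definable wf ok) => F e; exact: L2_holds_sat.
have D1 : D G1 (fun F e => one_dim e.2 /\ L2_holds F p).
  apply: (@D_guard G1 (fun F e => one_dim e.2) (fun F e => L2_holds F p)) D2.
  exact: (D_one_dim (isO_here G0)).
have [q qP] : D G0 (fun F e => L2_holds F p).
  (* The truth of a sentence does not depend on the line that represents the ring, so an existential
     quantifier over lines suffices; [F] over itself is such a line. *)
  apply: (@D_iff _ (fun F e => exists U : obj (Mod F), one_dim U /\ L2_holds F p)).
    move=> F e; split=> [[U []//]|h].
    have [R [iR]] := small_module (small_El _ : small (F^o : lmodType F)).
    exists R; split=> //; apply/one_dim_line; exists (iso_bwd iR 1%R).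
    have gK := iso_bwdK iR; split=> [e0|x].
      have := congr1 (iso_fwd iR) e0; rewrite gK linear0 => /eqP.
      by rewrite oner_eq0.
    exists (iso_fwd iR x); rewrite -linearZ_LR.
    by rewrite /GRing.scale /= mulr1 iso_fwdK.
  exact: (D_exO D1).
have [n nP] := cat_wf_bound q; exists (close (iota 0 n) q); first exact: close_wf.
move=> F; have cl := close_sat (M0 F) (iota 0 n) (fun eo em => qP F tt eo em
  (fun i li => False_ind _ (notF li)) (fun i li => False_ind _ (notF li))).
split=> [h|h eo em]; last exact/cl.
exact/(cl (fun=> M0 F) (fun=> Morphism (idm (M0 F))))/h.
Qed.

(** * Back and forth between a category and its codes *)

Record cat_iso (C : category) (X Y : obj C) := CatIso {
  fwd : hom X Y;
  bwd : hom Y X;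
  fwdK : cmp bwd fwd = idm X;
  bwdK : cmp fwd bwd = idm Y
}.

(** Objects are replaced by names in [T], and an object may have many names; the morphisms are
    kept. *)
Definition pullback_cat (C : category) (T : Type) (dec : T -> obj C) : category :=
  @Category T (fun t s => hom (dec t) (dec s)) (fun t => idm (dec t))
    (fun _ _ _ g f => cmp g f) (fun _ _ => @cmp1m C _ _) (fun _ _ => @cmpm1 C _ _)
    (fun _ _ _ _ => @cmpA C _ _ _ _).

Section BackAndForth.
Variables (C : category) (T : Type) (dec : T -> obj C).
Let K := pullback_cat dec.
Let matched (x : obj C) (t : T) : Prop := exists _ : cat_iso x (dec t), True.

Hypothesis fresh_code : forall x (s : seq T), exists t, ~ List.In t s /\ matched x t.
Hypothesis fresh_obj : forall t (s : seq (obj C)), exists x, ~ List.In x s /\ matched x t.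

(** [matched] is a proposition, so by proof irrelevance the chosen isomorphism depends on [x] and
    [t] only. Morphisms met in different rounds are thus transported along the same isomorphisms. *)
Let theta x t (h : matched x t) : cat_iso x (dec t) := projT1 (cid h).

Let tr x y t s (h : matched x t) (k : matched y s) (m : hom x y) : @hom K t s :=
  cmp (fwd (theta k)) (cmp m (bwd (theta h))).

Let untr x y t s (h : matched x t) (k : matched y s) (m : @hom K t s) : hom x y :=
  cmp (bwd (theta k)) (cmp (m : hom (dec t) (dec s)) (fwd (theta h))).

Let trK x y t s (h : matched x t) (k : matched y s) : cancel (tr h k) (untr h k).
Proof.
by move=> m; rewrite /tr /untr -!cmpA fwdK cmpm1 !cmpA fwdK cmp1m.
Qed.

Let untrK x y t s (h : matched x t) (k : matched y s) : cancel (untr h k) (tr h k).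
Proof.
by move=> m; rewrite /tr /untr -!cmpA bwdK cmpm1 !cmpA bwdK cmp1m.
Qed.

Let tr_id x t (h : matched x t) : tr h h (idm x) = @idm K t.
Proof. by rewrite /tr cmp1m bwdK. Qed.

Let tr_cmp x y z t s r (h : matched x t) (k : matched y s) (l : matched z r)
  (g : hom y z) (f : hom x y) : tr h l (cmp g f) = @cmp K _ _ _ (tr k l g) (tr h k f).
Proof.
by rewrite /tr /K /= -!cmpA (cmpA (bwd (theta k)) (fwd (theta k))) fwdK cmp1m.
Qed.

(** Finiteness leaves room for a fresh partner at each move; injectivity in both directions is what
    atomic equality of objects needs. *)
Record position (r : obj C -> T -> Prop) : Prop := Position {
  pos_matched : forall x t, r x t -> matched x t;
  pos_inj : forall x y t s, r x t -> r y s -> (x = y <-> t = s);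
  pos_fin : exists l : seq (obj C * T), forall x t, r x t -> List.In (x, t) l
}.

Let extends (r r' : obj C -> T -> Prop) := forall x t, r x t -> r' x t.

Let add_pair r x t : position r -> matched x t -> (forall s, ~ r x s) ->
  (forall y, ~ r y t) -> position (fun y s => r y s \/ (y = x /\ s = t)).
Proof.
move=> [rm ri [l lP]] m nx nt; split.
- by move=> y s [/rm|[-> ->]].
- move=> y z s s' [ry|[-> ->]] [rz|[-> ->]] //; first exact: ri.
    by split=> e; exfalso; [apply: (nx s); rewrite -e|apply: (nt y); rewrite -e].
  by split=> e; exfalso; [apply: (nx s'); rewrite e|apply: (nt z); rewrite e].
exists ((x, t) :: l) => y s [/lP ?|[-> ->]]; by [right|left].
Qed.

Let forth r x : position r -> exists t r', [/\ position r', extends r r' & r' x t].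
Proof.
move=> pr; have [[t rt]|nr] := pselect (exists t, r x t); first by exists t, r; split.
have [l lP] := pos_fin pr; have [t [nt m]] := fresh_code x (map snd l).
exists t, (fun y s => r y s \/ (y = x /\ s = t)); split=> [|y s ry|]; [|by left|by right].
apply: add_pair => // [s rs|y /lP yl]; first by apply: nr; exists s.
by apply: nt; exact: (List.in_map snd _ _ yl).
Qed.

Let back r t : position r -> exists x r', [/\ position r', extends r r' & r' x t].
Proof.
move=> pr; have [[x rt]|nr] := pselect (exists x, r x t); first by exists x, r; split.
have [l lP] := pos_fin pr; have [x [nx m]] := fresh_obj t (map fst l).
exists x, (fun y s => r y s \/ (y = x /\ s = t)); split=> [|y s ry|]; [|by left|by right].
apply: add_pair => // [s /lP yl|y ry]; last by apply: nr; exists y.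
by apply: nx; exact: (List.in_map fst _ _ yl).
Qed.

(** Corresponding morphisms have paired ends, and one is the transport of the other; [tr_id] and
    [tr_cmp] then preserve identities and composition. *)
Let mrel (r : obj C -> T -> Prop) (f : morphism C) (g : morphism K) : Prop :=
  exists x y t s (h : matched x t) (k : matched y s) (m : hom x y),
    [/\ r x t, r y s, f = Morphism m & g = Morphism (tr h k m)].

Let mrel_extends r r' f g : extends r r' -> mrel r f g -> mrel r' f g.
Proof.
move=> rr' [x [y [t [s [h [k [m [/rr' rx /rr' ry fE gE]]]]]]]].
by exists x, y, t, s, h, k, m.
Qed.

Let mforth r f : position r -> exists g r', [/\ position r', extends r r' & mrel r' f g].
Proof.
case: f => x y m pr; have [t [r1 [p1 e1 rx]]] := forth x pr.
have [s [r2 [p2 e2 ry]]] := forth y p1; have rx' := e2 _ _ rx.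
exists (Morphism (tr (pos_matched p2 rx') (pos_matched p2 ry) m)), r2.
split=> // [z u /e1/e2//|]; exists x, y, t, s, (pos_matched p2 rx'), (pos_matched p2 ry), m.
by split.
Qed.

Let mback r g : position r -> exists f r', [/\ position r', extends r r' & mrel r' f g].
Proof.
case: g => t s m pr; have [x [r1 [p1 e1 rx]]] := back t pr.
have [y [r2 [p2 e2 ry]]] := back s p1; have rx' := e2 _ _ rx.
exists (Morphism (untr (pos_matched p2 rx') (pos_matched p2 ry) m)), r2.
split=> // [z u /e1/e2//|]; exists x, y, t, s, (pos_matched p2 rx'), (pos_matched p2 ry).
by exists (untr (pos_matched p2 rx') (pos_matched p2 ry) m); split=> //; rewrite untrK.
Qed.

Let in_cons_env (A B : Type) (R : A -> B -> Prop) (s : seq nat) (e : nat -> A) (e' : nat -> B) i a b :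
  R a b -> {in s, forall j, R (e j) (e' j)} ->
  {in i :: s, forall j, R ([eta e with i |-> a] j) ([eta e' with i |-> b] j)}.
Proof. by move=> Rab Re j; rewrite inE /=; case: eqP => //= _ js; apply: Re. Qed.

Let game p os ms r eo em (eo' : nat -> obj K) em' : cat_wf os ms p -> position r ->
  {in os, forall X, r (eo X) (eo' X)} -> {in ms, forall f, mrel r (em f) (em' f)} ->
  (cat_sat eo em p <-> cat_sat eo' em' p).
Proof.
elim: p os ms r eo em eo' em' => [f X Y|h f g|f X|X Y|f g|p IH|p IHp q IHq|p IHp q IHq
  |p IHp q IHq|X p IH|X p IH|f p IH|f p IH] os ms r eo em eo' em' /=.
- move=> /and3P[fms Xos Yos] pr ho hm.
  have [x [y [t [s [h [k [m [rx ry -> ->]]]]]]]] := hm f fms => /=.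
  by rewrite (pos_inj pr rx (ho X Xos)) (pos_inj pr ry (ho Y Yos)).
- move=> /and3P[hms fms gms] pr ho hm.
  have [x [y [t [s [h1 [k1 [m [rx ry -> ->]]]]]]]] := hm h hms.
  have [x' [y' [t' [s' [h2 [k2 [m' [rx' ry' -> ->]]]]]]]] := hm f fms.
  have [x'' [y'' [t'' [s'' [h3 [k3 [m'' [rx'' ry'' -> ->]]]]]]]] := hm g gms.
  (* Once the ends fit on both sides, the claim is the functoriality and injectivity of [tr]. Each
     side alone supplies its own equations between ends, and [pos_inj] transfers them to the other
     side. *)
  have key (e1 : y'' = x') (e2 : x'' = x) (e3 : y' = y) (e1' : s'' = t') (e2' : t'' = t)
      (e3' : s' = s) : (exists X Y Z (u : hom Y Z) (v : hom X Y), [/\ Morphism m' = Morphism u,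
     Morphism m'' = Morphism v & Morphism m = Morphism (cmp u v)]) <->
     (exists X Y Z (u : @hom K Y Z) (v : @hom K X Y), [/\ Morphism (tr h2 k2 m') = Morphism u,
     Morphism (tr h3 k3 m'') = Morphism v & Morphism (tr h1 k1 m) = Morphism (cmp u v)]).
    subst; rewrite (Prop_irrelevance h3 h1) (Prop_irrelevance k2 k1) (Prop_irrelevance k3 h2).
    rewrite !comp_sat -tr_cmp; split=> [->//|]; exact: (can_inj (trK _ _)).
  have i1 := pos_inj pr ry'' rx'; have i2 := pos_inj pr rx'' rx.
  have i3 := pos_inj pr ry' ry.
  split=> H; have [X [Y [Z [u [v [e1 e2 e3]]]]]] := H.
    have d1 := congr1 (@dom C) e1; have d2 := congr1 (@dom C) e2.
    have d3 := congr1 (@dom C) e3; have c1 := congr1 (@cod C) e1.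
    have c2 := congr1 (@cod C) e2; have c3 := congr1 (@cod C) e3.
    move: d1 d2 d3 c1 c2 c3 => /= d1 d2 d3 c1 c2 c3.
    have j1 : y'' = x' by rewrite d1.
    have j2 : x'' = x by rewrite d2.
    have j3 : y' = y by rewrite c1.
    have [+ _] := key j1 j2 j3 (proj1 i1 j1) (proj1 i2 j2) (proj1 i3 j3); exact.
  have d1 := congr1 (@dom K) e1; have d2 := congr1 (@dom K) e2.
  have d3 := congr1 (@dom K) e3; have c1 := congr1 (@cod K) e1.
  have c2 := congr1 (@cod K) e2; have c3 := congr1 (@cod K) e3.
  move: d1 d2 d3 c1 c2 c3 => /= d1 d2 d3 c1 c2 c3.
  have j1 : s'' = t' by rewrite d1.
  have j2 : t'' = t by rewrite d2.
  have j3 : s' = s by rewrite c1.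
  have [_ +] := key (proj2 i1 j1) (proj2 i2 j2) (proj2 i3 j3) j1 j2 j3; exact.
- move=> /andP[fms Xos] pr ho hm.
  have [x [y [t [s [h [k [m [rx ry -> ->]]]]]]]] := hm f fms.
  have rX := ho X Xos; have i1 := pos_inj pr rx rX; have i2 := pos_inj pr ry rX.
  move: (eo X) (eo' X) i1 i2 {rX} => x0 t0 i1 i2.
  have key (e1 : x = x0) (e2 : y = x0) (e1' : t = t0) (e2' : s = t0) :
      Morphism m = Morphism (idm x0) <-> Morphism (tr h k m) = Morphism (C := K) (idm t0).
    subst; rewrite (Prop_irrelevance k h); split=> [/Morphism_inj->|/Morphism_inj].
      by rewrite tr_id.
    by rewrite -(tr_id h) => /(can_inj (trK _ _))->.
  split=> H; have d := congr1 (@dom _) H; have c := congr1 (@cod _) H; move: d c => /= d c.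
    have [+ _] := key d c (proj1 i1 d) (proj1 i2 c); exact.
  have [_ +] := key (proj2 i1 d) (proj2 i2 c) d c; exact.
- by move=> /andP[Xos Yos] pr ho hm; exact: (pos_inj pr (ho X Xos) (ho Y Yos)).
- move=> /andP[fms gms] pr ho hm.
  have [x [y [t [s [h1 [k1 [m [rx ry -> ->]]]]]]]] := hm f fms.
  have [x' [y' [t' [s' [h2 [k2 [m' [rx' ry' -> ->]]]]]]]] := hm g gms.
  have i1 := pos_inj pr rx rx'; have i2 := pos_inj pr ry ry'.
  have key (e1 : x = x') (e2 : y = y') (e1' : t = t') (e2' : s = s') :
      Morphism m = Morphism m' <-> Morphism (tr h1 k1 m) = Morphism (tr h2 k2 m').
    subst; rewrite (Prop_irrelevance h2 h1) (Prop_irrelevance k2 k1).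
    by split=> [/Morphism_inj->//|/Morphism_inj/(can_inj (trK _ _))->].
  split=> H; have d := congr1 (@dom _) H; have c := congr1 (@cod _) H; move: d c => /= d c.
    have [+ _] := key d c (proj1 i1 d) (proj1 i2 c); exact.
  have [_ +] := key (proj2 i1 d) (proj2 i2 c) d c; exact.
- by move=> wf pr ho hm; rewrite (IH _ _ _ _ _ _ _ wf pr ho hm).
- by move=> /andP[wp wq] pr ho hm; rewrite (IHp _ _ _ _ _ _ _ wp pr ho hm) (IHq _ _ _ _ _ _ _ wq pr ho hm).
- by move=> /andP[wp wq] pr ho hm; rewrite (IHp _ _ _ _ _ _ _ wp pr ho hm) (IHq _ _ _ _ _ _ _ wq pr ho hm).
- by move=> /andP[wp wq] pr ho hm; rewrite (IHp _ _ _ _ _ _ _ wp pr ho hm) (IHq _ _ _ _ _ _ _ wq pr ho hm).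
- move=> wf pr ho hm.
  have step x (t : obj K) r' : position r' -> extends r r' -> r' x t ->
      cat_sat [eta eo with X |-> x] em p <-> cat_sat [eta eo' with X |-> t] em' p.
    move=> pr' ext rxt; apply: IH wf pr' _ _; last by move=> f /hm; exact: mrel_extends.
    by apply: in_cons_env => // Y /ho/ext.
  split=> H => [t|x].
    by have [x [r' [pr' ext rxt]]] := back t pr; apply/(step x t r').
  by have [t [r' [pr' ext rxt]]] := forth x pr; apply/(step x t r').
- move=> wf pr ho hm.
  have step x (t : obj K) r' : position r' -> extends r r' -> r' x t ->
      cat_sat [eta eo with X |-> x] em p <-> cat_sat [eta eo' with X |-> t] em' p.
    move=> pr' ext rxt; apply: IH wf pr' _ _; last by move=> f /hm; exact: mrel_extends.
    by apply: in_cons_env => // Y /ho/ext.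
  split=> -[] => [x|t] H.
    by have [t [r' [pr' ext rxt]]] := forth x pr; exists t; apply/(step x t r').
  by have [x [r' [pr' ext rxt]]] := back t pr; exists x; apply/(step x t r').
- move=> wf pr ho hm.
  have step u (v : morphism K) r' : position r' -> extends r r' -> mrel r' u v ->
      cat_sat eo [eta em with f |-> u] p <-> cat_sat eo' [eta em' with f |-> v] p.
    move=> pr' ext ruv; apply: IH wf pr' _ _; first by move=> Y /ho/ext.
    by apply: in_cons_env => // g /hm; exact: mrel_extends.
  split=> H => [v|u].
    by have [u [r' [pr' ext ruv]]] := mback v pr; apply/(step u v r').
  by have [v [r' [pr' ext ruv]]] := mforth u pr; apply/(step u v r').
- move=> wf pr ho hm.
  have step u (v : morphism K) r' : position r' -> extends r r' -> mrel r' u v ->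
      cat_sat eo [eta em with f |-> u] p <-> cat_sat eo' [eta em' with f |-> v] p.
    move=> pr' ext ruv; apply: IH wf pr' _ _; first by move=> Y /ho/ext.
    by apply: in_cons_env => // g /hm; exact: mrel_extends.
  split=> -[] => [u|v] H.
    by have [v [r' [pr' ext ruv]]] := mforth u pr; exists v; apply/(step u v r').
  by have [u [r' [pr' ext ruv]]] := mback v pr; exists u; apply/(step u v r').
Qed.

(** The game starts from the empty position, which imposes nothing on the two valuations. *)
Theorem back_and_forth p (eo' : nat -> obj K) em' : cat_sentence p ->
  (cat_holds C p <-> cat_sat eo' em' p).
Proof.
move=> wf; have agree (eo : nat -> obj C) em : cat_sat eo em p <-> cat_sat eo' em' p.
  have pos0 : position (fun _ _ => False) by split=> //; exists [::].
  have := @game p [::] [::] _ eo em eo' em' wf pos0; exact.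
split=> [h|h eo em]; last by apply/agree.
by apply/(agree (fun=> dec (eo' 0)) (fun=> Morphism (idm (dec (eo' 0))))).
Qed.
End BackAndForth.

(** * Codes of modules *)

Section Codes.
Variable F : nzRingType.
Local Open Scope classical_set_scope.

(* The label [lam] is arbitrary: it provides every module with infinitely many
   codes. *)
Record raw := Raw {
  mu : Cn;
  lam : Cn;
  radd : set (seq V * seq F);
  rscale : set (seq V * seq F);
  radd_sub : radd `<=` rel_dom [:: mu; mu; mu] 0;
  rscale_sub : rscale `<=` rel_dom [:: mu; mu] 1
}.

Lemma raw_eq X Y : mu X = mu Y -> lam X = lam Y -> radd X = radd Y ->
  rscale X = rscale Y -> X = Y.
Proof.
case: X Y => [m l a s ha hs] [m' l' a' s' ha' hs'] /= *; subst.
by rewrite (Prop_irrelevance ha ha') (Prop_irrelevance hs hs').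
Qed.

Definition ad (X : raw) (x y z : El (mu X)) : Prop :=
  radd X ([:: sval x; sval y; sval z], [::]).
Definition sc (X : raw) (c : F) (x y : El (mu X)) : Prop :=
  rscale X ([:: sval x; sval y], [:: c]).

(** The laws refer to the graph of addition, since L2 has no function variables; functionality
    compares the underlying sets, which is the equality of L2. *)
Definition ad_ax (X : raw) : Prop :=
  [/\ forall x y : El (mu X), exists z, ad x y z,
      forall x y z z' : El (mu X), ad x y z -> ad x y z' -> sval z = sval z',
      forall x y z u v w : El (mu X), ad x y u -> ad u z w -> ad y z v -> ad x v w,
      forall x y z : El (mu X), ad x y z -> ad y x z
    & exists o : El (mu X), (forall x, ad o x x) /\ forall x, exists y, ad y x o].

(** L2 has no constants and no nested terms: a product of scalars is named by a variable, and the
    unit is a left identity of the ring, which equals [1] on taking [c] to be [1]. *)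
Definition sc_ax (X : raw) : Prop :=
  [/\ forall c (x : El (mu X)), exists y, sc c x y,
      forall c (x y y' : El (mu X)), sc c x y -> sc c x y' -> sval y = sval y',
      forall c d e (x y z : El (mu X)), e = (c * d)%R -> sc d x y -> sc c y z -> sc e x z
    & exists e : F, (forall c, c = (e * c)%R) /\ forall x : El (mu X), sc e x x].

Definition distr_ax (X : raw) : Prop :=
  (forall c (x y z x' y' z' : El (mu X)),
    sc c x x' -> sc c y y' -> ad x y z -> ad x' y' z' -> sc c z z') /\
  (forall c d e (x y z w : El (mu X)),
    e = (c + d)%R -> sc c x y -> sc d x z -> ad y z w -> sc e x w).

Definition is_mod (X : raw) : Prop := [/\ ad_ax X, sc_ax X & distr_ax X].

Definition ocode := {X : raw | is_mod X}.

Section Decode.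
Variable X : ocode.
Local Notation T := (El (mu (sval X))).

Let axA : ad_ax (sval X). Proof. by case: (svalP X). Qed.
Let axS : sc_ax (sval X). Proof. by case: (svalP X). Qed.
Let axD : distr_ax (sval X). Proof. by case: (svalP X). Qed.

Let add_ex (x y : T) : exists z, ad x y z. Proof. by case: axA. Qed.
Let scale_ex (c : F) (x : T) : exists y, sc c x y. Proof. by case: axS. Qed.
Let zero_ex : exists o : T, (forall x, ad o x x) /\ forall x, exists y, ad y x o.
Proof. by case: axA. Qed.

Definition dadd (x y : T) : T := projT1 (cid (add_ex x y)).
Definition dscale (c : F) (x : T) : T := projT1 (cid (scale_ex c x)).
Definition dzero : T := projT1 (cid zero_ex).

Fact opp_ex x : exists y, ad y x dzero.
Proof. by have [_] := projT2 (cid zero_ex); apply. Qed.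
Definition dopp (x : T) : T := projT1 (cid (opp_ex x)).

Fact daddP x y z : ad x y z <-> dadd x y = z.
Proof.
split=> [h|<-]; last exact: (projT2 (cid (add_ex x y))).
by apply: sval_inj; case: axA => _ fn _ _ _; apply: fn h; exact: (projT2 (cid (add_ex x y))).
Qed.

Fact dscaleP c x y : sc c x y <-> dscale c x = y.
Proof.
split=> [h|<-]; last exact: (projT2 (cid (scale_ex c x))).
by apply: sval_inj; case: axS => _ fn _ _; apply: fn h; exact: (projT2 (cid (scale_ex c x))).
Qed.

Fact dadd0 : left_id dzero dadd.
Proof. by move=> x; apply/daddP; have [] := projT2 (cid zero_ex). Qed.
Fact daddA : associative dadd.
Proof.
move=> x y z; apply/daddP; case: axA => _ _ as_ _ _.
by apply: (as_ x y z (dadd x y)); apply/daddP.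
Qed.
Fact daddC : commutative dadd.
Proof. by move=> x y; apply/daddP; case: axA => _ _ _ co _; apply: co; apply/daddP. Qed.
Fact daddN : left_inverse dzero dopp dadd.
Proof. by move=> x; apply/daddP; exact: (projT2 (cid (opp_ex x))). Qed.

Definition dzmod := GRing.isZmodule.Build T daddA daddC dadd0 daddN.
Let Z : zmodType := zmod_on dzmod.

Fact dscaleA (c d : F) (a : Z) : dscale c (dscale d a) = dscale (c * d) a.
Proof.
by apply/esym/dscaleP; case: axS => _ _ co _; apply: (co c d _ _ (dscale d a)) => //; apply/dscaleP.
Qed.
Fact dscale1 : left_id 1%R (dscale : F -> Z -> Z).
Proof.
move=> x; case: axS => _ _ _ [e [e1 es]]; apply/dscaleP.
by have := es x; rewrite (_ : e = 1%R) //; rewrite (e1 1%R) mulr1.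
Qed.
Fact dscaleDr : right_distributive (dscale : F -> Z -> Z) +%R.
Proof.
move=> c x y; apply/dscaleP; case: axD => ds _.
by apply: (ds c x y (dadd x y) (dscale c x) (dscale c y)); first [apply/daddP|apply/dscaleP].
Qed.
Fact dscaleDl (a : Z) : {morph (fun c => (dscale c a : Z)) : c d / (c + d)%R}.
Proof.
move=> c d; apply/dscaleP; case: axD => _ ds.
by apply: (ds c d _ a (dscale c a) (dscale d a)) => //; first [apply/daddP|apply/dscaleP].
Qed.

Definition decode : lmodule F :=
  Lmodule (GRing.Zmodule_isLmodule.Build F Z dscaleA dscale1 dscaleDr dscaleDl).

Lemma decode_add (x y z : T) : ad x y z <-> ((x : decode) + (y : decode))%R = z.
Proof. exact: daddP. Qed.
Lemma decode_scale c (x y : T) : sc c x y <-> (c *: (x : decode))%R = y.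
Proof. exact: dscaleP. Qed.
End Decode.

Section Graph.
Variables X Y : ocode.

Definition graph_in (H : set (seq V * seq F)) (x : El (mu (sval X))) (y : El (mu (sval Y))) :=
  H ([:: sval x; sval y], [::]).

Definition is_hom (H : set (seq V * seq F)) : Prop :=
  [/\ forall x, exists y, graph_in H x y,
      forall x y y', graph_in H x y -> graph_in H x y' -> sval y = sval y',
      forall x y z x' y' z', ad x y z -> graph_in H x x' -> graph_in H y y' ->
        graph_in H z z' -> ad x' y' z'
    & forall c x y x' y', sc c x y -> graph_in H x x' -> graph_in H y y' -> sc c x' y'].

Definition graph (m : @hom (Mod F) (decode X) (decode Y)) : set (seq V * seq F) :=
  [set c | exists x : El (mu (sval X)), c = ([:: sval x; sval (ap m x)], [::])].

Lemma graph_sub m : graph m `<=` rel_dom [:: mu (sval X); mu (sval Y)] 0.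
Proof.
move=> _ [x ->]; split=> //=; split; [exact: (svalP x)|].
by split=> //; exact: (svalP (ap m x : El _)).
Qed.

Lemma graphP m x y : graph_in (graph m) x y <-> ap m x = y.
Proof.
split=> [[x' [/sval_inj <- /sval_inj]]|<-]; first by move->.
by exists x.
Qed.

Lemma graph_hom m : is_hom (graph m).
Proof.
split=> [x|x y y' /graphP<- /graphP<-//|x y z x' y' z'|c x y x' y'].
- by exists (ap m x); apply/graphP.
- move=> /decode_add<- /graphP<- /graphP<- /graphP<-; apply/decode_add.
  by rewrite linearD.
- by move=> /decode_scale<- /graphP<- /graphP<-; apply/decode_scale; rewrite linearZ.
Qed.

Lemma graph_inj : injective graph.
Proof.
move=> m m' e; apply: hom_ext => x; apply/graphP; rewrite e; exact/graphP.
Qed.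

(** The inclusion in [rel_dom] excludes tuples of wrong length or with entries outside the carriers,
    on which [is_hom] says nothing; hence the graph is all of [H]. *)
Lemma hom_graph H : H `<=` rel_dom [:: mu (sval X); mu (sval Y)] 0 -> is_hom H ->
  exists m, graph m = H.
Proof.
move=> Hd [tot fn addH scH]; have [h hP] := choice tot.
have hE x y : graph_in H x y <-> h x = y.
  by split=> [xy|<-//]; apply/sval_inj/(fn x).
have lh : linear (h : decode X -> decode Y).
  move=> c x y; apply/esym; apply/decode_add.
  have hs : h (c *: (x : decode X))%R = (c *: (h x : decode Y))%R.
    apply/esym; apply/decode_scale; apply: (scH c x (c *: (x : decode X))%R _ _ _ (hP _) (hP _)).
    exact/decode_scale.
  rewrite -hs; apply: (addH (c *: (x : decode X))%R y _ _ _ _ _ (hP _) (hP _) (hP _)).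
  exact/decode_add.
exists (to_hom (mk_linear lh)); apply/seteqP; split=> [_ [x ->]|[s t] Hst]; first exact: hP.
have [/= + /size0nil t0] := Hd _ Hst; rewrite t0 in Hst *.
case: s Hst => [|x [|y [|? ?]]] //= Hst; try by move=> [? []].
move=> [xX [yY _]]; exists (exist _ x xX); congr (_, _); congr [:: _; _].
have : graph_in H (exist _ x xX) (exist _ y yY) by [].
by move=> /hE e; rewrite /ap /= e.
Qed.
End Graph.

Lemma graph_cmp (X Y Z : ocode) (g : @hom (Mod F) (decode Y) (decode Z)) (f : @hom (Mod F) (decode X) (decode Y))
    (h : @hom (Mod F) (decode X) (decode Z)) :
  h = cmp g f <-> forall (x : El (mu (sval X))) (y : El (mu (sval Y))) (z : El (mu (sval Z))),
    graph_in (graph f) x y -> graph_in (graph g) y z -> graph_in (graph h) x z.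
Proof.
split=> [-> x y z /graphP<- /graphP<-|H]; first exact/graphP.
apply: hom_ext => x; apply/graphP; apply: (H x (ap f x)); exact/graphP.
Qed.

Definition Codes : category := @pullback_cat (Mod F) ocode decode.


Lemma iso_cat_iso (M N : lmodule F) (i : iso_to M N) : exists _ : @cat_iso (Mod F) M N, True.
Proof.
unshelve eexists => //; apply: (@CatIso (Mod F) M N (to_hom (iso_fwd i)) (to_hom (iso_bwd i))).
  by apply: hom_ext => x; exact: iso_fwdK.
by apply: hom_ext => x; exact: iso_bwdK.
Qed.

(** The zero of [M] is renamed to a set [u] that includes the carriers of [M] and of all members of
    [s]. As [u] is not an element of itself, it belongs to none of these carriers, so the renaming
    is injective and the new carrier differs from those in [s]. *)
Lemma fresh_cat_iso (M : lmodule F) (s : seq (lmodule F)) :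
  exists N : lmodule F, ~ List.In N s /\ exists _ : @cat_iso (Mod F) N M, True.
Proof.
pose x := lmodule_set M.
have [u uP] : exists u, forall y, List.In y (x :: map (@lmodule_set F) s) ->
    forall z, z ∈ y -> z ∈ u.
  elim: (x :: _) => [|y l [u uP]]; first by exists x.
  have [p pP] := V_pairing y u; have [w wP] := V_union p; exists w => y' [<-|/uP yu] z zy.
    by apply/wP; exists y => //; apply/pP; left.
  by apply/wP; exists u; [apply/pP; right|exact: yu].
pose e (a : El x) : V := if (a : M) == 0%R then u else sval a.
have ux : u ∉ x by move=> /(uP x (or_introl erefl)); exact: elt_irr.
have inj_e : injective e.
  move=> a b; rewrite /e; case: eqP => [a0|_]; case: eqP => [b0|_].
  - by move=> _; exact: (etrans a0 (esym b0)).
  - by move=> ub; case: ux; rewrite ub; exact: (svalP b).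
  - by move=> ua; case: ux; rewrite -ua; exact: (svalP a).
  - exact: sval_inj.
have [A [h hs]] := small_El x; pose y := range_V (e \o h).
have yP z : z ∈ y <-> exists a, z = e a.
  rewrite elt_range_V; split=> [[a ->]|[a ->]]; first by exists (h a).
  by have [b ->] := hs a; exists b.
have ey a : e a ∈ y by apply/yP; exists a.
have [g gP] := choice (fun z : El y => proj1 (yP _) (svalP z)).
have gK : cancel g (fun a => exist _ (e a) (ey a) : El y) by move=> z; apply: sval_inj.
have fK : cancel (fun a => exist _ (e a) (ey a) : El y) g by move=> a; apply: inj_e; rewrite -gP.
exists (@transport F M y g _ gK fK); split; last first.
  by have [i _] := @transport_iso F M y g _ gK fK; exact: iso_cat_iso.
move=> /(List.in_map (@lmodule_set F))/= ys.
apply: (@elt_irr u); apply: (uP y); first by right.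
by apply/yP; exists (0%R : M); rewrite /e eqxx.
Qed.

Lemma card_inj : exists c : nat -> Cn, injective c.
Proof.
have /choice[c cP] n : exists k : Cn, exists f : El k -> 'I_n, bijective f.
  by apply: small_card; apply: small_sub (@ord_inj n) small_nat.
exists c => m n e; have [f bf] := cP m; have [g bg] := cP n; rewrite e in f bf.
have [f' fK f'K] := bf; have := bij_eq_card (bij_comp bg (Bijective f'K fK)).
by rewrite !card_ord.
Qed.

Lemma fresh_nat (T : Type) (c : nat -> T) (s : seq T) : injective c -> exists n, ~ List.In (c n) s.
Proof.
move=> inj_c; suff [n nP] : exists n, forall m, n <= m -> ~ List.In (c m) s.
  by exists n; apply: nP.
elim: s => [|x s [n nP]]; first by exists 0 => m _ [].
have [[m mx]|no] := pselect (exists m, c m = x); last first.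
  by exists n => m nm [e|]; [apply: no; exists m|exact: nP].
exists (maxn n m.+1) => k; rewrite geq_max => /andP[nk mk] [e|]; last exact: nP.
by move: mk; rewrite -(inj_c m k) ?ltnn // mx.
Qed.

(** Only the label has to avoid [s], and there are infinitely many cardinals to choose from. *)
Lemma fresh_code (M : lmodule F) (s : seq ocode) :
  exists t : ocode, ~ List.In t s /\ exists _ : @cat_iso (Mod F) M (decode t), True.
Proof.
have [c inj_c] := card_inj; have [n nP] := fresh_nat (map (lam \o sval) s) inj_c.
have [k [f [g fK gK]]] := small_card (small_El (lmodule_set M)).
pose fM : El k -> M := f; pose gM : M -> El k := g.
have fKM : cancel fM gM by [].
have gKM : cancel gM fM by [].
pose A := [set p : seq V * seq F | exists x y : El k,
  p = ([:: sval x; sval y; sval (gM (fM x + fM y)%R)], [::])].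
pose S := [set p : seq V * seq F | exists (c : F) (x : El k),
  p = ([:: sval x; sval (gM (c *: fM x)%R)], [:: c])].
have Asub : A `<=` rel_dom [:: k; k; k] 0.
  move=> _ [x [y ->]]; split=> //=; split; first exact: (svalP x).
  by split; [exact: (svalP y)|split=> //; exact: (svalP (gM _))].
have Ssub : S `<=` rel_dom [:: k; k] 1.
  by move=> _ [d [x ->]]; split=> //=; split; [exact: (svalP x)|split=> //; exact: (svalP (gM _))].
pose r := @Raw k (c n) A S Asub Ssub.
have adP (x y z : El k) : @ad r x y z <-> gM (fM x + fM y)%R = z.
  split=> [[x' [y' []]]|<-]; last by exists x, y.
  by move=> /sval_inj<- /sval_inj<- /sval_inj.
have scP (d : F) (x y : El k) : @sc r d x y <-> gM (d *: fM x)%R = y.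
  split=> [[d' [x' []]]|<-]; last by exists d, x.
  by move=> /sval_inj<- /sval_inj-> ->.
have mr : is_mod r.
  split; split.
  - by move=> x y; exists (gM (fM x + fM y)%R); apply/adP.
  - by move=> x y z z' /adP<- /adP<-.
  - by move=> x y z u v w /adP<- /adP<- /adP<-; apply/adP; rewrite !gKM addrA.
  - by move=> x y z /adP<-; apply/adP; rewrite addrC.
  - exists (gM 0%R); split=> x; first by apply/adP; rewrite gKM add0r.
    by exists (gM (- fM x)%R); apply/adP; rewrite gKM addNr.
  - by move=> d x; exists (gM (d *: fM x)%R); apply/scP.
  - by move=> d x y y' /scP<- /scP<-.
  - by move=> d d' e x y z -> /scP<- /scP<-; apply/scP; rewrite gKM scalerA.
  - exists 1%R; split=> [d|x]; first by rewrite mul1r.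
    by apply/scP; rewrite scale1r.
  - move=> d x y z x' y' z' /scP<- /scP<- /adP<- /adP<-; apply/scP.
    by rewrite !gKM scalerDr.
  - by move=> d d' e x y z w -> /scP<- /scP<- /adP<-; apply/scP; rewrite !gKM scalerDl.
pose t : ocode := exist _ r mr; exists t; split.
  by move=> /(List.in_map (lam \o sval)).
have lf : linear (fM : decode t -> M).
  move=> d x y; apply: (can_inj gKM); rewrite fKM.
  have h : (d *: x : decode t)%R = gM (d *: fM x)%R by apply/decode_scale/scP.
  rewrite h; have [H _] := @decode_add t (gM (d *: fM x)%R) y (gM (d *: fM x + fM y)%R).
  by apply: H; apply/adP; rewrite gKM.
have lg : linear (gM : M -> decode t).
  by move=> d a b; apply: (can_inj fKM); rewrite lf !gKM.
by apply: iso_cat_iso; exists (mk_linear lg) (mk_linear lf).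
Qed.

Lemma codes_sat p (eo : nat -> obj Codes) em : cat_sentence p ->
  (cat_holds (Mod F) p <-> cat_sat eo em p).
Proof.
apply: back_and_forth; first exact: fresh_code.
by move=> t s; exact: fresh_cat_iso.
Qed.

End Codes.

(** * Definability in L2 *)

Definition fresh (s : seq nat) : nat := (\max_(i <- s) i).+1.

Lemma fresh_notin s : fresh s \notin s.
Proof.
apply/negP => h; have := @leq_bigmax_seq nat s xpredT id (fresh s) h isT.
by rewrite /fresh ltnn.
Qed.

(** Counterpart of [ctx] for L2. Names are listed with their types, not taken from an initial
    segment, because [L2_wf] asks for fresh binders and records the cardinals of elements and
    predicates. *)
Record lctx := LCtx {
  lE : nzRingType -> Type;
  sR : seq nat;
  sK : seq nat;
  sE : seq (nat * nat);
  sP : seq (nat * (seq nat * nat));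
  dR : forall F, lE F -> nat -> F;
  dK : forall F, lE F -> nat -> Cn;
  dE : forall F, lE F -> nat -> V;
  dP : forall F, lE F -> nat -> set (seq V * seq F)
}.
Arguments dR l {F} e n : rename.
Arguments dK l {F} e n : rename.
Arguments dE l {F} e n : rename.
Arguments dP l {F} e n : rename.

Definition L (G : lctx) (Q : forall F, lE G F -> Prop) : Prop :=
  exists2 p, L2_wf (sR G) (sK G) (sE G) (sP G) p &
    forall F (e : lE G F) er ek ee ep,
    {in sR G, er =1 dR G e} -> {in sK G, ek =1 dK G e} ->
    {in unzip1 (sE G), ee =1 dE G e} -> {in unzip1 (sP G), ep =1 dP G e} ->
    (L2_sat er ek ee ep p <-> Q F e).
Arguments L : clear implicits.

(* Cardinal variables are tracked by name, because the type of an element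
   variable or of a predicate variable records the names of its cardinals. *)
Definition isLR (G : lctx) (r : forall F, lE G F -> F) : Prop :=
  exists2 i, i \in sR G & forall F e, dR G e i = r F e.
Definition isLK (G : lctx) (n : nat) (k : forall F, lE G F -> Cn) : Prop :=
  n \in sK G /\ forall F e, dK G e n = k F e.
Definition isLE (G : lctx) (n : nat) (a : forall F, lE G F -> V) : Prop :=
  exists2 i, (i, n) \in sE G & forall F e, dE G e i = a F e.
Definition isLP (G : lctx) (ns : seq nat) (m : nat)
    (P : forall F, lE G F -> set (seq V * seq F)) : Prop :=
  exists2 i, (i, (ns, m)) \in sP G & forall F e, dP G e i = P F e.
Arguments isLR : clear implicits.
Arguments isLK : clear implicits.
Arguments isLE : clear implicits.
Arguments isLP : clear implicits.

Lemma mem_unzip1 (A B : eqType) (a : A) (b : B) s : (a, b) \in s -> a \in unzip1 s.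
Proof. by move=> abs; apply/mapP; exists (a, b). Qed.

Record lsub (G' G : lctx) (r : forall F, lE G' F -> lE G F) : Prop := LSub {
  lsub_sR : {subset sR G <= sR G'};
  lsub_sK : {subset sK G <= sK G'};
  lsub_sE : {subset sE G <= sE G'};
  lsub_sP : {subset sP G <= sP G'};
  lsub_dR : forall F e, {in sR G, dR G' e =1 dR G (r F e)};
  lsub_dK : forall F e, {in sK G, dK G' e =1 dK G (r F e)};
  lsub_dE : forall F e, {in unzip1 (sE G), dE G' e =1 dE G (r F e)};
  lsub_dP : forall F e, {in unzip1 (sP G), dP G' e =1 dP G (r F e)}
}.
Arguments lsub : clear implicits.

Lemma lsub_refl G : lsub G G (fun F e => e).
Proof. by split. Qed.

Lemma sub_unzip1 (A B : eqType) (s t : seq (A * B)) : {subset s <= t} ->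
  {subset unzip1 s <= unzip1 t}.
Proof. by move=> st _ /mapP[[a b] /st abt ->]; exact: mem_unzip1 abt. Qed.

Lemma lsub_trans G3 G2 G1 r2 r1 : lsub G3 G2 r2 -> lsub G2 G1 r1 ->
  lsub G3 G1 (fun F e => r1 F (r2 F e)).
Proof.
move=> [a1 a2 a3 a4 a5 a6 a7 a8] [b1 b2 b3 b4 b5 b6 b7 b8]; split.
- by move=> i /b1/a1.
- by move=> i /b2/a2.
- by move=> i /b3/a3.
- by move=> i /b4/a4.
- by move=> F e i h; rewrite a5 ?b5 //; apply: b1.
- by move=> F e i h; rewrite a6 ?b6 //; apply: b2.
- by move=> F e i h; rewrite a7 ?b7 //; apply: (sub_unzip1 b3).
- by move=> F e i h; rewrite a8 ?b8 //; apply: (sub_unzip1 b4).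
Qed.

Lemma isLR_sub G' G r x : lsub G' G r -> isLR G x -> isLR G' (fun F e => x F (r F e)).
Proof.
by move=> s [i h iP]; exists i; [exact: (lsub_sR s)|move=> F e; rewrite (lsub_dR s)].
Qed.
Lemma isLK_sub G' G r n x : lsub G' G r -> isLK G n x -> isLK G' n (fun F e => x F (r F e)).
Proof.
by move=> s [h iP]; split; [exact: (lsub_sK s)|move=> F e; rewrite (lsub_dK s)].
Qed.
Lemma isLE_sub G' G r n x : lsub G' G r -> isLE G n x -> isLE G' n (fun F e => x F (r F e)).
Proof.
move=> s [i h iP]; exists i; first exact: (lsub_sE s).
by move=> F e; rewrite (lsub_dE s) //; exact: mem_unzip1 h.
Qed.
Lemma isLP_sub G' G r ns m x : lsub G' G r -> isLP G ns m x ->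
  isLP G' ns m (fun F e => x F (r F e)).
Proof.
move=> s [i h iP]; exists i; first exact: (lsub_sP s).
by move=> F e; rewrite (lsub_dP s) //; exact: mem_unzip1 h.
Qed.

Definition lextR (G : lctx) : lctx := {|
  lE F := (lE G F * F)%type;
  sR := fresh (sR G) :: sR G; sK := sK G; sE := sE G; sP := sP G;
  dR F e := [eta dR G e.1 with fresh (sR G) |-> e.2];
  dK F e := dK G e.1; dE F e := dE G e.1; dP F e := dP G e.1 |}.

Definition lextK (G : lctx) : lctx := {|
  lE F := (lE G F * Cn)%type;
  sR := sR G; sK := fresh (sK G) :: sK G; sE := sE G; sP := sP G;
  dR F e := dR G e.1;
  dK F e := [eta dK G e.1 with fresh (sK G) |-> e.2];
  dE F e := dE G e.1; dP F e := dP G e.1 |}.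

Definition lextE (G : lctx) (n : nat) (k : forall F, lE G F -> Cn) : lctx := {|
  lE F := {e : lE G F & El (k F e)};
  sR := sR G; sK := sK G;
  sE := (fresh (unzip1 (sE G)), n) :: sE G; sP := sP G;
  dR F e := dR G (projT1 e); dK F e := dK G (projT1 e);
  dE F e := [eta dE G (projT1 e) with fresh (unzip1 (sE G)) |-> sval (projT2 e)];
  dP F e := dP G (projT1 e) |}.

Definition lextP (G : lctx) (ns : seq nat) (m : nat) (ks : forall F, lE G F -> seq Cn)
    : lctx := {|
  lE F := {e : lE G F & {Q : set (seq V * seq F) | (Q `<=` rel_dom (ks F e) m)%classic}};
  sR := sR G; sK := sK G; sE := sE G;
  sP := (fresh (unzip1 (sP G)), (ns, m)) :: sP G;
  dR F e := dR G (projT1 e); dK F e := dK G (projT1 e); dE F e := dE G (projT1 e);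
  dP F e := [eta dP G (projT1 e) with fresh (unzip1 (sP G)) |-> sval (projT2 e)] |}.

Definition lpull (G : lctx) (E : nzRingType -> Type) (r : forall F, E F -> lE G F) : lctx := {|
  lE := E; sR := sR G; sK := sK G; sE := sE G; sP := sP G;
  dR F e := dR G (r F e); dK F e := dK G (r F e);
  dE F e := dE G (r F e); dP F e := dP G (r F e) |}.

Lemma with_notin (T : Type) (f : nat -> T) (s : seq nat) i x : i \notin s ->
  {in s, [eta f with i |-> x] =1 f}.
Proof. by move=> si j js /=; case: eqP => // ji; move: si; rewrite -ji js. Qed.

Lemma lsub_lextR G : lsub (lextR G) G (fun F e => e.1).
Proof.
split=> //; first by move=> i /=; rewrite inE orbC => ->.
by move=> F e; apply: with_notin; exact: fresh_notin.
Qed.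
Lemma lsub_lextK G : lsub (lextK G) G (fun F e => e.1).
Proof.
split=> //; first by move=> i /=; rewrite inE orbC => ->.
by move=> F e; apply: with_notin; exact: fresh_notin.
Qed.
Lemma lsub_lextE G n k : lsub (@lextE G n k) G (fun F e => projT1 e).
Proof.
split=> //; first by move=> i /=; rewrite inE orbC => ->.
by move=> F e; apply: with_notin; exact: fresh_notin.
Qed.
Lemma lsub_lextP G ns m ks : lsub (@lextP G ns m ks) G (fun F e => projT1 e).
Proof.
split=> //; first by move=> i /=; rewrite inE orbC => ->.
by move=> F e; apply: with_notin; exact: fresh_notin.
Qed.
Lemma lsub_lpull G E r : lsub (@lpull G E r) G r.
Proof. by split. Qed.

Lemma isLR_here G : isLR (lextR G) (fun F e => e.2).
Proof. by exists (fresh (sR G)) => [|F e /=]; rewrite ?mem_head ?eqxx. Qed.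
Lemma isLK_here G : isLK (lextK G) (fresh (sK G)) (fun F e => e.2).
Proof. by split=> [|F e /=]; rewrite ?mem_head ?eqxx. Qed.
Lemma isLE_here G n k : isLE (@lextE G n k) n (fun F e => sval (projT2 e)).
Proof. by exists (fresh (unzip1 (sE G))) => [|F e /=]; rewrite ?mem_head ?eqxx. Qed.
Lemma isLP_here G ns m ks : isLP (@lextP G ns m ks) ns m (fun F e => sval (projT2 e)).
Proof. by exists (fresh (unzip1 (sP G))) => [|F e /=]; rewrite ?mem_head ?eqxx. Qed.

Section Rules.
Variable G : lctx.
Implicit Types (P Q : forall F, lE G F -> Prop).

Lemma L_iff P Q : (forall F e, P F e <-> Q F e) -> L G P -> L G Q.
Proof. by move=> PQ [p wp pP]; exists p => // F e *; rewrite -PQ; exact: pP. Qed.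

Lemma L_not P : L G P -> L G (fun F e => ~ P F e).
Proof.
by move=> [p wp pP]; exists (LNot p) => // F e er ek ee ep hr hk he hp /=; rewrite (pP F e).
Qed.
Lemma L_and P Q : L G P -> L G Q -> L G (fun F e => P F e /\ Q F e).
Proof.
move=> [p wp pP] [q wq qQ]; exists (LAnd p q) => [|F e er ek ee ep hr hk he hp] /=.
  by rewrite wp wq.
by rewrite (pP F e) // (qQ F e).
Qed.
Lemma L_imp P Q : L G P -> L G Q -> L G (fun F e => P F e -> Q F e).
Proof.
move=> [p wp pP] [q wq qQ]; exists (LImp p q) => [|F e er ek ee ep hr hk he hp] /=.
  by rewrite wp wq.
by rewrite (pP F e) // (qQ F e).
Qed.

Lemma L_exR (Q : forall F, lE G F -> F -> Prop) :
  L (lextR G) (fun F e => Q F e.1 e.2) -> L G (fun F e => exists x, Q F e x).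
Proof.
move=> [p wp pP]; exists (LExR (fresh (sR G)) p) => [|F e er ek ee ep hr hk he hp] /=.
  by rewrite fresh_notin.
apply: exists_iff => x; apply: (pP F (e, x)) => //=; exact: with_in.
Qed.

Lemma L_exK (Q : forall F, lE G F -> Cn -> Prop) :
  L (lextK G) (fun F e => Q F e.1 e.2) -> L G (fun F e => exists x, Q F e x).
Proof.
move=> [p wp pP]; exists (LExC (fresh (sK G)) p) => [|F e er ek ee ep hr hk he hp] /=.
  by rewrite fresh_notin.
apply: exists_iff => x; apply: (pP F (e, x)) => //=; exact: with_in.
Qed.

Lemma L_exE n (k : forall F, lE G F -> Cn) (Q : forall F (e : lE G F), El (k F e) -> Prop) : isLK G n k ->
  L (lextE n k) (fun F e => Q F (projT1 e) (projT2 e)) ->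
  L G (fun F e => exists x, Q F e x).
Proof.
move=> [kn kE] [p wp pP]; set a := fresh (unzip1 (sE G)).
exists (LExE a n p) => [|F e er ek ee ep hr hk he hp] /=.
  by rewrite fresh_notin kn.
rewrite hk // kE; have H (x : El (k F e)) : L2_sat er ek [eta ee with a |-> sval x] ep p <-> Q F e x.
  by apply: (pP F (existT _ e x)) => //=; exact: with_in.
split=> [[x xk px]|[x /H]]; last by exists (sval x) => //; exact: (svalP x).
by exists (exist _ x xk); apply/H.
Qed.

Lemma L_exP ns m (ks : forall F, lE G F -> seq Cn) (Q : forall F (e : lE G F),
    {R : set (seq V * seq F) | (R `<=` rel_dom (ks F e) m)%classic} -> Prop) :
  {subset ns <= sK G} -> (forall F e, map (dK G e) ns = ks F e) ->
  L (lextP ns m ks) (fun F e => Q F (projT1 e) (projT2 e)) ->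
  L G (fun F e => exists R, Q F e R).
Proof.
move=> kn kE [p wp pP]; set a := fresh (unzip1 (sP G)).
exists (LExP a ns m p) => [|F e er ek ee ep hr hk he hp] /=.
  by rewrite fresh_notin wp andbT /=; apply/allP.
have -> : map ek ns = ks F e by rewrite -kE; apply/eq_in_map => i /kn; exact: hk.
have H (x : {R : set (seq V * seq F) | (R `<=` rel_dom (ks F e) m)%classic}) :
    L2_sat er ek ee [eta ep with a |-> sval x] p <-> Q F e x.
  by apply: (pP F (existT _ e x)) => //=; exact: with_in.
split=> [[x xk px]|[x /H]]; last by exists (sval x) => //; exact: (svalP x).
by exists (exist _ x xk); apply/H.
Qed.

(** Counterpart of [D_guard], the condition being membership in the image of [r]: raw data form a
    code, or a relation a morphism, when they come from one. *)
Lemma L_guard (E : nzRingType -> Type) (r : forall F, E F -> lE G F)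
    (Q : forall F, E F -> Prop) :
  L G (fun F e => exists h, r F h = e) -> L (lpull r) Q ->
  L G (fun F e => exists2 h, r F h = e & Q F h).
Proof.
move=> [p wp pP] [q wq qQ]; exists (LAnd p q) => [|F e er ek ee ep hr hk he hp] /=.
  by rewrite wp wq.
have H h : r F h = e -> (L2_sat er ek ee ep q <-> Q F h) by move=> rh; apply: qQ => //=; rewrite rh.
rewrite (pP F e) //; split=> [[[h rh] /(H h rh) Qh]|[h rh Qh]]; first by exists h.
by split; [exists h|apply/(H h rh)].
Qed.

Lemma L_add x y z : isLR G x -> isLR G y -> isLR G z ->
  L G (fun F e => x F e = (y F e + z F e)%R).
Proof.
move=> [a ai aP] [b bi bP] [c ci cP]; exists (LAdd a b c) => [|F e er ek ee ep hr *] /=.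
  by rewrite ai bi ci.
by rewrite !hr // aP bP cP.
Qed.
Lemma L_mul x y z : isLR G x -> isLR G y -> isLR G z ->
  L G (fun F e => x F e = (y F e * z F e)%R).
Proof.
move=> [a ai aP] [b bi bP] [c ci cP]; exists (LMul a b c) => [|F e er ek ee ep hr *] /=.
  by rewrite ai bi ci.
by rewrite !hr // aP bP cP.
Qed.
Lemma L_eqK n m k l : isLK G n k -> isLK G m l -> L G (fun F e => k F e = l F e).
Proof.
move=> [ai aP] [bi bP]; exists (LEqC n m) => [|F e er ek ee ep _ hk *] /=.
  by rewrite ai bi.
by rewrite !hk // aP bP.
Qed.
Lemma L_eqE n m x y : isLE G n x -> isLE G m y -> L G (fun F e => x F e = y F e).
Proof.
move=> [a ai aP] [b bi bP]; exists (LEqE a b) => [|F e er ek ee ep _ _ he _] /=.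
  by rewrite (mem_unzip1 ai) (mem_unzip1 bi).
by rewrite !he ?(mem_unzip1 ai) ?(mem_unzip1 bi) // aP bP.
Qed.

Lemma L_rel2 n1 n2 H x y : isLP G [:: n1; n2] 0 H -> isLE G n1 x -> isLE G n2 y ->
  L G (fun F e => H F e ([:: x F e; y F e], [::])).
Proof.
move=> [i ip iP] [a ai aP] [b bi bP].
exists (LPred i [:: a; b] [::]) => [|F e er ek ee ep _ _ he hp] /=.
  by apply/hasP; exists (i, ([:: n1; n2], 0)); rewrite //= !eqxx ai bi.
by rewrite hp ?(mem_unzip1 ip) // !he ?(mem_unzip1 ai) ?(mem_unzip1 bi) // aP bP iP.
Qed.
Lemma L_rel2r n1 n2 H x y c : isLP G [:: n1; n2] 1 H -> isLE G n1 x -> isLE G n2 y ->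
  isLR G c -> L G (fun F e => H F e ([:: x F e; y F e], [:: c F e])).
Proof.
move=> [i ip iP] [a ai aP] [b bi bP] [d di dP].
exists (LPred i [:: a; b] [:: d]) => [|F e er ek ee ep hr _ he hp] /=.
  by rewrite di /=; apply/hasP; exists (i, ([:: n1; n2], 1)); rewrite //= !eqxx ai bi.
by rewrite hp ?(mem_unzip1 ip) // !he ?(mem_unzip1 ai) ?(mem_unzip1 bi) // hr // aP bP iP dP.
Qed.
Lemma L_rel3 n1 n2 n3 H x y z : isLP G [:: n1; n2; n3] 0 H ->
  isLE G n1 x -> isLE G n2 y -> isLE G n3 z ->
  L G (fun F e => H F e ([:: x F e; y F e; z F e], [::])).
Proof.
move=> [i ip iP] [a ai aP] [b bi bP] [c ci cP].
exists (LPred i [:: a; b; c] [::]) => [|F e er ek ee ep _ _ he hp] /=.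
  by apply/hasP; exists (i, ([:: n1; n2; n3], 0)); rewrite //= !eqxx ai bi ci.
rewrite hp ?(mem_unzip1 ip) // !he ?(mem_unzip1 ai) ?(mem_unzip1 bi) ?(mem_unzip1 ci) //.
by rewrite aP bP cP iP.
Qed.
End Rules.

Section Rules2.
Variable G : lctx.

Lemma L_allR (Q : forall F, lE G F -> F -> Prop) :
  L (lextR G) (fun F e => Q F e.1 e.2) -> L G (fun F e => forall x, Q F e x).
Proof.
move=> /L_not LQ; apply: (L_iff _ (L_not (L_exR (Q := fun F e x => ~ Q F e x) LQ))) => F e.
split=> [nQ x|aQ [x]//]; apply: contrapT => nx; apply: nQ; by exists x.
Qed.

Lemma L_allE n (k : forall F, lE G F -> Cn) (Q : forall F (e : lE G F), El (k F e) -> Prop) : isLK G n k ->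
  L (lextE n k) (fun F e => Q F (projT1 e) (projT2 e)) ->
  L G (fun F e => forall x, Q F e x).
Proof.
move=> ik /L_not LQ; apply: (L_iff _ (L_not (L_exE (Q := fun F e x => ~ Q F e x) ik LQ))) => F e.
split=> [nQ x|aQ [x]//]; apply: contrapT => nx; apply: nQ; by exists x.
Qed.
End Rules2.

Ltac mk_lsub G' G :=
  lazymatch G' with
  | G => constr:(lsub_refl G)
  | lextR ?H => let s := mk_lsub H G in constr:(lsub_trans (lsub_lextR H) s)
  | lextK ?H => let s := mk_lsub H G in constr:(lsub_trans (lsub_lextK H) s)
  | @lextE ?H ?n ?k => let s := mk_lsub H G in constr:(lsub_trans (@lsub_lextE H n k) s)
  | @lextP ?H ?n ?m ?k => let s := mk_lsub H G in constr:(lsub_trans (@lsub_lextP H n m k) s)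
  | @lpull ?H ?E ?r => let s := mk_lsub H G in constr:(lsub_trans (@lsub_lpull H E r) s)
  end.

Ltac lvar_here G' G :=
  lazymatch G with
  | lextR ?H => first [let s := mk_lsub G' G in exact (isLR_sub s (isLR_here H)) | lvar_here G' H]
  | lextK ?H => first [let s := mk_lsub G' G in exact (isLK_sub s (isLK_here H)) | lvar_here G' H]
  | @lextE ?H ?n ?k =>
      first [let s := mk_lsub G' G in exact (isLE_sub s (@isLE_here H n k)) | lvar_here G' H]
  | @lextP ?H ?n ?m ?k =>
      first [let s := mk_lsub G' G in exact (isLP_sub s (@isLP_here H n m k)) | lvar_here G' H]
  | @lpull ?H ?E ?r => lvar_here G' H
  end.

Ltac lvar_hyp G' :=
  match goal with
  | H : isLR ?G _ |- isLR _ _ => let s := mk_lsub G' G in exact (isLR_sub s H)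
  | H : isLK ?G _ _ |- isLK _ _ _ => let s := mk_lsub G' G in exact (isLK_sub s H)
  | H : isLE ?G _ _ |- isLE _ _ _ => let s := mk_lsub G' G in exact (isLE_sub s H)
  | H : isLP ?G _ _ _ |- isLP _ _ _ _ => let s := mk_lsub G' G in exact (isLP_sub s H)
  end.

Ltac lvar :=
  lazymatch goal with
  | |- isLR ?G' _ => first [lvar_here G' G' | lvar_hyp G']
  | |- isLK ?G' _ _ => first [lvar_here G' G' | lvar_hyp G']
  | |- isLE ?G' _ _ => first [lvar_here G' G' | lvar_hyp G']
  | |- isLP ?G' _ _ _ => first [lvar_here G' G' | lvar_hyp G']
  end.

(** * Defining satisfaction of categorical formulas in L2 *)

Definition isRaw (G : lctx) (m l : nat) (X : forall F, lE G F -> raw F) : Prop :=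
  [/\ isLK G m (fun F e => mu (X F e)), isLK G l (fun F e => lam (X F e)),
      isLP G [:: m; m; m] 0 (fun F e => radd (X F e))
    & isLP G [:: m; m] 1 (fun F e => rscale (X F e))].
Arguments isRaw : clear implicits.

Lemma isRaw_sub G' G r m l X : lsub G' G r -> isRaw G m l X ->
  isRaw G' m l (fun F e => X F (r F e)).
Proof.
move=> s [k1 k2 p1 p2]; split; first exact: (isLK_sub s k1).
- exact: (isLK_sub s k2).
- exact: (isLP_sub s p1).
exact: (isLP_sub s p2).
Qed.

Ltac lvar ::=
  lazymatch goal with
  | |- isLR ?G' _ => first [lvar_here G' G' | lvar_hyp G']
  | |- isLK ?G' _ _ => first [lvar_here G' G' | lvar_hyp G']
  | |- isLE ?G' _ _ => first [lvar_here G' G' | lvar_hyp G']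
  | |- isLP ?G' _ _ _ => first [lvar_here G' G' | lvar_hyp G']
  | |- isRaw ?G' _ _ _ => match goal with
    | H : isRaw ?G _ _ _ |- _ => let s := mk_lsub G' G in exact (isRaw_sub s H) end
  end.

Section Raw.
Variables (G : lctx) (m l : nat) (X : forall F, lE G F -> raw F).
Arguments X : clear implicits.
Hypothesis iX : isRaw G m l X.

Lemma L_ad (x y z : forall F e, El (mu (X F e))) :
  isLE G m (fun F e => sval (x F e)) -> isLE G m (fun F e => sval (y F e)) ->
  isLE G m (fun F e => sval (z F e)) -> L G (fun F e => ad (x F e) (y F e) (z F e)).
Proof. by case: iX => _ _ iA _; exact: (L_rel3 iA). Qed.

Lemma L_sc (c : forall F, lE G F -> F) (x y : forall F e, El (mu (X F e))) :
  isLR G c -> isLE G m (fun F e => sval (x F e)) -> isLE G m (fun F e => sval (y F e)) ->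
  L G (fun F e => sc (c F e) (x F e) (y F e)).
Proof. by case: iX => _ _ _ iS ic ix iy; exact: (L_rel2r iS ix iy ic). Qed.
End Raw.

Ltac lquant := first [apply: L_allE; first lvar | apply: L_allR].
Ltac lad := apply: L_ad; lvar.
Ltac lsc := apply: L_sc; lvar.
Ltac latom := first [by lad | by lsc | by apply: L_eqE; lvar | by apply: L_add; lvar
  | by apply: L_mul; lvar].
Ltac lmatrix := repeat lquant; repeat (apply: L_imp; first latom); latom.

Section ModuleLaws.
Variables (G : lctx) (m l : nat) (X : forall F, lE G F -> raw F).
Arguments X : clear implicits.
Hypothesis iX : isRaw G m l X.
Let iM : isLK G m (fun F e => mu (X F e)). Proof. by case: iX. Qed.

Lemma L_ad_ax : L G (fun F e => ad_ax (X F e)).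
Proof.
apply: (@L_iff _ (fun F e => 
  (forall x y : El (mu (X F e)), exists z, ad x y z) /\
  (forall x y z z' : El (mu (X F e)), ad x y z -> ad x y z' -> sval z = sval z') /\
  (forall x y z u v w : El (mu (X F e)), ad x y u -> ad u z w -> ad y z v -> ad x v w) /\
  (forall x y z : El (mu (X F e)), ad x y z -> ad y x z) /\
  (exists o : El (mu (X F e)), (forall x, ad o x x) /\ forall x, exists y, ad y x o))).
  by move=> F e; split=> [[? [? [? []]]]|[]].
apply: L_and.
  by do 2!lquant; apply: L_exE; [lvar|lad].
apply: L_and; first by lmatrix.
apply: L_and; first by lmatrix.
apply: L_and; first by lmatrix.
apply: L_exE; first lvar.
apply: L_and; first by lquant; lad.
by lquant; apply: L_exE; [lvar|lad].
Qed.

Lemma L_sc_ax : L G (fun F e => sc_ax (X F e)).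
Proof.
apply: (@L_iff _ (fun F e => 
  (forall c (x : El (mu (X F e))), exists y, sc c x y) /\
  (forall c (x y y' : El (mu (X F e))), sc c x y -> sc c x y' -> sval y = sval y') /\
  (forall c d a (x y z : El (mu (X F e))), a = (c * d)%R -> sc d x y -> sc c y z -> sc a x z) /\
  (exists a : F, (forall c, c = (a * c)%R) /\ forall x : El (mu (X F e)), sc a x x))).
  by move=> F e; split=> [[? [? []]]|[]].
apply: L_and.
  by do 2!lquant; apply: L_exE; [lvar|lsc].
apply: L_and; first by lmatrix.
apply: L_and; first by lmatrix.
apply: L_exR; apply: L_and; first by lmatrix.
by lquant; lsc.
Qed.

Lemma L_distr_ax : L G (fun F e => distr_ax (X F e)).
Proof. by apply: L_and; lmatrix. Qed.

Lemma L_is_mod : L G (fun F e => is_mod (X F e)).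
Proof.
apply: (@L_iff _ (fun F e => ad_ax (X F e) /\ sc_ax (X F e) /\ distr_ax (X F e))).
  by move=> F e; split=> [[? []]|[]].
by apply: L_and; [exact: L_ad_ax|apply: L_and; [exact: L_sc_ax|exact: L_distr_ax]].
Qed.
End ModuleLaws.


Section Graph.
Variables (G : lctx) (m n : nat) (X Y : forall F, lE G F -> ocode F).
Variable H : forall F, lE G F -> set (seq V * seq F).
Arguments X : clear implicits.
Arguments Y : clear implicits.
Arguments H : clear implicits.
Hypothesis iH : isLP G [:: m; n] 0 H.

Lemma L_graph (x : forall F e, El (mu (sval (X F e)))) (y : forall F e, El (mu (sval (Y F e)))) :
  isLE G m (fun F e => sval (x F e)) -> isLE G n (fun F e => sval (y F e)) ->
  L G (fun F e => graph_in (H F e) (x F e) (y F e)).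
Proof. exact: (L_rel2 iH). Qed.
End Graph.

Ltac lgraph := apply: L_graph; lvar.

Section Hom.
Variables (G : lctx) (m l n k : nat) (X Y : forall F, lE G F -> ocode F).
Variable H : forall F, lE G F -> set (seq V * seq F).
Arguments X : clear implicits.
Arguments Y : clear implicits.
Arguments H : clear implicits.
Hypotheses (iX : isRaw G m l (fun F e => sval (X F e)))
  (iY : isRaw G n k (fun F e => sval (Y F e))) (iH : isLP G [:: m; n] 0 H).
Let iM : isLK G m (fun F e => mu (sval (X F e))). Proof. by case: iX. Qed.
Let iN : isLK G n (fun F e => mu (sval (Y F e))). Proof. by case: iY. Qed.

Lemma L_is_hom : L G (fun F e => @is_hom F (X F e) (Y F e) (H F e)).
Proof.
apply: (@L_iff _ (fun F e =>
  (forall x : El (mu (sval (X F e))), exists y : El (mu (sval (Y F e))), graph_in (H F e) x y) /\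
  (forall (x : El (mu (sval (X F e)))) (y y' : El (mu (sval (Y F e)))),
    graph_in (H F e) x y -> graph_in (H F e) x y' -> sval y = sval y') /\
  (forall (x y z : El (mu (sval (X F e)))) (x' y' z' : El (mu (sval (Y F e)))), ad x y z ->
    graph_in (H F e) x x' -> graph_in (H F e) y y' -> graph_in (H F e) z z' -> ad x' y' z') /\
  (forall (c : F) (x y : El (mu (sval (X F e)))) (x' y' : El (mu (sval (Y F e)))), sc c x y ->
    graph_in (H F e) x x' -> graph_in (H F e) y y' -> sc c x' y'))).
  by move=> F e; split=> [[? [? []]]|[]].
apply: L_and; first by lquant; apply: L_exE; [lvar|lgraph].
apply: L_and.
  by do 3!lquant; do 2!(apply: L_imp; first by lgraph); latom.
apply: L_and.
  by do 6!lquant; apply: L_imp; [latom|do 3!(apply: L_imp; first by lgraph); latom].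
by do 5!lquant; apply: L_imp; [latom|do 2!(apply: L_imp; first by lgraph); latom].
Qed.
End Hom.

(** By [radd_sub] and [rscale_sub] only tuples of elements of the carriers matter, so typed element
    quantifiers suffice. The paired variables [x] and [x'] replace a transport along
    [mu X = mu Y]. *)
Lemma raw_eqP F (X Y : raw F) : X = Y <->
  [/\ mu X = mu Y, lam X = lam Y,
    forall (x y z : El (mu X)) (x' y' z' : El (mu Y)), sval x = sval x' -> sval y = sval y' ->
      sval z = sval z' -> (ad x y z -> ad x' y' z') /\ (ad x' y' z' -> ad x y z)
  & forall (c : F) (x y : El (mu X)) (x' y' : El (mu Y)), sval x = sval x' -> sval y = sval y' ->
      (sc c x y -> sc c x' y') /\ (sc c x' y' -> sc c x y)].
Proof.
split=> [<-|[]].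
  by split=> // [x y z x' y' z' /sval_inj<- /sval_inj<- /sval_inj<-|c x y x' y' /sval_inj<- /sval_inj<-].
case: X Y => [m l a s ha hs] [m' l' a' s' ha' hs'] /= em el hadd hsc; subst m' l'.
apply: raw_eq => //=.
- apply/seteqP; split=> -[ss rs] h.
    have [/= + /size0nil r0] := ha _ h; rewrite r0 in h *.
    case: ss h => [|x [|y [|z [|? ?]]]] //= h; try (by move=> [? []]); try (by move=> [? [? []]]).
    move=> [xm [ym [zm _]]].
    by have [+ _] := hadd (exist _ x xm) (exist _ y ym) (exist _ z zm)
      (exist _ x xm) (exist _ y ym) (exist _ z zm) erefl erefl erefl; apply.
  have [/= + /size0nil r0] := ha' _ h; rewrite r0 in h *.
  case: ss h => [|x [|y [|z [|? ?]]]] //= h; try (by move=> [? []]); try (by move=> [? [? []]]).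
  move=> [xm [ym [zm _]]].
  by have [_ +] := hadd (exist _ x xm) (exist _ y ym) (exist _ z zm)
      (exist _ x xm) (exist _ y ym) (exist _ z zm) erefl erefl erefl; apply.
apply/seteqP; split=> -[ss [|c [|? ?]]] h.
- by have [] := hs _ h.
- have [/= + _] := hs _ h.
  case: ss h => [|x [|y [|? ?]]] //= h; try (by move=> [? []]).
  move=> [xm [ym _]].
  by have [+ _] := hsc c (exist _ x xm) (exist _ y ym)
      (exist _ x xm) (exist _ y ym) erefl erefl; apply.
- by have [] := hs _ h.
- by have [] := hs' _ h.
- have [/= + _] := hs' _ h.
  case: ss h => [|x [|y [|? ?]]] //= h; try (by move=> [? []]).
  move=> [xm [ym _]].
  by have [_ +] := hsc c (exist _ x xm) (exist _ y ym)
      (exist _ x xm) (exist _ y ym) erefl erefl; apply.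
by have [] := hs' _ h.
Qed.

Section RawEq.
Variables (G : lctx) (m l n k : nat) (X Y : forall F, lE G F -> raw F).
Arguments X : clear implicits.
Arguments Y : clear implicits.
Hypotheses (iX : isRaw G m l X) (iY : isRaw G n k Y).
Let iM : isLK G m (fun F e => mu (X F e)). Proof. by case: iX. Qed.
Let iN : isLK G n (fun F e => mu (Y F e)). Proof. by case: iY. Qed.
Let iL : isLK G l (fun F e => lam (X F e)). Proof. by case: iX. Qed.
Let iK : isLK G k (fun F e => lam (Y F e)). Proof. by case: iY. Qed.

Lemma L_raw_eq : L G (fun F e => X F e = Y F e).
Proof.
apply: (@L_iff _ (fun F e => mu (X F e) = mu (Y F e) /\ lam (X F e) = lam (Y F e) /\
  (forall (x y z : El (mu (X F e))) (x' y' z' : El (mu (Y F e))), sval x = sval x' ->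
    sval y = sval y' -> sval z = sval z' -> (ad x y z -> ad x' y' z') /\ (ad x' y' z' -> ad x y z)) /\
  (forall (c : F) (x y : El (mu (X F e))) (x' y' : El (mu (Y F e))), sval x = sval x' ->
    sval y = sval y' -> (sc c x y -> sc c x' y') /\ (sc c x' y' -> sc c x y)))).
  by move=> F e; rewrite raw_eqP; split=> [[? [? []]]|[]].
apply: L_and; first by apply: L_eqK; lvar.
apply: L_and; first by apply: L_eqK; lvar.
apply: L_and.
  by do 6!lquant; do 3!(apply: L_imp; first latom); apply: L_and; apply: L_imp; latom.
by do 5!lquant; do 2!(apply: L_imp; first latom); apply: L_and; apply: L_imp; latom.
Qed.
End RawEq.


(** * Morphisms of codes through their graphs *)

Notation Mo F := (morphism (Codes F)).

Definition msrc F (f : Mo F) : ocode F := dom f.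
Definition mtgt F (f : Mo F) : ocode F := cod f.
Definition mgraph F (f : Mo F) : set (seq V * seq F) := @graph F (msrc f) (mtgt f) (arrow f).
Definition at_pt F (f : Mo F) (x : El (mu (sval (msrc f)))) (y : El (mu (sval (mtgt f)))) : Prop :=
  graph_in (mgraph f) x y.

(** Both graphs are total and functional, so one implication between them is enough. *)
Lemma mo_eqP F (f g : Mo F) : f = g <-> [/\ sval (msrc f) = sval (msrc g),
  sval (mtgt f) = sval (mtgt g) &
  forall (x : El (mu (sval (msrc f)))) (x' : El (mu (sval (msrc g))))
    (y : El (mu (sval (mtgt f)))) (y' : El (mu (sval (mtgt g)))),
    sval x = sval x' -> sval y = sval y' -> at_pt x y -> at_pt x' y'].
Proof.
split=> [<-|[]]; first by split=> // x x' y y' /sval_inj<- /sval_inj<-.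
case: f g => X Y f [X' Y' g]; rewrite /msrc /mtgt /= => /sval_inj eX /sval_inj eY; subst X' Y'.
move=> h; congr Morphism; apply: hom_ext => x; apply/esym/graphP.
by apply: (h x x (ap f x) (ap f x) erefl erefl); apply/graphP.
Qed.

Lemma mo_idP F (f : Mo F) (X : ocode F) : f = Morphism (idm (X : obj (Codes F))) <->
  [/\ sval (msrc f) = sval X, sval (mtgt f) = sval X &
  forall (x : El (mu (sval (msrc f)))) (y : El (mu (sval (mtgt f)))), sval x = sval y -> at_pt x y].
Proof.
split=> [->|[]].
  by split=> // x y /sval_inj<-; exact/graphP.
case: f => Y Z f; rewrite /msrc /mtgt /= => /sval_inj eX /sval_inj eY; subst Y Z.
by move=> h; congr Morphism; apply: hom_ext => x; apply/graphP; exact: (h x x).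
Qed.

Lemma mo_cmpP F (h f g : Mo F) : (exists (X Y Z : obj (Codes F)) (u : hom Y Z) (v : hom X Y),
    [/\ f = Morphism u, g = Morphism v & h = Morphism (cmp u v)]) <->
  [/\ sval (mtgt g) = sval (msrc f), sval (msrc h) = sval (msrc g), sval (mtgt h) = sval (mtgt f) &
  forall (x : El (mu (sval (msrc g)))) (y : El (mu (sval (mtgt g)))) (y' : El (mu (sval (msrc f))))
    (z : El (mu (sval (mtgt f)))) (x' : El (mu (sval (msrc h)))) (z' : El (mu (sval (mtgt h)))),
    sval x = sval x' -> sval y = sval y' -> sval z = sval z' ->
    at_pt x y -> at_pt y' z -> at_pt x' z'].
Proof.
split=> [[X [Y [Z [u [v [-> -> ->]]]]]]|[]].
  split=> // x y y' z x' z' /sval_inj<- /sval_inj<- /sval_inj<-.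
  by move: x y z; apply/(@graph_cmp F X Y Z).
case: f g h => Y Z f [X Y' g] [X' Z' h]; rewrite /msrc /mtgt /=.
move=> /sval_inj eY /sval_inj eX /sval_inj eZ; subst Y' X' Z' => H.
exists X, Y, Z, f, g; split=> //; congr Morphism.
apply/(@graph_cmp F X Y Z) => x y z xy yz; exact: (H x y y z x z).
Qed.

Definition isMo (G : lctx) (m l n k : nat) (f : forall F, lE G F -> Mo F) : Prop :=
  [/\ isRaw G m l (fun F e => sval (msrc (f F e))), isRaw G n k (fun F e => sval (mtgt (f F e)))
    & isLP G [:: m; n] 0 (fun F e => mgraph (f F e))].
Arguments isMo : clear implicits.

Lemma isMo_sub G' G r m l n k f : lsub G' G r -> isMo G m l n k f ->
  isMo G' m l n k (fun F e => f F (r F e)).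
Proof.
move=> s [r1 r2 p]; split; first exact: (isRaw_sub s r1).
- exact: (isRaw_sub s r2).
exact: (isLP_sub s p).
Qed.

Ltac lvar ::=
  lazymatch goal with
  | |- isLR ?G' _ => first [lvar_here G' G' | lvar_hyp G']
  | |- isLK ?G' _ _ => first [lvar_here G' G' | lvar_hyp G']
  | |- isLE ?G' _ _ => first [lvar_here G' G' | lvar_hyp G']
  | |- isLP ?G' _ _ _ => first [lvar_here G' G' | lvar_hyp G']
  | |- isRaw ?G' _ _ _ => match goal with
    | H : isRaw ?G _ _ _ |- _ => let s := mk_lsub G' G in exact (isRaw_sub s H) end
  | |- isMo ?G' _ _ _ _ _ => match goal with
    | H : isMo ?G _ _ _ _ _ |- _ => let s := mk_lsub G' G in exact (isMo_sub s H) end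
  end.

Lemma L_at G m l n k (f : forall F, lE G F -> Mo F)
    (x : forall F e, El (mu (sval (msrc (f F e))))) (y : forall F e, El (mu (sval (mtgt (f F e))))) :
  isMo G m l n k f -> isLE G m (fun F e => sval (x F e)) -> isLE G n (fun F e => sval (y F e)) ->
  L G (fun F e => at_pt (x F e) (y F e)).
Proof. by case=> _ _ iH; exact: (L_rel2 iH). Qed.

Ltac lat := apply: L_at; lvar.

Section Atoms.
Variable G : lctx.

Lemma L_mo_eq m l n k m' l' n' k' (f g : forall F, lE G F -> Mo F) :
  isMo G m l n k f -> isMo G m' l' n' k' g -> L G (fun F e => f F e = g F e).
Proof.
move=> iF iG; have [iFs iFt _] := iF; have [iGs iGt _] := iG.
have [k1 _ _ _] := iFs; have [k2 _ _ _] := iFt; have [k3 _ _ _] := iGs; have [k4 _ _ _] := iGt.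
apply: (@L_iff _ (fun F e => sval (msrc (f F e)) = sval (msrc (g F e)) /\
  sval (mtgt (f F e)) = sval (mtgt (g F e)) /\
  forall (x : El (mu (sval (msrc (f F e))))) (x' : El (mu (sval (msrc (g F e)))))
    (y : El (mu (sval (mtgt (f F e))))) (y' : El (mu (sval (mtgt (g F e))))),
    sval x = sval x' -> sval y = sval y' -> at_pt x y -> at_pt x' y')).
  by move=> F e; rewrite mo_eqP; split=> [[? []]|[]].
apply: L_and; first exact: (L_raw_eq iFs iGs).
apply: L_and; first exact: (L_raw_eq iFt iGt).
by do 4!lquant; do 2!(apply: L_imp; first latom); apply: L_imp; lat.
Qed.

Lemma L_mo_id m l n k a b (f : forall F, lE G F -> Mo F) (X : forall F, lE G F -> ocode F) :
  isMo G m l n k f -> isRaw G a b (fun F e => sval (X F e)) ->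
  L G (fun F e => f F e = Morphism (idm (X F e : obj (Codes F)))).
Proof.
move=> iF iX; have [iFs iFt _] := iF; have [k1 _ _ _] := iFs; have [k2 _ _ _] := iFt.
apply: (@L_iff _ (fun F e => sval (msrc (f F e)) = sval (X F e) /\
  sval (mtgt (f F e)) = sval (X F e) /\
  forall (x : El (mu (sval (msrc (f F e))))) (y : El (mu (sval (mtgt (f F e))))),
    sval x = sval y -> at_pt x y)).
  by move=> F e; rewrite mo_idP; split=> [[? []]|[]].
apply: L_and; first exact: (L_raw_eq iFs iX).
apply: L_and; first exact: (L_raw_eq iFt iX).
by do 2!lquant; apply: L_imp; [latom|lat].
Qed.

Lemma L_mo_cmp m l n k m' l' n' k' m'' l'' n'' k'' (h f g : forall F, lE G F -> Mo F) :
  isMo G m l n k h -> isMo G m' l' n' k' f -> isMo G m'' l'' n'' k'' g ->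
  L G (fun F e => exists (X Y Z : obj (Codes F)) (u : hom Y Z) (v : hom X Y),
    [/\ f F e = Morphism u, g F e = Morphism v & h F e = Morphism (cmp u v)]).
Proof.
move=> iH iF iG; have [iFs iFt _] := iF; have [iGs iGt _] := iG; have [iHs iHt _] := iH.
have [k1 _ _ _] := iFs; have [k2 _ _ _] := iFt; have [k3 _ _ _] := iGs; have [k4 _ _ _] := iGt.
have [k5 _ _ _] := iHs; have [k6 _ _ _] := iHt.
apply: (@L_iff _ (fun F e => sval (mtgt (g F e)) = sval (msrc (f F e)) /\
  sval (msrc (h F e)) = sval (msrc (g F e)) /\ sval (mtgt (h F e)) = sval (mtgt (f F e)) /\
  forall (x : El (mu (sval (msrc (g F e))))) (y : El (mu (sval (mtgt (g F e)))))
    (y' : El (mu (sval (msrc (f F e))))) (z : El (mu (sval (mtgt (f F e)))))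
    (x' : El (mu (sval (msrc (h F e))))) (z' : El (mu (sval (mtgt (h F e))))),
    sval x = sval x' -> sval y = sval y' -> sval z = sval z' ->
    at_pt x y -> at_pt y' z -> at_pt x' z')).
  by move=> F e; rewrite mo_cmpP; split=> [[? [? []]]|[]].
apply: L_and; first exact: (L_raw_eq iGt iFs).
apply: L_and; first exact: (L_raw_eq iHs iGs).
apply: L_and; first exact: (L_raw_eq iHt iFt).
by do 6!lquant; do 3!(apply: L_imp; first latom); do 2!(apply: L_imp; first by lat); lat.
Qed.
End Atoms.

Section ExtOb.
Variable G : lctx.
Local Notation G2 := (lextK (lextK G)).
Definition ob_mu : nat := fresh (sK G).
Definition ob_lam : nat := fresh (sK (lextK G)).
Local Notation G3 := (@lextP G2 [:: ob_mu; ob_mu; ob_mu] 0 (fun F e => [:: e.1.2; e.1.2; e.1.2])).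
Local Notation G4 := (@lextP G3 [:: ob_mu; ob_mu] 1 (fun F e => [:: (projT1 e).1.2; (projT1 e).1.2])).

Definition ob_raw F (e : lE G4 F) : raw F :=
  @Raw F (projT1 (projT1 e)).1.2 (projT1 (projT1 e)).2 _ _ (proj2_sig (projT2 (projT1 e))) (proj2_sig (projT2 e)).

Definition extOb : lctx :=
  @lpull G4 (fun F => {e : lE G4 F | is_mod (ob_raw e)}) (fun F e => sval e).
Definition ob_base F (e : lE extOb F) : lE G F := (projT1 (projT1 (sval e))).1.1.
Definition ob_new F (e : lE extOb F) : ocode F := exist _ (ob_raw (sval e)) (proj2_sig e).

Lemma lsub_extOb : lsub extOb G ob_base.
Proof. by rewrite /extOb; match goal with |- lsub ?H _ _ => let s := mk_lsub H G in exact s end. Qed.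

Let iRaw4 : isRaw G4 ob_mu ob_lam (fun F e => ob_raw e).
Proof. by split; lvar. Qed.

Lemma isRaw_new : isRaw extOb ob_mu ob_lam (fun F e => sval (ob_new e)).
Proof. exact: (isRaw_sub (lsub_lpull _) iRaw4). Qed.

(** A quantifier over codes unfolds into quantifiers over the size, the label and two predicates
    typed by the size, guarded by [is_mod]. *)
Lemma L_exOb (Q : forall F, lE G F -> ocode F -> Prop) :
  L extOb (fun F e => Q F (ob_base e) (ob_new e)) -> L G (fun F e => exists X, Q F e X).
Proof.
move=> LQ; have gLQ : L G4 (fun F e => exists2 h : lE extOb F, sval h = e & Q F (ob_base h) (ob_new h)).
  apply: L_guard LQ; apply: (L_iff _ (L_is_mod iRaw4)) => F e.
  by split=> [h|[[e' h] <-//]]; exists (exist _ e h).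
have k1 : isLK G2 ob_mu (fun F e => e.1.2) by lvar.
have [k1s k1d] := k1.
apply: (@L_iff _ (fun F e => exists m l A S,
   let e4 : lE G4 F := existT _ (existT _ ((e, m), l) A) S in
   exists2 h : lE extOb F, sval h = e4 & Q F (ob_base h) (ob_new h))).
  move=> F e; split=> [[m [l [A [S [h he Qh]]]]]|[[X Xm] QX]].
    by exists (ob_new h); move: Qh; rewrite /ob_base he.
  case: X Xm QX => m l A S hA hS Xm QX.
  pose e4 : lE G4 F := existT _ (existT _ ((e, m), l) (exist _ A hA)) (exist _ S hS).
  exists m, l, (exist _ A hA), (exist _ S hS).
  unshelve eexists; [exact: (exist (fun e => is_mod (ob_raw e)) e4 Xm)|by []|exact: QX].
apply: L_exK; apply: L_exK; apply: (@L_exP _ [:: ob_mu; ob_mu; ob_mu]).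
- by move=> i; rewrite !inE !orbb => /eqP->.
- by move=> F e; have /= k1e := k1d F e; rewrite /= !k1e.
apply: (@L_exP _ [:: ob_mu; ob_mu]).
- by move=> i; rewrite !inE orbb => /eqP->.
- by move=> F e; have /= k1e := k1d F (projT1 e); rewrite /= !k1e.
apply: L_iff gLQ => F e; case: e => [[[[e m] l] A] S].
by [].
Qed.
End ExtOb.


Lemma sub_pair (T : eqType) (s : seq T) a b : a \in s -> b \in s ->
  {subset [:: a; b] <= s}.
Proof. by move=> sa sb c; rewrite !inE => /orP[] /eqP->. Qed.

Section ExtMo.
Variable G : lctx.
Local Notation G2 := (extOb (extOb G)).
Local Notation X e := (ob_new (ob_base e)).
Local Notation Y e := (ob_new e).
Local Notation mX := (ob_mu G).
Local Notation lX := (ob_lam G).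
Local Notation mY := (ob_mu (extOb G)).
Local Notation lY := (ob_lam (extOb G)).
Local Notation G3 := (@lextP G2 [:: mX; mY] 0
  (fun F e => [:: mu (sval (X e)); mu (sval (Y e))])).

Let iX : isRaw G2 mX lX (fun F e => sval (X e)).
Proof. exact: isRaw_sub (lsub_extOb _) (isRaw_new G). Qed.
Let iY : isRaw G2 mY lY (fun F e => sval (Y e)).
Proof. exact: isRaw_new. Qed.
Let iX3 : isRaw G3 mX lX (fun F e => sval (X (projT1 e))).
Proof. exact: isRaw_sub (@lsub_lextP _ _ _ _) iX. Qed.
Let iY3 : isRaw G3 mY lY (fun F e => sval (Y (projT1 e))).
Proof. exact: isRaw_sub (@lsub_lextP _ _ _ _) iY. Qed.

Definition extMo : lctx := @lpull G3 (fun F => {e : lE G3 F |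
  @is_hom F (X (projT1 e)) (Y (projT1 e)) (sval (projT2 e))}) (fun F e => sval e).
Definition mo_base F (e : lE extMo F) : lE G F := ob_base (ob_base (projT1 (sval e))).
(** The predicate variable carries only a graph; [hom_graph] recovers a morphism from it, the only
    one by [graph_inj]. *)
Definition mo_new F (e : lE extMo F) : Mo F :=
  @Morphism (Codes F) (X (projT1 (sval e))) (Y (projT1 (sval e)))
    (projT1 (cid (hom_graph (proj2_sig (projT2 (sval e))) (proj2_sig e)))).

Lemma mgraph_new F (e : lE extMo F) : mgraph (mo_new e) = sval (projT2 (sval e)).
Proof. exact: (projT2 (cid (hom_graph _ _))). Qed.

Lemma lsub_extMo : lsub extMo G mo_base.
Proof.
exact: (lsub_trans (lsub_lpull _) (lsub_trans (@lsub_lextP _ _ _ _)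
  (lsub_trans (lsub_extOb _) (lsub_extOb _)))).
Qed.

Lemma isMo_new : isMo extMo mX lX mY lY mo_new.
Proof.
split; first exact: (isRaw_sub (lsub_lpull _) iX3).
  exact: (isRaw_sub (lsub_lpull _) iY3).
have [i ip iP] := isLP_sub (lsub_lpull (G := G3) (fun F (e : lE extMo F) => sval e)) (@isLP_here G2 _ _ _).
by exists i => // F e; rewrite iP mgraph_new.
Qed.

Lemma L_exMo (Q : forall F, lE G F -> Mo F -> Prop) :
  L extMo (fun F e => Q F (mo_base e) (mo_new e)) -> L G (fun F e => exists f, Q F e f).
Proof.
move=> LQ; have gLQ : L G3 (fun F e =>
    exists2 h : lE extMo F, sval h = e & Q F (mo_base h) (mo_new h)).
  apply: L_guard LQ; apply: (L_iff _ (L_is_hom iX3 iY3 (@isLP_here G2 _ _ _))) => F e.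
  by split=> [h|[[e' h] <-//]]; exists (exist _ e h).
have [[kX dX] _ _ _] := iX; have [[kY dY] _ _ _] := iY.
have L2 : L G2 (fun F e => exists H,
    exists2 h : lE extMo F, sval h = (existT _ e H : lE G3 F) & Q F (mo_base h) (mo_new h)).
  apply: (@L_exP _ [:: mX; mY]).
  - exact: sub_pair.
  - by move=> F e; congr [:: _; _]; [exact: dX|exact: dY].
  by apply: L_iff gLQ => F [e H].
have L0 : L G (fun F e => exists X Y : ocode F, exists f : hom (X : obj (Codes F)) Y,
    Q F e (Morphism f)).
  do 2!apply: L_exOb; apply: L_iff L2 => F e; split=> [[H [h hE Qh]]|[f Qf]].
    have eE : projT1 (sval h) = e by rewrite hE.
    by clear hE; subst e; exists (arrow (mo_new h)); exact: Qh.
  exists (exist _ (graph f) (@graph_sub _ _ _ f)).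
  pose e3 : lE G3 F := existT _ e (exist _ (graph f) (@graph_sub _ _ _ f)).
  pose h : lE extMo F := exist _ e3 (@graph_hom _ _ _ f).
  exists h; first by [].
  rewrite /mo_base; change (projT1 (sval h)) with e; rewrite (_ : mo_new _ = Morphism f) //; congr Morphism; apply: graph_inj.
  exact: (projT2 (cid (hom_graph _ _))).
apply: L_iff L0 => F e; split=> [[Z [T [f Qf]]]|[[Z T f] Qf]]; first by exists (Morphism f).
by exists Z, T, f.
Qed.
End ExtMo.

Lemma L_allOb G (Q : forall F, lE G F -> ocode F -> Prop) :
  L (extOb G) (fun F e => Q F (ob_base e) (ob_new e)) -> L G (fun F e => forall X, Q F e X).
Proof.
move=> /L_not LQ; apply: (L_iff _ (L_not (L_exOb (Q := fun F e x => ~ Q F e x) LQ))) => F e.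
split=> [nQ x|aQ [x]//]; apply: contrapT => nx; apply: nQ; by exists x.
Qed.

Lemma L_allMo G (Q : forall F, lE G F -> Mo F -> Prop) :
  L (extMo G) (fun F e => Q F (mo_base e) (mo_new e)) -> L G (fun F e => forall f, Q F e f).
Proof.
move=> /L_not LQ; apply: (L_iff _ (L_not (L_exMo (Q := fun F e x => ~ Q F e x) LQ))) => F e.
split=> [nQ x|aQ [x]//]; apply: contrapT => nx; apply: nQ; by exists x.
Qed.

(** The names of the cardinals are chosen before [F] and the situation: [m] for the size and [l] for
    the label. *)
Definition obs_ok (G : lctx) (os : seq nat) (eo : forall F, lE G F -> nat -> ocode F) : Prop :=
  {in os, forall i, exists m l, isRaw G m l (fun F e => sval (eo F e i))}.
Definition mos_ok (G : lctx) (ms : seq nat) (em : forall F, lE G F -> nat -> Mo F) : Prop :=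
  {in ms, forall i, exists m l n k, isMo G m l n k (fun F e => em F e i)}.

Lemma obs_ok_sub G' G r os eo : lsub G' G r -> obs_ok os eo ->
  @obs_ok G' os (fun F e => eo F (r F e)).
Proof. by move=> s ho i /ho[m [l ir]]; exists m, l; exact: isRaw_sub s ir. Qed.

Lemma mos_ok_sub G' G r ms em : lsub G' G r -> mos_ok ms em ->
  @mos_ok G' ms (fun F e => em F (r F e)).
Proof. by move=> s hm i /hm[m [l [n [k ir]]]]; exists m, l, n, k; exact: isMo_sub s ir. Qed.

Lemma with_eq (T : Type) (f : nat -> T) i x : [eta f with i |-> x] i = x.
Proof. by rewrite /= eqxx. Qed.

Lemma with_neq (T : Type) (f : nat -> T) i j x : j != i -> [eta f with i |-> x] j = f j.
Proof. by move=> /negPf /= ->. Qed.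

Lemma isRaw_ext G m l (X Y : forall F, lE G F -> raw F) : (forall F e, X F e = Y F e) ->
  isRaw G m l Y -> isRaw G m l X.
Proof.
move=> XY; suff -> : X = Y by [].
by apply/functional_extensionality_dep => F; apply/functional_extensionality_dep => e.
Qed.

Lemma isMo_ext G m l n k (f g : forall F, lE G F -> Mo F) : (forall F e, f F e = g F e) ->
  isMo G m l n k g -> isMo G m l n k f.
Proof.
move=> XY; suff -> : f = g by [].
by apply/functional_extensionality_dep => F; apply/functional_extensionality_dep => e.
Qed.

Lemma obs_ok_new G os (eo : forall F, lE G F -> nat -> ocode F) X : obs_ok os eo ->
  @obs_ok (extOb G) (X :: os) (fun F e => [eta eo F (ob_base e) with X |-> ob_new e]).
Proof.
move=> ho i; have [->|iX] := eqVneq i X => h.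
  exists (ob_mu G), (ob_lam G); apply: (isRaw_ext _ (isRaw_new G)) => F e.
  by rewrite with_eq.
have [|m [l ir]] := ho i; first by move: h; rewrite inE (negPf iX).
exists m, l; apply: (isRaw_ext _ (isRaw_sub (lsub_extOb G) ir)) => F e.
by rewrite with_neq.
Qed.

Lemma mos_ok_new G ms (em : forall F, lE G F -> nat -> Mo F) f : mos_ok ms em ->
  @mos_ok (extMo G) (f :: ms) (fun F e => [eta em F (mo_base e) with f |-> mo_new e]).
Proof.
move=> hm i; have [->|iX] := eqVneq i f => h.
  exists (ob_mu G), (ob_lam G), (ob_mu (extOb G)), (ob_lam (extOb G)).
  by apply: (isMo_ext _ (isMo_new G)) => F e; rewrite with_eq.
have [|m [l [n [k ir]]]] := hm i; first by move: h; rewrite inE (negPf iX).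
exists m, l, n, k; apply: (isMo_ext _ (isMo_sub (lsub_extMo G) ir)) => F e.
by rewrite with_neq.
Qed.

Theorem cat_definable p os ms G (eo : forall F, lE G F -> nat -> ocode F)
    (em : forall F, lE G F -> nat -> Mo F) : cat_wf os ms p -> obs_ok os eo -> mos_ok ms em ->
  L G (fun F e => @cat_sat (Codes F) (eo F e) (em F e) p).
Proof.
elim: p os ms G eo em => [f X Y|h f g|f X|X Y|f g|p IH|p IHp q IHq|p IHp q IHq
  |p IHp q IHq|X p IH|X p IH|f p IH|f p IH] os ms G eo em /=.
- move=> /and3P[fms Xos Yos] ho hm.
  have [a [b iX]] := ho X Xos; have [c [d iY]] := ho Y Yos.
  have [m [l [n [k [iS iT _]]]]] := hm f fms.
  apply: (L_iff _ (L_and (L_raw_eq iS iX) (L_raw_eq iT iY))) => F e.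
  by split=> -[]; [move=> /sval_inj ? /sval_inj|move=> <- <-].
- move=> /and3P[hms fms gms] ho hm.
  have [? [? [? [? i1]]]] := hm h hms; have [? [? [? [? i2]]]] := hm f fms.
  have [? [? [? [? i3]]]] := hm g gms; exact: L_mo_cmp i1 i2 i3.
- move=> /andP[fms Xos] ho hm; have [? [? i1]] := ho X Xos.
  have [? [? [? [? i2]]]] := hm f fms; exact: L_mo_id i2 i1.
- move=> /andP[Xos Yos] ho hm; have [? [? i1]] := ho X Xos; have [? [? i2]] := ho Y Yos.
  by apply: (L_iff _ (L_raw_eq i1 i2)) => F e; split=> [/sval_inj|->].
- move=> /andP[fms gms] ho hm; have [? [? [? [? i1]]]] := hm f fms.
  have [? [? [? [? i2]]]] := hm g gms; exact: L_mo_eq i1 i2.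
- by move=> wf ho hm; apply: L_not; exact: IH wf ho hm.
- move=> /andP[wp wq] ho hm.
  by apply: L_and; [exact: IHp wp ho hm|exact: IHq wq ho hm].
- move=> /andP[wp wq] ho hm.
  apply: (L_iff _ (L_imp (L_not (IHp _ _ _ _ _ wp ho hm)) (IHq _ _ _ _ _ wq ho hm))) => F e.
  split=> [h|[]//]; have [Hp|Hp] := pselect (@cat_sat (Codes F) (eo F e) (em F e) p); first by left.
  by right; apply: h.
- move=> /andP[wp wq] ho hm.
  by apply: L_imp; [exact: IHp wp ho hm|exact: IHq wq ho hm].
- move=> wf ho hm; apply: (@L_allOb G (fun F e x => @cat_sat (Codes F) [eta eo F e with X |-> x] (em F e) p)).
  have := IH _ _ _ _ _ wf (@obs_ok_new _ _ _ X ho) (mos_ok_sub (lsub_extOb G) hm); exact.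
- move=> wf ho hm; apply: (@L_exOb G (fun F e x => @cat_sat (Codes F) [eta eo F e with X |-> x] (em F e) p)).
  have := IH _ _ _ _ _ wf (@obs_ok_new _ _ _ X ho) (mos_ok_sub (lsub_extOb G) hm); exact.
- move=> wf ho hm; apply: (@L_allMo G (fun F e x => @cat_sat (Codes F) (eo F e) [eta em F e with f |-> x] p)).
  have := IH _ _ _ _ _ wf (obs_ok_sub (lsub_extMo G) ho) (@mos_ok_new _ _ _ f hm); exact.
- move=> wf ho hm; apply: (@L_exMo G (fun F e x => @cat_sat (Codes F) (eo F e) [eta em F e with f |-> x] p)).
  have := IH _ _ _ _ _ wf (obs_ok_sub (lsub_extMo G) ho) (@mos_ok_new _ _ _ f hm); exact.
Qed.

Theorem cat_to_L2 p : cat_sentence p -> exists2 q, L2_sentence q &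
  forall F : nzRingType, L2_holds F q <-> cat_holds (Mod F) p.
Proof.
move=> wf; have c0 F : ocode F.
  have [M _] := cid (@lmodule_inhabited F).
  by have [t _] := cid (fresh_code M [::]).
pose m0 F : Mo F := Morphism (idm (c0 F : obj (Codes F))).
(* No variable is in scope, so these values only inhabit the types of valuations. *)
pose G0 : lctx := @LCtx (fun=> unit) [::] [::] [::] [::] (fun F _ _ => 0%R)
  (fun F _ _ => mu (sval (c0 F))) (fun F _ _ => set_of_card (mu (sval (c0 F))))
  (fun F _ _ => classical_sets.set0).
have [q wq qP] := @cat_definable p [::] [::] G0 (fun F _ _ => c0 F) (fun F _ _ => m0 F) wf
  (fun i h => False_ind _ (notF h)) (fun i h => False_ind _ (notF h)).
exists q => // F; rewrite (codes_sat (fun=> c0 F) (fun=> m0 F) wf).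
rewrite -(qP F tt (fun=> 0%R) (fun=> mu (sval (c0 F))) (fun=> set_of_card (mu (sval (c0 F))))
  (fun=> classical_sets.set0)) //.
by apply: iff_sym; exact: L2_holds_sat.
Qed.

(** In both translations [q] is found before the ring, so one sentence serves [F1] and [F2] at
    once. *)
Theorem corollary1 (F1 F2 : skewfield) :
  elementarily_equivalent (Mod F1) (Mod F2) <-> L2_equivalent F1 F2.
Proof.
split=> eqF p wf.
  by have [q wq qP] := L2_to_cat wf; rewrite -!qP; exact: eqF.
by have [q wq qP] := cat_to_L2 wf; rewrite -!qP; exact: eqF.
Qed.
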